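(* Let $(\mathrm{PA}_t)_{t\ge1}$ be the preferential attachment model with parameters $m\ge2$ and $\delta\in(-m,0)$, and $\tau=3+\delta/m$. Let $V_1^t$ and $V_2^t$ be two independent uniformly random vertices in $[t]$ (independent of the graph), and let $H_t$ be the graph distance between $V_1^t$ and $V_2^t$ in $\mathrm{PA}_t$. Then $$\frac{H_t}{\log\log t}\longrightarrow\frac{4}{|\log(\tau-2)|}$$ in probability as $t\to\infty$.
   Context: Preferential attachment model with parameters $m\in\mathbb{N}$, $\delta\in(-m,\infty)$: for $s\in\mathbb{N}$ and $j\in[m]$, $\xi_{s,j}\in[s]$ denotes the vertex to which the $j$-th edge of vertex $s$ is attached. Order pairs by $(s,i)\le(t,j)$ iff $s<t$, or $s=t$ and $i\le j$; set $(t,0):=(t-1,m)$. Degrees: $D_{t,k}(v)=\sum_{(s,i)\le(t,k)}(\mathbf 1_{\{\xi_{s,i}=v\}}+\mathbf 1_{\{s=v\}})$. Set $\xi_{1,j}=1$ for all $j$, and for $t\ge2$, conditionally on $(\xi_{s,i})_{(s,i)\le(t,j-1)}$, $\xi_{t,j}=v$ with probability $(D_{t,j-1}(v)+1+j\delta/m)/c_{t,j}$ if $v=t$ and $(D_{t,j-1}(v)+\delta)/c_{t,j}$ if $v<t$, where $c_{t,j}=[m(t-1)+(j-1)](2+\delta/m)+1+\delta/m$. $\mathrm{PA}_t$ is the multigraph on $[t]$ with an edge between $s$ and $\xi_{s,i}$ for every $(s,i)\le(t,m)$. *)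

(* Defs.v *)
From HB Require Import structures.
From mathcomp Require Import all_boot all_order all_algebra.
From mathcomp Require Import all_classical all_reals all_analysis.
Set Implicit Arguments. Unset Strict Implicit. Unset Printing Implicit Defensive.
Import Order.TTheory GRing.Theory Num.Theory.
Local Open Scope ring_scope.

(* Conventions (0-based): paper vertex  k in [t]  is the ordinal  k-1 : 'I_t,
   paper edge index  j in [m]  is the ordinal  j-1 : 'I_m.
   A configuration of PA_t is  xi : {ffun 'I_t * 'I_m -> 'I_t},
   xi (s,j) = (paper) xi_{s+1,j+1} - 1. *)
Definition pa_config (t m : nat) := {ffun 'I_t * 'I_m -> 'I_t}.

Definition lexlt (p q : nat * nat) : bool :=
  (p.1 < q.1)%N || ((p.1 == q.1) && (p.2 < q.2)%N).

(* degree of vertex v just before edge (s,j) is attached: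
   paper D_{s+1, j}(v+1) (i.e. D_{t,j-1} in 1-based indices) *)
Definition pa_deg (t m : nat) (xi : pa_config t m) (s j v : nat) : nat :=
  (\sum_(p : 'I_t * 'I_m | lexlt (val p.1, val p.2) (s, j))
     ((val (xi p) == v) + (val p.1 == v)))%N.

Definition pa_step_prob (R : realType) (t m : nat) (delta : R)
    (xi : pa_config t m) (s : 'I_t) (j : 'I_m) : R :=
  let v := val (xi (s, j)) in
  if val s == 0%N then (v == 0%N)%:R else
  let D := (pa_deg xi (val s) (val j) v)%:R in
  let c := (m * val s + val j)%:R * (2 + delta / m%:R) + 1 + delta / m%:R in
  if v == val s then (D + 1 + (val j).+1%:R * delta / m%:R) / c
  else if (v < val s)%N then (D + delta) / c
  else 0.

Definition pa_weight (R : realType) (t m : nat) (delta : R)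
    (xi : pa_config t m) : R :=
  \prod_(s < t) \prod_(j < m) pa_step_prob delta xi s j.

Definition pa_adj (t m : nat) (xi : pa_config t m) (u w : 'I_t) : bool :=
  [exists j : 'I_m, (xi (u, j) == w) || (xi (w, j) == u)].

Fixpoint pa_ball (t m : nat) (xi : pa_config t m) (n : nat) (u : 'I_t)
    : {set 'I_t} :=
  match n with
  | 0 => [set u]
  | n'.+1 => pa_ball xi n' u :|:
             [set w | [exists x in pa_ball xi n' u, pa_adj xi x w]]
  end.

(* graph distance; None = infinite (not connected).  A shortest path in a
   graph with t vertices has length < t, so it suffices to search k < t. *)
Definition pa_dist (t m : nat) (xi : pa_config t m) (u w : 'I_t)
    : option nat :=
  let k := find (fun k => w \in pa_ball xi k u) (iota 0 t) in
  if (k < t)%N then Some k else None.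

Definition pa_prob (R : realType) (t m : nat) (delta : R)
    (E : pa_config t m -> 'I_t -> 'I_t -> bool) : R :=
  \sum_(xi : pa_config t m) \sum_(v1 : 'I_t) \sum_(v2 : 'I_t)
     pa_weight delta xi / (t%:R ^+ 2) * (E xi v1 v2)%:R.

(* Main.v *)
(* Put rho = 1 + delta / m = tau - 2 and beta = 1 / (1 + rho), so that beta / (1 - beta) =
   1 / rho. An edge attached at time n hits a vertex with probability proportional to its
   weight, and weights behave like Polya urns: the weight of u at time s is of order (s / u)^beta.

   Lower bound. The probability that a given self-avoiding path is present is at most the
   product over its edges of C min^(-beta) max^(beta - 1). Summing over paths whose k-th
   vertex, counted from either end, stays above t / eta_k, with log eta_k = B theta^k and
   theta^2 slightly larger than 1 / rho, shows that neither a path leaving this region nor a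
   path inside it is likely to exist with fewer than 4 log log t / |log rho| edges.

   Upper bound. Let T = t - t / q. In the graph at time T, following first edges leads a
   typical vertex to one of large constant weight. Consider the levels of vertices of weight at
   least y_k^beta, with log y_(k+1) = theta log y_k and theta slightly less than 1 / rho. Urn
   estimates bound the total weight of each level from below, so that some vertex
   born between T and t is attached both to a given vertex of level k and to level k + 1. After
   log log t / log theta levels the vertex 0 is reached, so a typical vertex is within
   2 log log t / |log rho| of it. *)
Require Import Defs.
From HB Require Import structures.
From mathcomp Require Import all_boot all_order all_algebra.
From mathcomp Require Import all_classical all_reals all_analysis.
From mathcomp Require Import zify ring lra.
Set Implicit Arguments. Unset Strict Implicit. Unset Printing Implicit Defensive.
Import Order.TTheory GRing.Theory Num.Theory numFieldNormedType.Exports.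
Local Open Scope ring_scope.

(** No probability space appears: [pexp] is a finite recursion for conditional expectations, and
    martingale arguments become one-step inequalities. Counting every edge, the one in progress
    included, with mass [rho] for its owner puts old vertices, self-loops and the deterministic
    start under one formula.

    An unrestricted first moment fails: rare paths through very old vertices dominate the expected
    number of short paths, whence the truncation. Near-optimal paths alternate between old hubs and
    young connectors, so two edges multiply log (t / birth time) by about 1 / rho; each end costs 2
    log log t / |log rho| edges, which gives the constant 4.

    For the upper bound the connectors must be fresh given the hub weights: the graph is frozen at
    time T and only the first two edges of later vertices are used. Since the number of levels grows
    with t, a constant failure probability per level is not affordable; urn failures decay with the
    level, and connection failures are controlled by the sum of waiting times. The climb starts only
    from a large constant weight, which a typical vertex lacks; this is why ancestors are followed
    first. *)

(* A history lists the targets of the edges in order of attachment; edge number e belongs to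
   vertex e %/ m. *)
Section Validity.
Variable m : nat.
Hypothesis m2 : (1 < m)%N.

(** Counts the edges numbered at most n that v owns. The successor lets the edge being attached
    already count for its owner, which gives a self-loop positive probability. *)
Definition ownw (n v : nat) : nat := minn m (n.+1 - m * v).

Definition valid (h : seq nat) : Prop :=
  forall i, (i < size h)%N -> (nth 0%N h i <= i %/ m)%N.

Definition extends (h h' : seq nat) : Prop :=
  valid h' /\ take (size h) h' = h.

Lemma m_gt0 : (0 < m)%N. Proof. lia. Qed.

Lemma valid_nil : valid [::]. Proof. by []. Qed.

Lemma valid_rcons h v : valid h -> (v <= size h %/ m)%N -> valid (rcons h v).
Proof.
move=> vh le i; rewrite size_rcons ltnS nth_rcons.
by case: ltngtP => // [/vh//|->] _.
Qed.

Lemma valid_le h u : valid h -> u \in h -> (u <= size h %/ m)%N.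
Proof.
move=> vh /(nthP 0%N) [i ilt <-]; apply: (leq_trans (vh _ ilt)).
exact/leq_div2r/ltnW.
Qed.

Lemma extends_refl h : valid h -> extends h h.
Proof. by move=> vh; split=> //; rewrite take_size. Qed.

Lemma extends_size h h' : extends h h' -> (size h <= size h')%N.
Proof. by case=> _ /(congr1 size); rewrite size_take_min => <-; exact: geq_minr. Qed.

Lemma extends_trans h1 h2 h3 : extends h1 h2 -> extends h2 h3 -> extends h1 h3.
Proof.
move=> e1 e2; split; first by case: e2.
have le := extends_size e1; case: e1 e2 => [_ e1] [_ e2].
by move: e1; rewrite -{1}e2 take_takel.
Qed.

Lemma extends_rcons h v :
  valid h -> (v <= size h %/ m)%N -> extends h (rcons h v).
Proof.
move=> vh le; split; first exact: valid_rcons.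
by rewrite -cats1 take_size_cat.
Qed.

Lemma extends_cat h h' : extends h h' -> exists g, h' = h ++ g.
Proof.
by case=> _ e; exists (drop (size h) h'); rewrite -{1}e cat_take_drop.
Qed.

Lemma extends_nth h h' i : extends h h' -> (i < size h)%N -> nth 0%N h' i = nth 0%N h i.
Proof. by move=> /extends_cat[g ->] lt; rewrite nth_cat lt. Qed.

Lemma sum_count_mem (h : seq nat) k :
  all (fun u => u < k)%N h -> (\sum_(v < k) count_mem (val v) h = size h)%N.
Proof.
elim: h => [|x h IH] /=; first by rewrite big1.
case/andP=> xk hk; rewrite big_split /= (IH hk) -add1n; congr addn.
rewrite (bigD1 (Ordinal xk)) //= eqxx big1 // => i ne.
by rewrite eq_sym; case: eqVneq => // e; case/eqP: ne; apply: val_inj.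
Qed.

Lemma sum_ownw n k : (\sum_(v < k) minn m (n - m * v) = minn (m * k) n)%N.
Proof.
elim: k => [|k IH]; first by rewrite big_ord0 muln0 min0n.
rewrite big_ord_recr /= IH mulnS; lia.
Qed.

End Validity.

(** * The attachment process and its conditional expectations *)

Section Histories.
Variables (R : realType) (m : nat) (rho : R).
Hypotheses (m2 : (1 < m)%N) (rho0 : 0 < rho) (rho1 : rho < 1).

(* With rho = 1 + delta / m, [stp h v] is the attachment probability of the next edge, for old
   vertices, for the vertex being attached, and for the deterministic loops of vertex 0. *)
Definition totw (n : nat) : R := n%:R * (1 + rho) + rho.

Definition stp (h : seq nat) (v : nat) : R :=
  ((count_mem v h)%:R + (ownw m (size h) v)%:R * rho) / totw (size h).

(** The conditional expectation of [f] at the history k edges later, given the present history. *)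
Fixpoint pexp (k : nat) (f : seq nat -> R) (h : seq nat) : R :=
  if k is k'.+1
  then \sum_(v < (size h %/ m).+1) stp h v * pexp k' f (rcons h v)
  else f h.

(** For a vertex whose m edges are all placed this is degree plus delta, since delta = m (rho - 1)
    and the degree is m plus the number of hits. *)
Definition wt (h : seq nat) (u : nat) : R := m%:R * rho + (count_mem u h)%:R.

Lemma totw_gt0 n : 0 < totw n.
Proof.
rewrite /totw; apply: ltr_wpDl => //; apply: mulr_ge0 => //. move: rho0 => ?; lra.
Qed.

Lemma totw_neq0 n : totw n != 0. Proof. exact/lt0r_neq0/totw_gt0. Qed.

Lemma stp_ge0 h v : 0 <= stp h v.
Proof.
apply: divr_ge0; last exact/ltW/totw_gt0.
by apply: addr_ge0 => //; apply: mulr_ge0 => //; exact: ltW.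
Qed.

Lemma wt_extends h h' u : extends m h h' -> wt h u <= wt h' u.
Proof.
move=> /extends_cat[g ->]; rewrite /wt lerD2l ler_nat count_cat; lia.
Qed.

Lemma wt_gt0 h u : 0 < wt h u.
Proof.
apply: ltr_wpDr => //; apply: mulr_gt0 => //; rewrite ltr0n; exact: (m_gt0 m2).
Qed.

Lemma wt_rcons h v u : wt (rcons h v) u = wt h u + (v == u)%:R.
Proof. by rewrite /wt -cats1 count_cat /= natrD addrA addn0. Qed.

Lemma stp_le h u : stp h u <= wt h u / totw (size h).
Proof.
rewrite ler_pM2r ?invr_gt0 ?totw_gt0 // addrC lerD2r ler_pM2r // ler_nat.
exact: geq_minl.
Qed.

Lemma stp_eq h u : (m * u.+1 <= (size h).+1)%N -> stp h u = wt h u / totw (size h).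
Proof.
move=> le; rewrite /stp /wt /ownw addrC; congr ((_%:R * _ + _) / _); nia.
Qed.

(** There are n hits and, with the current edge, n + 1 owned edges, so the numerators add up to n +
    (n + 1) rho = [totw n]. *)
Lemma sum_stp h : valid m h -> \sum_(v < (size h %/ m).+1) stp h v = 1.
Proof.
move=> vh; rewrite -mulr_suml big_split /= -mulr_suml -!natr_sum.
rewrite sum_count_mem; last first.
  by apply/allP => u /(valid_le vh); rewrite ltnS.
rewrite /ownw (sum_ownw m2); have -> : minn (m * (size h %/ m).+1) (size h).+1 = (size h).+1.
  by apply/minn_idPr; rewrite mulnC; apply: ltn_ceil; exact: (m_gt0 m2).
have := totw_neq0 (size h); rewrite /totw => ne.
by rewrite -natr1; field.
Qed.

Lemma pexpD a b f h : pexp (a + b) f h = pexp a (pexp b f) h.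
Proof. by elim: a h => //= a IH h; apply: eq_bigr => v _; rewrite IH. Qed.

Lemma pexp_le k f g h : valid m h ->
  (forall h', extends m h h' -> size h' = (size h + k)%N -> f h' <= g h') ->
  pexp k f h <= pexp k g h.
Proof.
elim: k h => [|k IH] h vh fg /=; first by apply: fg; [exact: extends_refl|rewrite addn0].
apply: ler_sum => v _; apply: ler_wpM2l; first exact: stp_ge0.
have ev : extends m h (rcons h v) by apply: extends_rcons => //; rewrite -ltnS.
apply: IH => [|h' e sz]; first by case: ev.
by apply: fg; [exact: extends_trans ev e|rewrite sz size_rcons addSnnS].
Qed.

Lemma eq_pexp k f g h : valid m h ->
  (forall h', extends m h h' -> size h' = (size h + k)%N -> f h' = g h') ->
  pexp k f h = pexp k g h.
Proof.
move=> vh e; apply/eqP; rewrite eq_le; apply/andP.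
by split; apply: pexp_le => // h' e1 e2; rewrite e.
Qed.

Lemma pexpM k f a h : pexp k (fun h' => a * f h') h = a * pexp k f h.
Proof.
elim: k h => //= k IH h; rewrite mulr_sumr; apply: eq_bigr => v _.
by rewrite IH mulrCA.
Qed.

Lemma pexpDf k f g h : pexp k (fun h' => f h' + g h') h = pexp k f h + pexp k g h.
Proof.
elim: k h => //= k IH h; rewrite -big_split /=; apply: eq_bigr => v _.
by rewrite IH mulrDr.
Qed.

Lemma pexp_cst k a h : valid m h -> pexp k (fun=> a) h = a.
Proof.
elim: k h => //= k IH h vh.
rewrite (eq_bigr (fun v : 'I_ _ => stp h v * a)); last first.
  by move=> v _; rewrite IH //; apply: valid_rcons => //; rewrite -ltnS.
by rewrite -mulr_suml sum_stp // mul1r.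
Qed.

Lemma pexp_const k f a h : valid m h ->
  (forall h', extends m h h' -> size h' = (size h + k)%N -> f h' = a) ->
  pexp k f h = a.
Proof. by move=> vh fa; rewrite -[RHS](pexp_cst k a vh); apply: eq_pexp. Qed.

Lemma pexp_sum k (I : Type) (r : seq I) (P : pred I) (f : I -> seq nat -> R) h :
  pexp k (fun h' => \sum_(i <- r | P i) f i h') h = \sum_(i <- r | P i) pexp k (f i) h.
Proof.
elim: k h => //= k IH h.
under eq_bigr => v _ do rewrite IH mulr_sumr.
by rewrite exchange_big.
Qed.

Lemma pexp_ge0 k f h : valid m h ->
  (forall h', extends m h h' -> size h' = (size h + k)%N -> 0 <= f h') ->
  0 <= pexp k f h.
Proof. by move=> vh f0; rewrite -(pexp_cst k 0 vh); apply: pexp_le. Qed.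

(** The supermartingale inequality for potentials. The one-step decrease is required only before the
    final time, so [F] may contain a compensating product that ends there. *)
Lemma pexp_super k F h : valid m h ->
  (forall h', extends m h h' -> (size h' < size h + k)%N ->
     \sum_(v < (size h' %/ m).+1) stp h' v * F (rcons h' v) <= F h') ->
  pexp k F h <= F h.
Proof.
elim: k h => [|k IH] h vh st //=.
have e0 : extends m h h := extends_refl vh.
apply: le_trans (st h e0 _); last by lia.
apply: ler_sum => v _; apply: ler_wpM2l; first exact: stp_ge0.
have ev : extends m h (rcons h v) by apply: extends_rcons => //; rewrite -ltnS.
apply: IH => [|h' e sz]; first by case: ev.
apply: st; first exact: extends_trans ev e.
by move: sz; rewrite size_rcons; lia.
Qed.

End Histories.

(** * Translation of configurations into histories *)

Section Configurations.
Variables (t m : nat).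
Hypothesis m2 : (1 < m)%N.

Lemma sum_tuple_cons (R : nmodType) (T : finType) n (f : n.+1.-tuple T -> R) :
  \sum_w f w = \sum_v \sum_w f (cons_tuple v w).
Proof.
rewrite pair_big /=.
rewrite (reindex (fun p : T * n.-tuple T => cons_tuple p.1 p.2)) //=.
exists (fun w => (thead w, [tuple of behead w])) => [[v w] _|w _] /=.
  by rewrite theadE; congr pair; apply: val_inj.
by apply: val_inj; case/tupleP: w.
Qed.

Definition edge_index (p : 'I_t * 'I_m) : nat := (m * p.1 + p.2)%N.

Lemma edge_index_lt p : (edge_index p < t * m)%N.
Proof. case: p => [[s lts] [j ltj]]; rewrite /edge_index /=; nia. Qed.

Lemma edge_of_subproof (i : 'I_(t * m)) : (i %/ m < t)%N && (i %% m < m)%N.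
Proof. by rewrite ltn_divLR ?ltn_mod; [rewrite ltn_ord /=|]; lia. Qed.

Definition edge_of (i : 'I_(t * m)) : 'I_t * 'I_m :=
  (Ordinal (proj1 (andP (edge_of_subproof i))),
   Ordinal (proj2 (andP (edge_of_subproof i)))).

Lemma edge_ofK i : edge_index (edge_of i) = i.
Proof. by rewrite /edge_index /= mulnC -divn_eq. Qed.

Lemma edge_indexK p : edge_of (Ordinal (edge_index_lt p)) = p.
Proof.
case: p => s j; congr pair; apply: val_inj; rewrite /= /edge_index /=.
  by rewrite mulnC divnMDl ?divn_small ?addn0 //; lia.
by rewrite mulnC modnMDl modn_small.
Qed.

Definition history (xi : pa_config t m) : (t * m).-tuple 'I_t :=
  [tuple xi (edge_of i) | i < t * m].

Lemma nth_history xi p : nth 0%N (map val (history xi)) (edge_index p) = val (xi p).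
Proof.
have lt := edge_index_lt p.
have t0 : 'I_t by exact: p.1.
rewrite (nth_map t0) ?size_tuple //.
have -> : edge_index p = Ordinal (edge_index_lt p) by [].
by rewrite -tnth_nth tnth_mktuple edge_indexK.
Qed.

(** The default [p.1] is taken only for an entry that is not below t, which a valid history does not
    have at these positions. *)
Definition config (h : seq nat) : pa_config t m :=
  [ffun p => odflt p.1 (insub (nth 0%N h (edge_index p)))].

Lemma historyK xi : config (map val (history xi)) = xi.
Proof. by apply/ffunP => p; rewrite ffunE nth_history valK. Qed.

Lemma configE h p : (nth 0%N h (edge_index p) < t)%N ->
  val (config h p) = nth 0%N h (edge_index p).
Proof. by move=> lt; rewrite ffunE insubT. Qed.

Lemma history_bij : bijective history.
Proof.
exists (fun w : (t * m).-tuple 'I_t => [ffun p => tnth w (Ordinal (edge_index_lt p))]).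
  by move=> xi; apply/ffunP => p; rewrite ffunE tnth_mktuple edge_indexK.
move=> w; apply/eq_from_tnth => i; rewrite tnth_mktuple ffunE; congr tnth.
by apply: val_inj; rewrite /= edge_ofK.
Qed.

Lemma sum_own n v : (\sum_(i < n) (i %/ m == v) = minn m (n - m * v))%N.
Proof.
elim: n => [|n IH]; first by rewrite big_ord0 sub0n minn0.
rewrite big_ord_recr /= IH.
have := divn_eq n m; have : (n %% m < m)%N by rewrite ltn_mod; lia.
case: eqP => [<-|]; nia.
Qed.

Lemma big_edge (P : pred nat) (F : nat -> nat) :
  (\sum_(p : 'I_t * 'I_m | P (edge_index p)) F (edge_index p)
   = \sum_(i < t * m | P i) F i)%N.
Proof.
rewrite (reindex edge_of); last first.
  exists (fun p => Ordinal (edge_index_lt p)) => [i _|p _]; last exact: edge_indexK.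
  by apply: val_inj; rewrite /= edge_ofK.
by apply: eq_big => i *; rewrite edge_ofK.
Qed.

Lemma lexltE (p : 'I_t * 'I_m) (s : 'I_t) (j : 'I_m) :
  lexlt (val p.1, val p.2) (val s, val j) = (edge_index p < edge_index (s, j))%N.
Proof.
case: p => [[a la] [b lb]]; case: s j => [s ls] [j lj].
rewrite /lexlt /edge_index /=; case: (ltngtP a s) => [lt|lt|->] /=.
- by symmetry; nia.
- by symmetry; apply/negbTE; rewrite -leqNgt; nia.
by rewrite ltn_add2l.
Qed.

Lemma pa_degE (xi : pa_config t m) (s : 'I_t) (j : 'I_m) v :
  let n := edge_index (s, j) in
  pa_deg xi (val s) (val j) v =
  (count_mem v (take n (map val (history xi))) + minn m (n - m * v))%N.
Proof.
move=> n; pose h := map val (history xi).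
have szh : size h = (t * m)%N by rewrite size_map size_tuple.
have nlt : (n < t * m)%N := edge_index_lt (s, j).
transitivity (\sum_(i < t * m | (i < n)%N) ((nth 0%N h i == v) + (i %/ m == v)))%N.
  rewrite -(big_edge (fun i => i < n)%N (fun i => (nth 0%N h i == v) + (i %/ m == v)))%N.
  apply: eq_big => [p|p _]; first by rewrite lexltE.
  rewrite nth_history; congr (_ + (_ == _))%N.
  rewrite /edge_index mulnC divnMDl ?divn_small ?addn0 //; lia.
rewrite -(big_ord_widen _ (fun i => (nth 0%N h i == v) + (i %/ m == v))%N (ltnW nlt)).
rewrite big_split /= sum_own; congr addn.
rewrite -sum1_count (big_nth 0%N) size_takel ?szh ?(ltnW nlt) // big_mkord.
rewrite [LHS](eq_bigr (fun i : 'I_n => if nth 0%N h i == v then 1 else 0)%N); last first.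
  by move=> i _; case: ifP.
by rewrite -big_mkcond /=; apply: eq_bigl => i; rewrite nth_take.
Qed.

Variables (R : realType) (rho : R).
Hypotheses (rho0 : 0 < rho) (rho1 : rho < 1).

(** Tuples over ['I_t] also list targets not yet born, over which [pexp] does not sum; the value 0
    there reconciles the two. *)
Definition stp0 (h : seq nat) (v : nat) : R :=
  if (v <= size h %/ m)%N then stp m rho h v else 0.

Lemma pexp_tuple n (f : seq nat -> R) h : (size h + n <= t * m)%N ->
  \sum_(w : n.-tuple 'I_t)
     (\prod_(i < n) stp0 (h ++ take i (map val w)) (nth 0%N (map val w) i))
     * f (h ++ map val w) = pexp m rho n f h.
Proof.
elim: n h => [|n IH] h le /=.
  rewrite (bigD1 [tuple]) //= big_ord0 mul1r cats0 big1 ?addr0 // => w.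
  by move=> /eqP[]; exact: tuple0.
rewrite sum_tuple_cons.
have lt : (size h %/ m < t)%N by rewrite ltn_divLR; lia.
pose G v := \sum_(w : n.-tuple 'I_t) stp0 h v *
  ((\prod_(i < n) stp0 (rcons h v ++ take i (map val w)) (nth 0%N (map val w) i))
   * f (rcons h v ++ map val w)).
transitivity (\sum_(v < t) G v).
  apply: eq_bigr => v _; apply: eq_bigr => w _.
  rewrite big_ord_recl /= cats0 mulrA; congr (_ * _ * f _); last by rewrite cat_rcons.
  by apply: eq_bigr => i _; rewrite /= cat_rcons.
rewrite (big_ord_widen _ (fun v => stp m rho h v * pexp m rho n f (rcons h v)) lt).
rewrite [LHS](bigID (fun v : 'I_t => val v < (size h %/ m).+1)%N) /=.
rewrite [X in _ + X]big1 ?addr0; last first.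
  by move=> v; rewrite ltnS => /negbTE nv; apply: big1 => w _; rewrite /stp0 nv mul0r.
apply: eq_bigr => v lv; rewrite /G -mulr_sumr IH ?size_rcons ?addSnnS //.
by rewrite /stp0 -ltnS lv.
Qed.

Lemma pa_step_stp (delta : R) xi (s : 'I_t) (j : 'I_m) :
  let h := map val (history xi) in
  let n := edge_index (s, j) in
  rho = 1 + delta / m%:R -> valid m (take n h) ->
  pa_step_prob delta xi s j = stp0 (take n h) (nth 0%N h n).
Proof.
move=> h n rhoE vh; rewrite /pa_step_prob pa_degE nth_history.
have szh : size h = (t * m)%N by rewrite size_map size_tuple.
have nlt : (n < t * m)%N := edge_index_lt (s, j).
have szt : size (take n h) = n by rewrite size_takel // szh ltnW.
have ndiv : (n %/ m = s)%N.
  by rewrite /n /edge_index /= mulnC divnMDl ?divn_small ?addn0 //; lia.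
have mR : m%:R != 0 :> R by rewrite pnatr_eq0; lia.
have deltaE : delta = m%:R * (rho - 1) by rewrite rhoE; field.
rewrite /stp0 szt ndiv /stp szt -/h -/n.
set v := val (xi (s, j)).
have nE : n = (m * s + j)%N by [].
(* For the edges of vertex 0 all n previous targets are 0 and all n + 1 edges are its own, so the
   general formula gives n + (n + 1) rho over [totw], which is 1. *)
case: eqP => [s0|s0].
  have s0' : nat_of_ord s = 0%N := s0.
  rewrite s0' leqn0; case: eqP => // ->.
  have -> : count_mem 0%N (take n h) = n.
    rewrite -[RHS]szt; apply/eqP; rewrite -all_count; apply/allP => x /(nthP 0%N)[i].
    rewrite szt => ilt <-; rewrite /= -leqn0; apply: leq_trans (vh i _) _; first by rewrite szt.
    by rewrite divn_small //; have := ltn_ord j; move: ilt; rewrite nE s0'; lia.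
  have -> : ownw m n 0 = n.+1.
    by rewrite /ownw nE s0'; have := ltn_ord j; lia.
  have <- : totw rho n = n%:R + n.+1%:R * rho by rewrite /totw -natr1; ring.
  by rewrite divff ?totw_neq0.
have -> : (m * s + j)%:R * (2 + delta / m%:R) + 1 + delta / m%:R = totw rho n.
  by rewrite /totw -nE rhoE; ring.
(* Self-loop: j own edges precede, so D + 1 + (j + 1) delta / m is the number of hits plus (j + 1)
   rho. *)
case: eqP => [vs|vs].
  rewrite vs leqnn; congr (_ / _).
  have -> : minn m (n - m * s) = j by rewrite nE; have := ltn_ord j; lia.
  have -> : ownw m n s = j.+1 by rewrite /ownw nE; have := ltn_ord j; lia.
  by rewrite deltaE natrD -natr1; field.
case: ltnP => vlt; last first.
  by case: ifP => //; rewrite leq_eqVlt; case: eqP => //=; rewrite ltnNge vlt.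
rewrite (ltnW vlt); congr (_ / _).
have le : (m * v + m <= m * nat_of_ord s)%N.
  by rewrite addnC -mulnS leq_mul2l; apply/orP; right; exact: vlt.
have -> : minn m (n - m * v) = m by rewrite nE; lia.
have -> : ownw m n v = m by rewrite /ownw nE; lia.
by rewrite deltaE natrD; ring.
Qed.

Lemma pa_weight_stp (delta : R) xi : rho = 1 + delta / m%:R ->
  pa_weight delta xi =
  \prod_(i < t * m) stp0 (take i (map val (history xi))) (nth 0%N (map val (history xi)) i).
Proof.
move=> rhoE; set h := map val (history xi).
have szh : size h = (t * m)%N by rewrite size_map size_tuple.
rewrite /pa_weight pair_big /=.
rewrite (reindex edge_of) /=; last first.
  exists (fun p => Ordinal (edge_index_lt p)) => [i _|p _]; last exact: edge_indexK.
  by apply: val_inj; rewrite /= edge_ofK.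
have eR (i : 'I_(t * m)) : edge_index ((edge_of i).1, (edge_of i).2) = i by exact: edge_ofK.
have [vh|nvh] := pselect (valid m h).
  apply: eq_bigr => i _; rewrite pa_step_stp // ?eR // => k.
  rewrite -/h size_takel ?szh; last exact: ltnW.
  by move=> ki; rewrite nth_take // vh // szh (ltn_trans ki).
(* An invalid configuration sends some edge to an unborn vertex, and both products vanish at that
   factor. *)
have {nvh} [k ksz kv] : exists2 k, (k < t * m)%N & (k %/ m < nth 0%N h k)%N.
  apply: contrapT => ne; apply: nvh => i; rewrite szh => ilt.
  by rewrite leqNgt; apply/negP => lt; apply: ne; exists i.
rewrite (bigD1 (Ordinal ksz)) //= [RHS](bigD1 (Ordinal ksz)) //=.
have -> : stp0 (take k h) (nth 0%N h k) = 0.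
  have sk : size (take k h) = k by rewrite size_takel // szh ltnW.
  by rewrite /stp0 sk leqNgt kv.
rewrite mul0r; apply/eqP; rewrite mulf_eq0; apply/orP; left.
rewrite /pa_step_prob -[(Ordinal _, Ordinal _)]/(edge_of (Ordinal ksz)).
rewrite -nth_history edge_ofK -/h /=.
rewrite (gtn_eqF kv) (gtn_eqF (leq_ltn_trans (leq0n _) kv)).
by rewrite [(nth 0 h k < k %/ m)%N]ltnNge (ltnW kv) /=; case: ifP.
Qed.

(** The averages over the two vertices stay outside the expectation, so later estimates concern two
    fixed vertices. *)
Lemma pa_prob_pexp (delta : R) (E : pa_config t m -> 'I_t -> 'I_t -> bool) :
  rho = 1 + delta / m%:R ->
  pa_prob delta E = \sum_(v1 : 'I_t) \sum_(v2 : 'I_t)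
    pexp m rho (t * m) (fun h => (E (config h) v1 v2)%:R) [::] / t%:R ^+ 2.
Proof.
move=> rhoE; rewrite /pa_prob exchange_big /=; apply: eq_bigr => v1 _.
rewrite exchange_big /=; apply: eq_bigr => v2 _.
rewrite -pexp_tuple //= mulr_suml (reindex history) /=; last first.
  by apply: onW_bij; exact: history_bij.
apply: eq_bigr => xi _; rewrite historyK -(pa_weight_stp xi rhoE).
by rewrite -!mulrA; congr (_ * _); rewrite mulrC.
Qed.

End Configurations.

(** * Graph distance in terms of walks read off a history *)

Section Distances.
Variables (t m : nat).
Hypothesis m2 : (1 < m)%N.

Lemma pa_ballP (xi : pa_config t m) n u w :
  reflect (exists p, [/\ path (pa_adj xi) u p, last u p = w & (size p <= n)%N])
          (w \in pa_ball xi n u).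
Proof.
elim: n w => [|n IH] w /=.
  rewrite inE; apply: (iffP eqP) => [->|]; first by exists [::].
  by case=> [[|x p] []].
rewrite !inE; apply: (iffP orP) => [[/IH[p [pp lp sp]]|/existsP[x /andP[/IH[p [pp lp sp]] xw]]]|].
- by exists p; split=> //; exact: ltnW.
- exists (rcons p w); rewrite rcons_path pp lp xw last_rcons size_rcons; split=> //.
case=> p [pp lp sp]; case/lastP: p pp lp sp => [|p x].
  by move=> _ <- _; left; apply/IH; exists [::].
rewrite rcons_path last_rcons size_rcons => /andP[pp ax] <- sp.
by right; apply/existsP; exists (last u p); rewrite ax andbT; apply/IH; exists p.
Qed.

(** Self-avoidance makes the edges of the path distinct and meets each vertex in at most two of
    them, on which the product bound for path probabilities rests. *)
Lemma pa_dist_uniq_path (xi : pa_config t m) u w k : pa_dist xi u w = Some k ->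
  exists p, [/\ path (pa_adj xi) u p, last u p = w, uniq (u :: p) & (size p <= k)%N].
Proof.
rewrite /pa_dist; set q := find _ _; case: ifP => // qt [<-].
have hq : has (fun k => w \in pa_ball xi k u) (iota 0 t) by rewrite has_find size_iota.
have /pa_ballP[p [pp lp sp]] := nth_find 0%N hq.
move: sp; rewrite -/q nth_iota // add0n => sp.
case/shortenP: pp lp => p' pp' up' sub lp.
exists p'; split=> //; apply: leq_trans sp; apply: uniq_leq_size sub.
by case/andP: up'.
Qed.

Lemma path_pa_dist (xi : pa_config t m) u p : path (pa_adj xi) u p ->
  exists2 k, pa_dist xi u (last u p) = Some k & (k <= size p)%N.
Proof.
move=> pp; set w := last u p.
have [p' [pp' lp' sp' st]] : exists p', [/\ path (pa_adj xi) u p', last u p' = w,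
    (size p' <= size p)%N & (size p' < t)%N].
  rewrite /w; case/shortenP: pp => p' pp' up' sub; exists p'; split=> //.
    by apply: uniq_leq_size sub; case/andP: up'.
  by rewrite -[X in (_ < X)%N]card_ord -[(size p').+1]/(size (u :: p')) -(card_uniqP up') max_card.
rewrite /pa_dist; set q := find _ _.
have qle : (q <= size p')%N.
  rewrite leqNgt; apply/negP => lt; have := before_find 0%N lt.
  rewrite nth_iota // add0n => /negbT/pa_ballP[]; by exists p'.
by rewrite (leq_ltn_trans qle st); exists q => //; exact: leq_trans sp'.
Qed.

Definition hadj (h : seq nat) (u w : nat) : bool :=
  has (fun j => (nth 0 h (m * u + j) == w) || (nth 0 h (m * w + j) == u))%N (iota 0 m).

Lemma hadj_sym h u w : hadj h u w = hadj h w u.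
Proof. by apply: eq_has => j; rewrite orbC. Qed.

Lemma hadjP h u w : reflect
  (exists2 j, (j < m)%N & nth 0%N h (m * u + j) = w \/ nth 0%N h (m * w + j) = u)
  (hadj h u w).
Proof.
apply: (iffP hasP) => [[j]|[j jm e]].
  by rewrite mem_iota /= => jm /orP[/eqP e|/eqP e]; exists j => //; [left|right].
by exists j; rewrite ?mem_iota //; apply/orP; case: e => ->; rewrite eqxx; [left|right].
Qed.

Lemma valid_bound h i : valid m h -> size h = (t * m)%N -> (i < t * m)%N ->
  (nth 0%N h i < t)%N.
Proof.
move=> vh sz lt; apply: leq_ltn_trans (vh i _) _; rewrite ?sz //.
by rewrite ltn_divLR //; lia.
Qed.

Lemma pa_adj_config h (u w : 'I_t) : valid m h -> size h = (t * m)%N ->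
  pa_adj (config t m h) u w = hadj h u w.
Proof.
move=> vh sz.
have cfgE (x : 'I_t) (j : 'I_m) : val (config t m h (x, j)) = nth 0%N h (m * x + j).
  have lt := edge_index_lt m2 (x, j).
  by rewrite configE // valid_bound.
apply/existsP/hadjP => [[j /orP[]/eqP e]|[j jm e]].
- by exists j => //; left; rewrite -cfgE e.
- by exists j => //; right; rewrite -cfgE e.
exists (Ordinal jm); apply/orP; case: e => e; [left|right]; apply/eqP/val_inj;
  by rewrite cfgE.
Qed.

(** The bound by t on every vertex matters: beyond the end of a history [nth] answers 0 and would
    create spurious edges to vertex 0. *)
Definition reach (h : seq nat) (u w k : nat) : Prop :=
  exists p, [/\ path (hadj h) u p, all (fun x => x < t)%N (u :: p),
                last u p = w & (size p <= k)%N].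

Lemma reach_refl h u : (u < t)%N -> reach h u u 0.
Proof. by move=> ut; exists [::]; rewrite /= ut. Qed.

Lemma reach_trans h u v w k l : reach h u v k -> reach h v w l -> reach h u w (k + l).
Proof.
move=> [p [pp ap lp sp]] [q [pq aq lq sq]]; exists (p ++ q); split.
- by rewrite cat_path pp lp.
- by rewrite -cat_cons all_cat ap; case/andP: aq.
- by rewrite last_cat lp.
by rewrite size_cat leq_add.
Qed.

Lemma reach_adj h u w : (u < t)%N -> (w < t)%N -> hadj h u w -> reach h u w 1.
Proof. by move=> ut wt a; exists [:: w]; rewrite /= ut wt a. Qed.

Lemma reach_sym h u w k : reach h u w k -> reach h w u k.
Proof.
move=> [p [pp ap lp sp]]; exists (rev (belast u p)); split.
- rewrite -lp rev_path; apply: sub_path pp => x y; by rewrite /= hadj_sym.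
- by rewrite -lp -[last u p :: _]rev_rcons -lastI all_rev.
- by case: p lp {pp ap sp} => [<-//|x p]; rewrite /= rev_cons last_rcons.
by rewrite size_rev size_belast.
Qed.

Lemma reachW h u w k l : (k <= l)%N -> reach h u w k -> reach h u w l.
Proof. by move=> kl [p [pp ap lp sp]]; exists p; split=> //; exact: leq_trans kl. Qed.

Lemma reach_pa_dist h (u w : 'I_t) k : valid m h -> size h = (t * m)%N ->
  reach h u w k -> exists2 l, pa_dist (config t m h) u w = Some l & (l <= k)%N.
Proof.
move=> vh sz [p [pp ap lp sp]].
have [q qE] : exists q : seq 'I_t, map val q = p.
  exists (pmap insub p); rewrite (pmap_filter (insubK _)).
  by apply/all_filterP; apply/allP => x xp; rewrite isSome_insub; move/allP: ap; apply; rewrite inE xp orbT.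
have pq : path (pa_adj (config t m h)) u q.
  rewrite -(eq_path (e := relpre val (hadj h))) -?path_map ?qE //.
  by move=> x y; rewrite /= pa_adj_config.
have [l dl ll] := path_pa_dist pq.
exists l; last by apply: leq_trans ll _; rewrite -(size_map val) qE.
by rewrite -dl; congr pa_dist; apply: val_inj; rewrite -last_map qE.
Qed.

Lemma pa_dist_hpath h (u w : 'I_t) k : valid m h -> size h = (t * m)%N ->
  pa_dist (config t m h) u w = Some k ->
  exists p, [/\ path (hadj h) (val u) p, all (fun x => x < t)%N (val u :: p), last (val u) p = w,
     uniq (val u :: p) & (size p <= k)%N].
Proof.
move=> vh sz /pa_dist_uniq_path[q [pq lq uq sq]].
exists (map val q); split.
- rewrite path_map -(eq_path (e := pa_adj (config t m h))) // => x y.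
  by rewrite /= pa_adj_config.
- by rewrite -map_cons all_map; apply/allP => x _ /=.
- by rewrite last_map lq.
- by rewrite -map_cons map_inj_uniq //; exact: val_inj.
by rewrite size_map.
Qed.

End Distances.

(** * Elementary inequalities for real powers *)

Section Powers.
Variable R : realType.
Implicit Types a b x : R.

Lemma ln_le_sub1 x : 0 < x -> ln x <= x - 1.
Proof.
move=> x0; have e : x = 1 + (x - 1) by ring.
by rewrite {1}e; apply: le_ln1Dx; lra.
Qed.

Lemma powRE a x : 0 < a -> a `^ x = expR (x * ln a).
Proof. by move=> a0; rewrite /powR gt_eqF. Qed.

Lemma powRB1 a x : 0 < x -> x `^ (a - 1) = x `^ a / x.
Proof.
move=> x0; rewrite powRB; last by rewrite (gt_eqF x0) implybT.
by rewrite powRr1 // ltW.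
Qed.

Lemma powR_divr a x y : 0 <= x -> 0 < y -> (x / y) `^ a = x `^ a / y `^ a.
Proof.
move=> x0 y0; have y0' := ltW y0; rewrite powRM ?invr_ge0 //; congr (_ * _).
by rewrite -[y^-1]powR_inv1 // -powRrM mulN1r powRN.
Qed.

Lemma powR_mono a x y : 0 <= a -> 0 <= x -> x <= y -> x `^ a <= y `^ a.
Proof.
by move=> a0 x0 xy; apply: ge0_ler_powR; rewrite ?nnegrE //; exact: le_trans xy.
Qed.

Lemma powR_antimono a x y : 0 <= a -> 0 < x -> x <= y -> y `^ (- a) <= x `^ (- a).
Proof.
move=> a0 x0 xy; have y0 : 0 < y by exact: lt_le_trans xy.
rewrite !powRN lef_pV2 ?posrE ?powR_gt0 //; apply: powR_mono => //; exact: ltW.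
Qed.

(** Weighted arithmetic-geometric mean inequality for x and 1: with w their mean, the tangent bound
    on ln is applied to x / w and 1 / w, and the weighted linear terms cancel. *)
Lemma powR_bernoulli x b : 0 < x -> 0 <= b -> b <= 1 -> x `^ b <= 1 - b + b * x.
Proof.
move=> x0 b0 b1; set w := _ + b * x.
have w0 : 0 < w by rewrite /w; have := mulr_ge0 b0 (ltW x0); case: (ltrP b 1) => ?; nra.
rewrite powRE // -[leRHS]lnK ?posrE // ler_expR.
have l1 : ln x - ln w <= x / w - 1.
  by rewrite -ln_div ?posrE //; apply: ln_le_sub1; rewrite divr_gt0.
have l2 : - ln w <= w^-1 - 1.
  by rewrite -lnV ?posrE //; apply: ln_le_sub1; rewrite invr_gt0.
have e : b * (x / w - 1) + (1 - b) * (w^-1 - 1) = 0.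
  have -> : b * (x / w - 1) + (1 - b) * (w^-1 - 1) = w / w - 1 by rewrite /w; ring.
  by rewrite divff ?subrr // gt_eqF.
have b1' : 0 <= 1 - b by rewrite subr_ge0.
have := ler_wpM2l b0 l1; have := ler_wpM2l b1' l2; lra.
Qed.

End Powers.

(** * Joint probability that prescribed edges hit prescribed vertices *)

Section HitProbability.
Variables (R : realType) (m : nat) (rho : R).
Hypotheses (m2 : (1 < m)%N) (rho0 : 0 < rho) (rho1 : rho < 1).

Local Notation totw := (totw rho).
Local Notation stp := (stp m rho).
Local Notation wt := (wt m rho).
Local Notation pexp := (pexp m rho).

Definition beta : R := (1 + rho)^-1.

Lemma beta_gt0 : 0 < beta.
Proof. by rewrite invr_gt0; apply: addr_gt0. Qed.

Lemma beta_lt1 : beta < 1.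
Proof. by rewrite invf_lt1; [rewrite ltrDl|apply: addr_gt0]. Qed.

Lemma beta_eq : beta * (1 + rho) = 1.
Proof. by rewrite mulVf // gt_eqF // addr_gt0. Qed.

Lemma beta_gt_half : 2^-1 < beta.
Proof. by rewrite ltf_pV2 ?posrE ?addr_gt0 // ltrD2l. Qed.

Lemma totwE n : totw n = (n%:R + 1 - beta) / beta.
Proof.
have b0 : beta != 0 by rewrite gt_eqF // beta_gt0.
rewrite /totw; have -> : rho = beta^-1 - 1 by rewrite /beta invrK; ring.
by field.
Qed.

(** Bernoulli at i / (i + 1), inverted: since [totw i] is (i + 1 - beta) / beta, the reciprocal of
    the Bernoulli bound is exactly the left side. *)
Lemma succ_totw_le (i : nat) : (0 < i)%N ->
  1 + (totw i)^-1 <= (i.+1%:R / i%:R) `^ beta.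
Proof.
move=> i0; have iR : 0 < i%:R :> R by rewrite ltr0n.
have b0 := beta_gt0; have b1 := beta_lt1.
have := @powR_bernoulli R (i%:R / i.+1%:R) beta.
rewrite divr_gt0 ?ltr0n // (ltW b0) (ltW b1) => /(_ isT isT isT) le.
have p0 : 0 < (i%:R / i.+1%:R) `^ beta :> R by rewrite powR_gt0 // divr_gt0 ?ltr0n.
have -> : (i.+1%:R / i%:R) `^ beta = ((i%:R / i.+1%:R) `^ beta)^-1 :> R.
  by rewrite -[in LHS]invf_div -[X in X `^ _]powR_inv1 ?divr_ge0 // -powRrM mulN1r powRN.
have e : 1 + (totw i)^-1 = (1 - beta + beta * (i%:R / i.+1%:R))^-1.
  rewrite totwE -natr1; field; repeat (apply/andP; split); lra.
by rewrite e lef_pV2 ?posrE //; apply: lt_le_trans le.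
Qed.

Lemma prod_totw_le a b : (0 < a)%N -> (a <= b)%N ->
  \prod_(a <= i < b) (1 + (totw i)^-1) <= (b%:R / a%:R) `^ beta.
Proof.
move=> a0; elim: b => [|b IH].
  by rewrite leqn0 => /eqP e; rewrite e in a0.
rewrite leq_eqVlt => /orP[/eqP <-|]; first by rewrite big_geq // divff ?powR1 // pnatr_eq0 -lt0n.
rewrite ltnS => ab; rewrite big_nat_recr //=.
have b0 : (0 < b)%N by exact: leq_trans ab.
apply: le_trans (_ : (b%:R / a%:R) `^ beta * (b.+1%:R / b%:R) `^ beta <= _).
  apply: ler_pM; [|by rewrite addr_ge0 ?invr_ge0 // ltW // totw_gt0|exact: IH|exact: succ_totw_le].
  by apply: prodr_ge0 => i _; rewrite addr_ge0 ?invr_ge0 // ltW // totw_gt0.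
rewrite -powRM ?divr_ge0 //.
have -> // : b%:R / a%:R * (b.+1%:R / b%:R) = b.+1%:R / a%:R :> R.
by field; rewrite !pnatr_eq0 -!lt0n a0 b0.
Qed.

(* A product of rising factorials of the weights: each hit of u consumes one factor. *)
Fixpoint pending (K : seq nat) (h : seq nat) : R :=
  if K is u :: K' then (wt h u + (count_mem u K')%:R) * pending K' h else 1.

Lemma pending_gt0 K h : 0 < pending K h.
Proof.
by elim: K => //= u K IH; apply: mulr_gt0 => //; apply: ltr_wpDr => //; exact: wt_gt0.
Qed.

(** Raising the weight w of v by one turns w (w + 1) ... (w + c - 1) into (w + 1) ... (w + c), a
    factor 1 + c / w. *)
Lemma pending_rcons K h v :
  pending K (rcons h v) = pending K h * (1 + (count_mem v K)%:R / wt h v).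
Proof.
have w0 : wt h v != 0 by rewrite gt_eqF // wt_gt0.
elim: K => [|u K IH] /=; first by rewrite mul0r addr0 mulr1.
rewrite IH wt_rcons; case: (eqVneq u v) => [->|uv].
  by rewrite natrD; field.
by rewrite addr0 add0n mulrA.
Qed.

Lemma pending_hit K h u :
  stp h u * pending K (rcons h u) <= pending (u :: K) h / totw (size h).
Proof.
apply: le_trans (ler_wpM2r (ltW (pending_gt0 _ _)) (stp_le _ _ _ _)) _ => //.
rewrite pending_rcons /= le_eqVlt; apply/orP; left; apply/eqP.
have w0 : wt h u != 0 by rewrite gt_eqF // wt_gt0.
by field; rewrite totw_neq0.
Qed.

Definition born (n : nat) (u : nat) : R := (m * u <= n)%N%:R.

Lemma prodr_1D_ge (I : Type) (r : seq I) (f : I -> R) : (forall i, 0 <= f i) ->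
  1 + \sum_(i <- r) f i <= \prod_(i <- r) (1 + f i).
Proof.
move=> f0; elim: r => [|i r IH]; first by rewrite !big_nil addr0.
rewrite !big_cons; have := f0 i; have := IH.
have : 0 <= \sum_(j <- r) f j by apply: sumr_ge0.
nra.
Qed.

(** A hit of v has probability at most [wt / totw] and multiplies the product by 1 + count / [wt].
    The weights cancel, each listed vertex already born contributes 1 / [totw], and 1 plus the sum
    is at most the product. *)
Lemma pending_step K h : valid m h ->
  \sum_(v < (size h %/ m).+1) stp h v * pending K (rcons h v) <=
  pending K h * \prod_(u <- K) (1 + born (size h) u / totw (size h)).
Proof.
move=> vh; set n := size h.
have c0 := totw_gt0 rho0 n.
under [leLHS]eq_bigr => v _ do rewrite pending_rcons mulrCA.
rewrite -mulr_sumr ler_pM2l ?pending_gt0 //.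
under [leLHS]eq_bigr => v _ do rewrite mulrDr mulr1.
rewrite big_split /= sum_stp //.
apply: le_trans (prodr_1D_ge _ _); last first.
  by move=> u; rewrite divr_ge0 // ltW.
rewrite lerD2l -mulr_suml.
apply: (@le_trans _ _ (\sum_(v < (n %/ m).+1) (count_mem (val v) K)%:R / totw n)).
  apply: ler_sum => v _; have w0 := wt_gt0 m2 rho0 h v.
  rewrite mulrCA ler_wpM2l // ler_pdivrMr // mulrC.
  exact: stp_le.
rewrite -mulr_suml ler_pM2r ?invr_gt0 // -natr_sum.
have -> : \sum_(u <- K) born n u = (\sum_(u <- K) (m * u <= n)%N)%:R :> R.
  by rewrite natr_sum.
rewrite ler_nat; elim: K => [|u K IH] /=; first by rewrite big_nil big1.
rewrite big_cons big_split /= leq_add //.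
have [le|lt] := leqP (m * u) n.
  have us : (u < (n %/ m).+1)%N by rewrite ltnS leq_divRL 1?mulnC //; lia.
  rewrite (bigD1 (Ordinal us)) //= eqxx big1 // => v /eqP nv.
  by case: eqP => // e; case: nv; apply: val_inj.
rewrite big1 // => v _; case: eqP => // e.
have := ltn_ord v; rewrite -e ltnS leq_divRL; lia.
Qed.

(** The price of a hit of u by edge e: 1 / [totw e] per unit of weight, times a bound on the
    expected growth factor of that weight between times n and e. *)
Definition psi (n u e : nat) : R :=
  (totw e)^-1 * \prod_(n <= i < e) (1 + born i u / totw i).

Lemma growth_ge1 i u : 1 <= 1 + born i u / totw i.
Proof. by rewrite lerDl divr_ge0 // ltW // totw_gt0. Qed.

Lemma pending_evolve K h d : valid m h ->
  pexp d (pending K) h <= pending K h *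
    \prod_(u <- K) \prod_(size h <= i < size h + d) (1 + born i u / totw i).
Proof.
elim: d h => [|d IH] h vh /=.
  by rewrite big1 ?mulr1 // => u _; rewrite addn0 big_geq.
have G0 u n k : 0 <= \prod_(n <= i < k) (1 + born i u / totw i).
  by apply: prodr_ge0 => i _; apply: le_trans (growth_ge1 i u).
apply: (@le_trans _ _ (\sum_(v < (size h %/ m).+1) stp h v * (pending K (rcons h v) *
    \prod_(u <- K) \prod_((size h).+1 <= i < size h + d.+1) (1 + born i u / totw i)))).
  apply: ler_sum => v _; apply: ler_wpM2l; first exact: stp_ge0.
  have vr : valid m (rcons h v) by apply: valid_rcons => //; rewrite -ltnS.
  by have := IH _ vr; rewrite size_rcons addSnnS.
under [leLHS]eq_bigr => v _ do rewrite mulrA.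
rewrite -mulr_suml; apply: le_trans (ler_wpM2r _ (pending_step K vh)) _.
  by apply: prodr_ge0 => u _; exact: G0.
rewrite -mulrA ler_pM2l ?pending_gt0 // -big_split /= le_eqVlt; apply/orP; left; apply/eqP.
by apply: eq_bigr => u _; rewrite [RHS]big_ltn //; lia.
Qed.

Lemma hits_le (H : seq (nat * nat)) h N : valid m h ->
  sorted ltn (map fst H) ->
  all (fun q => [&& size h <= q.1, q.1 < N & m * q.2 <= q.1])%N H ->
  pexp (N - size h) (fun h' => \prod_(q <- H) (nth 0%N h' q.1 == q.2)%:R) h <=
  pending (map snd H) h * \prod_(q <- H) psi (size h) q.2 q.1.
Proof.
elim: H h => [|[e u] H IH] h vh /= sH.
  move=> _; rewrite !big_nil mulr1; rewrite (@pexp_const _ _ _ m2 rho0 _ _ 1) // => h' _ _.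
  by rewrite big_nil.
case/andP=> /and3P[/= he eN ue] aH.
have sH' : sorted ltn (map fst H) by exact: path_sorted sH.
have {}aH : all (fun q => [&& e < q.1, q.1 < N & m * q.2 <= q.1])%N H.
  apply/allP => q qH; move/allP: aH => /(_ q qH) /and3P[_ -> ->].
  rewrite !andbT; move: sH; rewrite (path_sortedE ltn_trans) => /andP[/allP al _].
  by apply: al; apply: map_f.
set c := totw e; have c0 : 0 < c := totw_gt0 rho0 e.
pose G := \prod_(q <- H) psi e.+1 q.2 q.1.
have psi0 a b k : 0 <= psi a b k.
  apply: mulr_ge0; first by rewrite invr_ge0 ltW // totw_gt0.
  by apply: prodr_ge0 => i _; apply: le_trans (growth_ge1 i b).
have G0 : 0 <= G by apply: prodr_ge0 => q _.
have -> : (N - size h = (e - size h) + (N - e.+1).+1)%N by lia.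
rewrite pexpD.
apply: (@le_trans _ _ (pexp (e - size h) (fun h' => (c^-1 * G) * pending (u :: map snd H) h') h)).
  apply: pexp_le => // h1 ex sz1.
  have vh1 : valid m h1 by case: ex.
  have {}sz1 : size h1 = e by lia.
  have us : (u < (size h1 %/ m).+1)%N.
    by rewrite ltnS sz1 leq_divRL 1?mulnC //; lia.
  rewrite /= (bigD1 (Ordinal us)) //= [X in _ + X]big1 ?addr0; last first.
    move=> v nv; have vr : valid m (rcons h1 v) by apply: valid_rcons => //; rewrite -ltnS.
    rewrite (@pexp_const _ _ _ m2 rho0 _ _ 0) ?mulr0 // => h' ex' sz'.
    rewrite big_cons /= (extends_nth ex') ?size_rcons ?sz1 //.
    have -> : nth 0%N (rcons h1 v) e = v by rewrite -sz1 nth_rcons ltnn eqxx.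
    case: eqP => [uv|]; last by rewrite mul0r.
    by case/eqP: nv; apply: val_inj.
  have vr : valid m (rcons h1 u) by apply: valid_rcons => //; rewrite -ltnS.
  have st : pexp (N - e.+1) (fun h' => \prod_(q <- (e, u) :: H) (nth 0%N h' q.1 == q.2)%:R) (rcons h1 u)
       <= pending (map snd H) (rcons h1 u) * G.
    have := IH (rcons h1 u) vr sH'; rewrite size_rcons sz1 => /(_ aH).
    apply: le_trans; apply: pexp_le => // h' ex' sz'; rewrite big_cons.
    rewrite ler_piMl //; last by rewrite lern1; case: (_ == _).
    by apply: prodr_ge0.
  apply: le_trans (ler_wpM2l (stp_ge0 _ _ _ _) st) _ => //.
  rewrite mulrA; apply: le_trans (ler_wpM2r G0 (pending_hit _ _ _)) _.
  rewrite /= sz1 -/c le_eqVlt; apply/orP; left; apply/eqP; ring.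
rewrite pexpM; apply: le_trans (ler_wpM2l _ (pending_evolve _ _ vh)) _.
  by rewrite mulr_ge0 // invr_ge0 ltW.
rewrite subnKC // mulrCA ler_pM2l ?pending_gt0 //.
rewrite !big_cons /= /psi -/c big_map.
rewrite mulrACA; apply: ler_wpM2l.
  rewrite mulr_ge0 ?invr_ge0 ?(ltW c0) //.
  by apply: prodr_ge0 => i _; apply: le_trans (growth_ge1 i u).
rewrite -big_split /= big_seq [leRHS]big_seq; apply: ler_prod => q qH.
rewrite mulr_ge0 ?psi0 //=; last first.
  by apply: prodr_ge0 => i _; apply: le_trans (growth_ge1 i q.2).
rewrite {1}/psi -mulrA ler_pM2l ?invr_gt0 ?totw_gt0 //.
have /and3P[eq _ _] := allP aH q qH.
rewrite [leRHS](@big_cat_nat _ _ _ e) //=; last by lia.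
rewrite mulrC; apply: ler_wpM2l.
  by apply: prodr_ge0 => i _; apply: le_trans (growth_ge1 i q.2).
(* The left side skips time e, whose edge is prescribed; the growth factor there is at least 1 and
   may be inserted. *)
rewrite [leRHS]big_ltn // ler_peMl //; last exact: growth_ge1.
by apply: prodr_ge0 => i _; apply: le_trans (growth_ge1 i q.2).
Qed.

End HitProbability.

(** * Decomposition of a path into oriented edges *)

Section PathEdges.

(** Edges are recorded as (younger, older), because only the younger endpoint can have attached the
    edge. *)
Fixpoint path_edges (x : nat) (p : seq nat) : seq (nat * nat) :=
  if p is y :: p' then (maxn x y, minn x y) :: path_edges y p' else [::].

Lemma mem_path_edges x p q :
  q \in path_edges x p -> (q.1 \in x :: p) && (q.2 \in x :: p).
Proof.
elim: p x => [|y p IH] x //=; rewrite inE => /orP[/eqP ->|/IH/andP[]] /=.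
  by rewrite !inE; case: (leqP x y) => ?; rewrite !eqxx ?orbT.
by rewrite !inE => /orP[->|->] /orP[->|->]; rewrite !orbT.
Qed.

Lemma path_edges_uniq x p : uniq (x :: p) -> uniq (path_edges x p).
Proof.
elim: p x => [|y p IH] x //= /andP[xp up]; rewrite IH // andbT.
apply/negP => /mem_path_edges /=.
by case: (leqP x y) => _; rewrite (negbTE xp) ?andbF.
Qed.

Lemma path_edges_lt x p q : uniq (x :: p) -> q \in path_edges x p -> (q.2 < q.1)%N.
Proof.
elim: p x => [|y p IH] x //= /andP[xp up]; rewrite inE => /orP[/eqP -> /=|]; last exact: IH.
by move: xp; rewrite inE negb_or => /andP[/eqP ne _]; lia.
Qed.

Lemma count_path_edges u x p :
  (count_mem u (map snd (path_edges x p)) <= (x == u) + (count_mem u p).*2)%N.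
Proof.
elim: p x => [|y p IH] x //=; have := IH y.
have : ((minn x y == u) <= (x == u) + (y == u))%N.
  by case: (leqP x y) => _; [exact: leq_addr|exact: leq_addl].
by case: (minn x y == u); case: (x == u); case: (y == u) => //=; lia.
Qed.

(** A self-avoiding path has at most two edges at u. This keeps each factor of [pending] at the
    empty history at most m + 1. *)
Lemma count_path_edges_uniq u x p : uniq (x :: p) ->
  (count_mem u (map snd (path_edges x p)) <= 2)%N.
Proof.
move=> /andP[xp up]; apply: leq_trans (count_path_edges u x p) _.
rewrite (count_uniq_mem _ up); case: eqP => [<-|]; first by rewrite (negbTE xp).
by case: (u \in p).
Qed.

Variable m : nat.
Hypothesis m2 : (1 < m)%N.

Definition hit (h : seq nat) (s u : nat) : bool :=
  has (fun j => nth 0%N h (m * s + j) == u) (iota 0 m).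

Lemma path_hits t h x p : valid m h -> size h = (t * m)%N ->
  uniq (x :: p) -> all (fun y => y < t)%N (x :: p) -> path (hadj m h) x p ->
  all (fun q => hit h q.1 q.2) (path_edges x p).
Proof.
move=> vh sz; elim: p x => [|y p IH] x //= /andP[xp up] /and3P[xt yt pt] /andP[xy pp].
have -> : all (fun q => hit h q.1 q.2) (path_edges y p) by apply: IH => //=; rewrite yt.
rewrite andbT; move: xp; rewrite inE negb_or => /andP[/eqP ne _].
have inb s j : (s < t)%N -> (j < m)%N -> (nth 0%N h (m * s + j) <= s)%N.
  move=> st jm; have := vh (m * s + j)%N; rewrite sz.
  rewrite [(m * s)%N]mulnC divnMDl ?divn_small ?addn0 //; last lia.
  by apply; nia.
case/hadjP: xy => j jm [] e; apply/hasP; exists j; rewrite ?mem_iota //.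
  have := inb x j xt jm; rewrite e => le.
  by rewrite (maxn_idPl le) (minn_idPr le) e.
have := inb y j yt jm; rewrite e => le.
by rewrite (maxn_idPr le) (minn_idPl le) e.
Qed.

(** Any of the m edges of the younger endpoint may realise an adjacency; these are all selections of
    edge numbers, over which a union bound is taken. *)
Fixpoint choices (L : seq (nat * nat)) : seq (seq (nat * nat)) :=
  if L is (s, u) :: L' then [seq (m * s + j, u)%N :: H | j <- iota 0 m, H <- choices L']
  else [:: [::]].

Lemma size_choices L : size (choices L) = (m ^ size L)%N.
Proof. by elim: L => [|[s u] L IH] //=; rewrite size_allpairs IH size_iota expnS. Qed.

Lemma mem_choices L H : H \in choices L ->
  [seq ((q.1 %/ m)%N, q.2) | q <- H] = L.
Proof.
elim: L H => [|[s u] L IH] H /=; first by rewrite inE => /eqP ->.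
case/allpairsP=> [[j H'] /= [jm /IH <- ->]] /=.
move: jm; rewrite mem_iota /= add0n => jm.
by rewrite mulnC divnMDl ?divn_small ?addn0 //; lia.
Qed.

Lemma hits_choices (R : realType) L h :
  \prod_(q <- L) (hit h q.1 q.2)%:R <=
  \sum_(H <- choices L) \prod_(q <- H) (nth 0%N h q.1 == q.2)%:R :> R.
Proof.
elim: L => [|[s u] L IH] /=; first by rewrite big_seq1 !big_nil.
rewrite big_allpairs_dep big_cons /=.
apply: (@le_trans _ _ (\sum_(j <- iota 0 m) ((nth 0%N h (m * s + j) == u)%:R *
   \sum_(H <- choices L) \prod_(q <- H) (nth 0%N h q.1 == q.2)%:R))); last first.
  apply: ler_sum => j _; rewrite mulr_sumr; apply: ler_sum => H _.
  by rewrite big_cons.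
rewrite -mulr_suml; apply: ler_pM => //; first by apply: prodr_ge0.
rewrite -natr_sum ler_nat /hit; elim: (iota 0 m) => [|j r IHr] /=; first by rewrite big_nil.
rewrite big_cons; case: (_ == u) => //=.
Qed.

End PathEdges.

(** * Probability of a given self-avoiding path *)

Section PathProbability.
Variables (R : realType) (m : nat) (rho : R).
Hypotheses (m2 : (1 < m)%N) (rho0 : 0 < rho) (rho1 : rho < 1).

Local Notation totw := (totw rho).
Local Notation beta := (beta rho).
Local Notation pexp := (pexp m rho).
Local Notation psi := (psi m rho).
Local Notation pending := (pending m rho).

Definition powS (n : nat) (a : R) : R := n.+1%:R `^ a.

Lemma powS_gt0 n a : 0 < powS n a.
Proof. by rewrite powR_gt0 // ltr0n. Qed.

Lemma powSD n a b : powS n (a + b) = powS n a * powS n b.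
Proof. by rewrite /powS powRD // pnatr_eq0 implybT. Qed.

Lemma psi_le u s j : (u < s)%N -> (j < m)%N ->
  psi 0 u (m * s + j) <= (1 + rho^-1) * (2 * m)%:R * powS s (beta - 1) * powS u (- beta).
Proof.
(* The weight of u can grow from edge m u on. The maximum with 1 keeps e / a meaningful for u = 0,
   for which time 0 is treated apart and yields 1 + 1 / rho. *)
move=> us jm; set e := (m * s + j)%N; set a := maxn 1 (m * u).
have ms2 : (2 * s <= m * s)%N by rewrite leq_mul2r m2 orbT.
have mus : (m * u + m <= m * s)%N by rewrite addnC -mulnS leq_mul2l us orbT.
have a0 : (0 < a)%N by rewrite /a; lia.
have ae : (a <= e)%N by rewrite /a /e; lia.
have b0 : 0 < beta := beta_gt0 rho0; have b1 : beta < 1 := beta_lt1 rho0.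
have g0 i : 0 <= 1 + born R m i u / totw i.
  by apply: le_trans (growth_ge1 m rho0 i u).
rewrite /psi (@big_cat_nat _ _ _ a) //=.
have l1 : \prod_(0 <= i < a) (1 + born R m i u / totw i) <= 1 + rho^-1.
  case: (posnP u) => [u0|u0].
    rewrite /a u0 muln0 big_nat1 /born muln0 leq0n mul1r.
    by rewrite /totw mul0r add0r.
  rewrite big_nat big1 ?lerDl ?invr_ge0 ?(ltW rho0) // => i /andP[_ ia].
  rewrite /born; case: leqP => [le|]; last by rewrite mul0r addr0.
  have : (m <= m * u)%N by rewrite leq_pmulr.
  move: ia; rewrite /a; lia.
have l2 : \prod_(a <= i < e) (1 + born R m i u / totw i) <= (e%:R / a%:R) `^ beta.
  apply: le_trans (prod_totw_le rho0 a0 ae); apply: ler_prod => i _.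
  rewrite g0 lerD2l /born ler_piMl ?invr_ge0 ?(ltW (totw_gt0 rho0 i)) //.
  by case: (m * u <= i)%N; rewrite ?lexx ?ler01.
have l3 : (e%:R / a%:R) `^ beta <= (2 * m)%:R * powS s beta * powS u (- beta).
  apply: (@le_trans _ _ (((2 * m)%:R * (s.+1%:R / u.+1%:R)) `^ beta)).
    rewrite ge0_ler_powR ?(ltW b0) ?nnegrE ?divr_ge0 ?mulr_ge0 ?divr_ge0 //.
    rewrite ler_pdivrMr ?ltr0n // mulrA mulrAC ler_pdivlMr ?ltr0n //.
    rewrite -!natrM ler_nat.
    have l4 : (u.+1 <= 2 * a)%N.
      have : (2 * u <= m * u)%N by rewrite leq_mul2r m2 orbT.
      by rewrite /a; lia.
    have l5 : (e <= m * s.+1)%N by rewrite /e mulnS; lia.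
    have -> : (2 * m * s.+1 * a = (m * s.+1) * (2 * a))%N by ring.
    exact: leq_mul.
  rewrite powRM ?divr_ge0 // powRM ?invr_ge0 // -mulrA.
  rewrite -[u.+1%:R^-1]powR_inv1 // -powRrM mulN1r.
  apply: ler_wpM2r; first by rewrite mulr_ge0 ?powR_ge0.
  by apply: ler1_powR (ltW b1); rewrite ler1n; lia.
have l6 : (totw e)^-1 <= powS s (-1).
  rewrite /powS powR_inv1 // lef_pV2 ?posrE ?totw_gt0 ?ltr0n //.
  apply: (@le_trans _ _ e%:R); first by rewrite ler_nat /e; lia.
  by rewrite /totw mulrDr mulr1 -addrA lerDl addr_ge0 ?mulr_ge0 // ltW.
have -> : (1 + rho^-1) * (2 * m)%:R * powS s (beta - 1) * powS u (- beta) =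
   powS s (-1) * ((1 + rho^-1) * ((2 * m)%:R * powS s beta * powS u (- beta))).
  by rewrite powSD; ring.
apply: ler_pM => //; first by rewrite invr_ge0 ltW // totw_gt0.
  by rewrite mulr_ge0 //; apply: prodr_ge0 => i _.
apply: ler_pM => //; [by apply: prodr_ge0 => i _|by apply: prodr_ge0 => i _|].
exact: le_trans l3.
Qed.

Lemma pending_nil_le K : (forall u, (count_mem u K <= 2)%N) ->
  pending K [::] <= (m.+1)%:R ^+ size K.
Proof.
elim: K => [|u K IH] c2 //=.
rewrite exprS; apply: ler_pM.
- by rewrite addr_ge0 // ltW // wt_gt0.
- by rewrite ltW // pending_gt0.
- have : (count_mem u K <= 1)%N by have := c2 u; rewrite /= eqxx; lia.
  rewrite -(ler_nat R) => c1; rewrite /wt /= addr0 -natr1; apply: lerD => //.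
  by rewrite ler_piMr // ltW.
by apply: IH => w; apply: leq_trans (c2 w); rewrite /= leq_addl.
Qed.

(** Three costs per edge of a path: m for the choice of the edge number, m + 1 for the initial
    weight, and the constant of [psi_le]. *)
Definition kap : R := m%:R * m.+1%:R * ((1 + rho^-1) * (2 * m)%:R).

Definition edgew (u w : nat) : R :=
  kap * powS (maxn u w) (beta - 1) * powS (minn u w) (- beta).

Definition pairw (q : nat * nat) : R :=
  (1 + rho^-1) * (2 * m)%:R * powS q.1 (beta - 1) * powS q.2 (- beta).

Lemma kap_gt0 : 0 < kap.
Proof.
have m0 : 0 < m%:R :> R by rewrite ltr0n; lia.
by rewrite /kap !mulr_gt0 ?addr_gt0 ?invr_gt0 ?ltr0n //; lia.
Qed.

Lemma edgew_gt0 u w : 0 < edgew u w.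
Proof.
by apply: mulr_gt0; [apply: mulr_gt0; [exact: kap_gt0|]|]; exact: powS_gt0.
Qed.

Lemma edgew_sym u w : edgew u w = edgew w u.
Proof. by rewrite /edgew maxnC minnC. Qed.

Lemma edge_hits_le t (H : seq (nat * nat)) :
  uniq [seq ((q.1 %/ m)%N, q.2) | q <- H] ->
  (forall u, (count_mem u (map snd H) <= 2)%N) ->
  (forall q, q \in H -> (q.2 < q.1 %/ m)%N && (q.1 < t * m)%N) ->
  pexp (t * m) (fun h => \prod_(q <- H) (nth 0%N h q.1 == q.2)%:R) [::] <=
  m.+1%:R ^+ size H * \prod_(q <- H) pairw ((q.1 %/ m)%N, q.2).
Proof.
move=> uH c2 ltH.
have pw0 q : 0 < pairw q.
  by rewrite !mulr_gt0 ?powS_gt0 ?addr_gt0 ?invr_gt0 ?ltr0n //; lia.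
(* Two prescriptions sharing an edge number have different targets, so the event is empty; otherwise
   sorting by edge number prepares [hits_le]. *)
have [u1|nu] := boolP (uniq (map fst H)); last first.
  rewrite (@pexp_const _ _ _ m2 rho0 _ _ 0) //.
    by rewrite mulr_ge0 ?exprn_ge0 //; apply: prodr_ge0 => q _; exact: ltW.
  move=> h _ _; apply/eqP; rewrite prodf_seq_eq0; apply: contraR nu => /hasPn al.
  rewrite map_inj_in_uniq ?(map_uniq uH) // => q1 q2 i1 i2 e.
  have hq q : q \in H -> nth 0%N h q.1 = q.2.
    by move=> iq; have /= := al q iq; rewrite pnatr_eq0 eqb0 negbK => /eqP.
  by case: q1 q2 i1 i2 e => [a b] [c d] /hq/= <- /hq/= <- ->.
pose H' := sort (fun a b : nat * nat => a.1 <= b.1)%N H.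
have pH : perm_eq H' H by rewrite perm_sort.
have sH : sorted ltn (map fst H').
  rewrite ltn_sorted_uniq_leq (perm_uniq (perm_map fst pH)) u1 /=.
  rewrite sorted_map; apply: sort_sorted => a b; exact: leq_total.
have aH : all (fun q => [&& size ([::] : seq nat) <= q.1, q.1 < t * m & m * q.2 <= q.1])%N H'.
  apply/allP => q; rewrite (perm_mem pH) => /ltH/andP[l1 ->] /=.
  by rewrite mulnC; apply: leq_trans (leq_divM q.1 m); rewrite leq_mul2r (ltnW l1) orbT.
have := hits_le m2 rho0 rho1 (@valid_nil m) sH aH; rewrite subn0 => hl.
have -> : pexp (t * m) (fun h => \prod_(q <- H) (nth 0%N h q.1 == q.2)%:R) [::] =
          pexp (t * m) (fun h => \prod_(q <- H') (nth 0%N h q.1 == q.2)%:R) [::].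
  by apply: eq_pexp => // h _ _; apply/esym/perm_big.
apply: le_trans hl _; apply: ler_pM.
- by rewrite ltW // pending_gt0.
- apply: prodr_ge0 => q _; rewrite mulr_ge0 ?invr_ge0 ?(ltW (totw_gt0 _ _)) //.
  by apply: prodr_ge0 => i _; apply: le_trans (growth_ge1 m rho0 i q.2).
- rewrite -(perm_size pH) -(size_map snd); apply: pending_nil_le => u.
  by rewrite (permP (perm_map snd pH)).
rewrite (perm_big _ pH) /= big_seq [leRHS]big_seq; apply: ler_prod => q qH.
apply/andP; split.
  rewrite mulr_ge0 ?invr_ge0 ?(ltW (totw_gt0 _ _)) //.
  by apply: prodr_ge0 => i _; apply: le_trans (growth_ge1 m rho0 i q.2).
have /andP[l1 _] := ltH q qH.
rewrite {1}(divn_eq q.1 m) [(_ %/ _ * _)%N]mulnC; apply: psi_le => //.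
by rewrite ltn_mod; lia.
Qed.

Definition pathw (x : nat) (p : seq nat) : R :=
  \prod_(q <- path_edges x p) (m%:R * m.+1%:R * pairw q).

Lemma pathw_cons x y p : pathw x (y :: p) = edgew x y * pathw y p.
Proof. by rewrite /pathw big_cons /edgew /kap /pairw /= !mulrA. Qed.

Lemma path_prob_le t x p : uniq (x :: p) -> all (fun y => y < t)%N (x :: p) ->
  pexp (t * m) (fun h => (path (hadj m h) x p)%:R) [::] <= pathw x p.
Proof.
move=> up ap; set L := path_edges x p.
apply: (@le_trans _ _ (pexp (t * m) (fun h => \sum_(H <- choices m L)
    \prod_(q <- H) (nth 0%N h q.1 == q.2)%:R) [::])).
  apply: pexp_le => // h [vh _] sz.
  apply: le_trans (hits_choices m R L h).
  have [pp|] := boolP (path (hadj m h) x p); last by move=> _; apply: prodr_ge0.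
  have al := path_hits m2 vh sz up ap pp.
  rewrite big_seq big1 // => q qL; by rewrite (allP al).
rewrite pexp_sum big_seq.
apply: (@le_trans _ _ (\sum_(H <- choices m L | H \in choices m L)
   (m.+1%:R ^+ size L * \prod_(q <- L) pairw q))).
  apply: ler_sum => H /(mem_choices m2) eL.
  have sL : size H = size L by rewrite -eL size_map.
  have snd_eq : map snd H = map snd L by rewrite -eL -map_comp.
  have := @edge_hits_le t H; rewrite eL sL snd_eq => le.
  have -> : \prod_(q <- L) pairw q = \prod_(q <- H) pairw ((q.1 %/ m)%N, q.2).
    by rewrite -eL big_map.
  apply: le; first exact: path_edges_uniq.
    by move=> u; exact: count_path_edges_uniq.
  move=> q qH; have qL : ((q.1 %/ m)%N, q.2) \in L by rewrite -eL; apply: map_f.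
  have /= -> := path_edges_lt up qL.
  have /andP[/= q1 _] := mem_path_edges qL.
  have := allP ap _ q1; rewrite ltn_divLR //; lia.
rewrite -big_seq big_const_seq count_predT size_choices iter_addr_0.
have -> : pathw x p = (m%:R * m.+1%:R) ^+ size L * \prod_(q <- L) pairw q.
  rewrite /pathw -/L; elim: (L) => [|q l IH]; first by rewrite !big_nil mulr1.
  by rewrite !big_cons IH exprS; ring.
by rewrite -[leLHS]mulr_natl natrX exprMn mulrA.
Qed.

End PathProbability.

(** * Sums over words of vertices *)

Section WordSums.
Variables (R : realType) (t : nat).
Implicit Types (F G : seq nat -> R).

Fixpoint psum (k : nat) F : R :=
  if k is k'.+1 then \sum_(z < t) psum k' (fun p => F (val z :: p)) else F [::].

Lemma psum_rcons k F : psum k.+1 F = psum k (fun p => \sum_(z < t) F (rcons p z)).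
Proof. by elim: k F => [|k IH] F //; apply: eq_bigr => z _; exact: (IH (fun p => F (val z :: p))). Qed.

Lemma psum_cat k l F : psum (k + l) F = psum k (fun p => psum l (fun q => F (p ++ q))).
Proof. by elim: k F => //= k IH F; apply: eq_bigr => z _; rewrite IH. Qed.

Lemma psum_le k F G :
  (forall p, size p = k -> all (fun x => x < t)%N p -> F p <= G p) -> psum k F <= psum k G.
Proof.
elim: k F G => [|k IH] F G le /=; first exact: le.
by apply: ler_sum => z _; apply: IH => p sz ap; apply: le; rewrite /= ?sz ?ltn_ord.
Qed.

Lemma eq_psum k F G :
  (forall p, size p = k -> all (fun x => x < t)%N p -> F p = G p) -> psum k F = psum k G.
Proof.
by move=> e; apply/eqP; rewrite eq_le; apply/andP; split; apply: psum_le => p *; rewrite e.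
Qed.

Lemma psum_cst0 k : psum k (fun=> 0) = 0.
Proof. by elim: k => //= k IH; rewrite big1. Qed.

Lemma psum_ge0 k F : (forall p, 0 <= F p) -> 0 <= psum k F.
Proof. by move=> F0; rewrite -(psum_cst0 k); apply: psum_le => p *. Qed.

Lemma psumM k F a : psum k (fun p => a * F p) = a * psum k F.
Proof. by elim: k F => //= k IH F; rewrite mulr_sumr; apply: eq_bigr => z _; rewrite IH. Qed.

Lemma psum_mem k F p : (forall p, 0 <= F p) -> size p = k ->
  all (fun x => x < t)%N p -> F p <= psum k F.
Proof.
elim: k F p => [|k IH] F [|x p] F0 //= [sz] /andP[xt ap].
rewrite (bigD1 (Ordinal xt)) //= -[leLHS]addr0; apply: lerD.
  exact: (IH (fun p => F (x :: p))).
by apply: sumr_ge0 => z _; apply: psum_ge0.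
Qed.

End WordSums.

(** * First-moment bounds for truncated paths *)

Section PathSums.
Variables (R : realType) (m : nat) (rho : R) (t : nat).
Hypotheses (m2 : (1 < m)%N) (rho0 : 0 < rho) (rho1 : rho < 1).

Local Notation pexp := (pexp m rho).
Local Notation edgew := (edgew m rho).
Local Notation pathw := (pathw m rho).

Lemma pexp_psum k l (F : seq nat -> seq nat -> R) h :
  pexp l (fun h' => psum t k (F h')) h = psum t k (fun p => pexp l (fun h' => F h' p) h).
Proof.
elim: k F => //= k IH F; rewrite pexp_sum; apply: eq_bigr => z _.
by rewrite (IH (fun h' p => F h' (val z :: p))).
Qed.

Lemma pathw_ge0 x p : 0 <= pathw x p.
Proof.
apply: prodr_ge0 => q _; rewrite !mulr_ge0 ?addr_ge0 ?invr_ge0 ?powR_ge0 //; exact: ltW.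
Qed.

Lemma pathw_cat x p q : pathw x (p ++ q) = pathw x p * pathw (last x p) q.
Proof.
elim: p x => [|y p IH] x /=; first by rewrite /pathw /= big_nil mul1r.
by rewrite !pathw_cons IH mulrA.
Qed.

(** Union bound. Words with repeated vertices carry no event, but their nonnegative weight is added
    on the right so that the sum factorises over steps. *)
Lemma path_exists_le v k (P : pred (seq nat)) : (v < t)%N ->
  pexp (t * m) (fun h => `[< exists p, [/\ size p = k, P p, uniq (v :: p),
      all (fun x => x < t)%N p & path (hadj m h) v p] >]%:R) [::] <=
  psum t k (fun p => (P p)%:R * pathw v p).
Proof.
move=> vt.
pose good p := [&& P p, uniq (v :: p) & all (fun x => x < t)%N p].
apply: (@le_trans _ _ (pexp (t * m)
   (fun h => psum t k (fun p => (good p && path (hadj m h) v p)%:R)) [::])).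
  apply: pexp_le => // h _ _; case: asboolP => [[p [sz Pp up ap pp]]|_]; last first.
    by apply: psum_ge0.
  have -> : true%:R = (good p && path (hadj m h) v p)%:R :> R.
    by rewrite /good Pp up ap pp.
  exact: (psum_mem (F := fun p => (good p && path (hadj m h) v p)%:R)).
rewrite pexp_psum; apply: psum_le => p sz ap.
have [|ng] := boolP (good p); last first.
  by rewrite (@pexp_const _ _ _ m2 rho0 _ _ 0) // mulr_ge0 // pathw_ge0.
by case/and3P=> -> up _; rewrite mul1r; apply: path_prob_le => //=; rewrite vt.
Qed.

Variable lam : nat -> R.

Definition above (k z : nat) : bool := lam k <= z.+1%:R.

(** Total weight of the k-step words from v to u whose i-th vertex is above level i for all i < k,
    built by removing the last step; the endpoint u is unrestricted. *)
Fixpoint pathsum (v k u : nat) : R :=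
  if k is k'.+1 then \sum_(z < t | above k' z) edgew u z * pathsum v k' z
  else (u == v)%:R.

Lemma pathsum_ge0 v k u : 0 <= pathsum v k u.
Proof.
elim: k u => [|k IH] u //=; apply: sumr_ge0 => z _; apply: mulr_ge0 => //.
by rewrite ltW // edgew_gt0.
Qed.

Definition above_upto (v k : nat) (p : seq nat) : bool :=
  all (fun i => above i (nth 0%N (v :: p) i)) (iota 0 k).

Lemma psum_pathsum v k (g : nat -> R) : (v < t)%N ->
  psum t k (fun p => (above_upto v k p)%:R * pathw v p * g (last v p)) =
  \sum_(u < t) pathsum v k u * g u.
Proof.
move=> vt; elim: k g => [|k IH] g.
  rewrite /= (bigD1 (Ordinal vt)) //= eqxx big1 ?addr0.
    by rewrite /pathw /= big_nil !mul1r.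
  by move=> u; rewrite -val_eqE /= => /negbTE ->; rewrite mul0r.
rewrite psum_rcons.
pose g' y := (above k y)%:R * \sum_(z < t) edgew y z * g z.
transitivity (psum t k (fun p => (above_upto v k p)%:R * pathw v p * g' (last v p))).
  apply: eq_psum => p sz _; rewrite /g' mulrA mulr_sumr; apply: eq_bigr => z _.
  rewrite last_rcons -cats1 pathw_cat pathw_cons {2}/pathw /= big_nil mulr1.
  have -> : above_upto v k.+1 (p ++ [:: val z]) = above_upto v k p && above k (last v p).
    rewrite /above_upto -addn1 iotaD all_cat /= andbT add0n; congr andb.
      apply: eq_in_all => i; rewrite mem_iota /= add0n => ik.
      by rewrite -cat_cons nth_cat /= sz ltnS ltnW.
    by rewrite -cat_cons nth_cat /= sz ltnSn -sz (last_nth 0%N).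
  by rewrite -mulnb natrM; ring.
rewrite IH /=; under [RHS]eq_bigr => u _ do rewrite mulr_suml.
rewrite exchange_big /= [LHS](bigID (fun z : 'I_t => above k z)) /=.
rewrite [X in _ + X]big1 ?addr0; last first.
  by move=> u /negbTE nu; rewrite /g' nu mul0r mulr0.
apply: eq_bigr => y ay; rewrite /g' ay mul1r mulr_sumr.
by apply: eq_bigr => z _; rewrite edgew_sym; ring.
Qed.

Lemma escape_prob_le v k : (v < t)%N ->
  pexp (t * m) (fun h => `[< exists p, [/\ size p = k,
      above_upto v k p && ~~ above k (last v p), uniq (v :: p),
      all (fun x => x < t)%N p & path (hadj m h) v p] >]%:R) [::] <=
  \sum_(u < t | ~~ above k u) pathsum v k u.
Proof.
move=> vt; apply: le_trans (path_exists_le _ _ vt) _.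
rewrite (eq_psum (G := fun p => (above_upto v k p)%:R * pathw v p * (~~ above k (last v p))%:R)).
  rewrite (psum_pathsum k (fun y => (~~ above k y)%:R) vt) [leRHS]big_mkcond /=.
  apply: ler_sum => u _; by case: (above k u); rewrite ?mulr0 ?mulr1.
by move=> p _ _; rewrite -mulnb natrM; ring.
Qed.

Definition above_back (k : nat) (y : nat) (p : seq nat) : bool :=
  all (fun j => above j (nth 0%N (y :: p) (k - j))) (iota 0 k).

Lemma psum_back w k y : (w < t)%N -> (y < t)%N ->
  psum t k (fun p => (above_back k y p && (last y p == w))%:R * pathw y p) <= pathsum w k y.
Proof.
move=> wt; elim: k y => [|k IH] y yt.
  by rewrite /= /pathw /= big_nil mulr1.
rewrite /= [leRHS]big_mkcond /=; apply: ler_sum => z _.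
have step p : size p = k -> all (fun x => x < t)%N p ->
    (above_back k.+1 y (val z :: p) && (last (val z) p == w))%:R * pathw y (val z :: p) <=
    (above k z)%:R * edgew y z * ((above_back k z p && (last (val z) p == w))%:R * pathw z p).
  move=> _ _; rewrite pathw_cons.
  have -> : above_back k.+1 y (val z :: p) = above_back k z p && above k z.
    rewrite /above_back -addn1 iotaD all_cat /= andbT add0n addn1 subSnn /=; congr andb.
    by apply: eq_in_all => i; rewrite mem_iota /= add0n => ik; rewrite subSn // ltnW.
  by rewrite -!mulnb !natrM le_eqVlt; apply/orP; left; apply/eqP; ring.
apply: le_trans (psum_le step) _; rewrite psumM.
case: ifP => az; last by rewrite !mul0r.
rewrite mul1r ler_pM2l ?edgew_gt0 //; exact: IH.
Qed.

(** The path is cut at its k-th vertex y. Its weight is the product over the two pieces, and each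
    piece sums to a [pathsum] ending at y, the second one started at w. *)
Lemma good_prob_le v w k l : (v < t)%N -> (w < t)%N ->
  pexp (t * m) (fun h => `[< exists p, [/\ size p = (k + l)%N,
      [&& above_upto v k.+1 p, all (fun j => above j (nth 0%N (v :: p) (k + l - j))) (iota 0 l)
        & last v p == w], uniq (v :: p),
      all (fun x => x < t)%N p & path (hadj m h) v p] >]%:R) [::] <=
  \sum_(y < t | above k y) pathsum v k y * pathsum w l y.
Proof.
move=> vt wt; apply: le_trans (path_exists_le _ _ vt) _; rewrite psum_cat.
pose g y := (above k y)%:R * pathsum w l y.
apply: (@le_trans _ _ (psum t k (fun p => (above_upto v k p)%:R * pathw v p * g (last v p)))).
  apply: psum_le => p sz ap.
  have lt : (last v p < t)%N.
    have : all (fun x => x < t)%N (v :: p) by rewrite /= vt.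
    by move/allP; apply; exact: mem_last.
  have step q : size q = l -> all (fun x => x < t)%N q ->
    ([&& above_upto v k.+1 (p ++ q), all (fun j => above j (nth 0%N (v :: p ++ q) (k + l - j))) (iota 0 l)
        & last v (p ++ q) == w])%:R * pathw v (p ++ q) <=
    (above_upto v k p)%:R * pathw v p * (above k (last v p))%:R *
     ((above_back l (last v p) q && (last (last v p) q == w))%:R * pathw (last v p) q).
    move=> szq _; rewrite pathw_cat last_cat.
    have -> : above_upto v k.+1 (p ++ q) = above_upto v k p && above k (last v p).
      rewrite /above_upto -addn1 iotaD all_cat /= andbT add0n; congr andb.
        apply: eq_in_all => i; rewrite mem_iota /= add0n => ik.
        by rewrite -cat_cons nth_cat /= sz ltnS ltnW.
      by rewrite -cat_cons nth_cat /= sz ltnSn -sz (last_nth 0%N).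
    have -> : all (fun j => above j (nth 0%N (v :: p ++ q) (k + l - j))) (iota 0 l)
        = above_back l (last v p) q.
      apply: eq_in_all => j; rewrite mem_iota /= add0n => jl.
      have -> : (k + l - j = (k + (l - j).-1).+1)%N by lia.
      have -> : (l - j = (l - j).-1.+1)%N by lia.
      by rewrite /= nth_cat sz ltnNge leq_addr /= addKn.
    by rewrite -!mulnb !natrM le_eqVlt; apply/orP; left; apply/eqP; ring.
  apply: le_trans (psum_le step) _; rewrite psumM /g [leRHS]mulrA.
  apply: ler_wpM2l; first by rewrite !mulr_ge0 ?pathw_ge0.
  exact: psum_back.
rewrite psum_pathsum // [leRHS]big_mkcond /=; apply: ler_sum => u _.
by rewrite /g; case: (above k u); rewrite ?mul0r ?mulr0 ?mul1r.
Qed.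

End PathSums.

(** * Power sums compared with integrals *)

Section PowerSums.
Variable R : realType.
Implicit Types a l : R.

(** Bernoulli at j / (j + 1), rescaled: a discrete derivative of x^a, from which the power sums
    telescope. *)
Lemma powR_diff_ge a (j : nat) : 0 < a -> a <= 1 ->
  a * j.+1%:R `^ (a - 1) <= j.+1%:R `^ a - j%:R `^ a.
Proof.
move=> a0 a1; have J0 : 0 < j.+1%:R :> R by rewrite ltr0n.
have pw : 0 < j.+1%:R `^ a :> R by rewrite powR_gt0.
rewrite powRB1 //.
have [->|j0] := posnP j; first by rewrite powR0 ?gt_eqF // subr0 powR1 divr1 mulr1.
have := @powR_bernoulli R (j%:R / j.+1%:R) a.
rewrite divr_gt0 ?ltr0n // (ltW a0) a1 => /(_ isT isT isT).
rewrite powR_divr // ler_pdivrMr // => le.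
have e : (1 - a + a * (j%:R / j.+1%:R)) * j.+1%:R `^ a = j.+1%:R `^ a - a * (j.+1%:R `^ a / j.+1%:R).
  by rewrite -natr1; field; rewrite natr1 gt_eqF.
by rewrite lerBrDr addrC -lerBrDr -e.
Qed.

Lemma sum_powR_le a t : 0 < a -> a <= 1 ->
  \sum_(z < t) z.+1%:R `^ (a - 1) <= t%:R `^ a / a.
Proof.
move=> a0 a1; elim: t => [|t IH].
  by rewrite big_ord0 powR0 ?gt_eqF // mul0r.
rewrite big_ord_recr /=; have := powR_diff_ge t a0 a1.
rewrite ler_pdivlMr // mulrDl; move: IH; rewrite ler_pdivlMr //; lra.
Qed.

Lemma sum_powR_lt_le a l t : 0 < a -> a <= 1 -> 0 < l ->
  \sum_(z < t | ~~ (l <= z.+1%:R)) z.+1%:R `^ (a - 1) <= l `^ a / a.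
Proof.
move=> a0 a1 l0.
(* Induction on t needs the smaller of t and l in the bound. *)
have : \sum_(z < t | ~~ (l <= z.+1%:R)) z.+1%:R `^ (a - 1) <=
       (if t%:R < l then t%:R `^ a else l `^ a) / a.
  elim: t => [|t IH]; first by rewrite big_ord0 l0 powR0 ?gt_eqF // mul0r.
  rewrite big_mkcond big_ord_recr /= -big_mkcond /=.
  have tl : t%:R < t.+1%:R :> R by rewrite ltr_nat.
  case: (ltrP t.+1%:R l) => [lt|ge] /=.
    move: IH; rewrite (lt_trans tl lt).
    have := powR_diff_ge t a0 a1; rewrite !ler_pdivlMr // mulrDl; lra.
  rewrite addr0; apply: le_trans IH _; rewrite ler_pM2r ?invr_gt0 //.
  by case: ltrP => // lt; apply: powR_mono => //; exact: ltW.
move=> le; apply: le_trans le _; rewrite ler_pM2r ?invr_gt0 //.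
by case: ltrP => // lt; apply: powR_mono => //; exact: ltW.
Qed.

Lemma inv_succ_le_ln (j : nat) : (0 < j)%N -> j.+1%:R^-1 <= ln (j.+1%:R / j%:R) :> R.
Proof.
move=> j0; have J0 : 0 < j%:R :> R by rewrite ltr0n.
have := @ln_le_sub1 R (j%:R / j.+1%:R); rewrite divr_gt0 ?ltr0n // => /(_ isT).
rewrite -invf_div lnV ?posrE ?divr_gt0 ?ltr0n // -lerN2 opprK invf_div.
have -> : - (j%:R / j.+1%:R - 1) = j.+1%:R^-1 :> R.
  by rewrite -natr1; field; rewrite natr1 gt_eqF ?ltr0n.
by [].
Qed.

Lemma sum_inv_le l t : 0 < l -> l <= t%:R ->
  \sum_(z < t | l <= z.+1%:R) z.+1%:R^-1 <= 1 + ln (t%:R / l).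
Proof.
move=> l0; elim: t => [|t IH]; first by rewrite leNgt l0.
move=> le; rewrite big_mkcond big_ord_recr /= -big_mkcond /= le.
have [lt|gt] := lerP l t%:R.
  have t0 : (0 < t)%N by rewrite -(ltr_nat R); exact: lt_le_trans lt.
  have T0 : 0 < t%:R :> R by rewrite ltr0n.
  apply: le_trans (lerD (IH lt) (inv_succ_le_ln t0)) _.
  rewrite !ln_div ?posrE ?ltr0n // le_eqVlt; apply/orP; left; apply/eqP; ring.
rewrite big1 ?add0r; last first.
  move=> z lz; exfalso; have : z.+1%:R <= t%:R :> R by rewrite ler_nat.
  by move/(le_trans lz); rewrite leNgt gt.
apply: (@le_trans _ _ 1); first by rewrite invf_le1 ?ltr0n // ler1n.
by rewrite lerDl ln_ge0 // ler_pdivlMr // mul1r.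
Qed.

Lemma powR_diffN_ge a (j : nat) : 0 < a -> (0 < j)%N ->
  a * j.+1%:R `^ (- a - 1) <= j%:R `^ (- a) - j.+1%:R `^ (- a).
Proof.
move=> a0 j0; have J1 : 0 < j.+1%:R :> R by rewrite ltr0n.
have J0 : 0 < j%:R :> R by rewrite ltr0n.
have e : j%:R `^ (- a) = j.+1%:R `^ (- a) * expR (a * ln (j.+1%:R / j%:R)).
  rewrite !powRE // -expRD ln_div ?posrE //; congr expR; ring.
rewrite powRB1 //.
rewrite e -{3}[j.+1%:R `^ (- a)]mulr1 -mulrBr mulrCA ler_pM2l ?powR_gt0 //.
rewrite lerBrDl; apply: le_trans (expR_ge1Dx _); rewrite lerD2l ler_pM2l //.
exact: inv_succ_le_ln.
Qed.

Lemma sum_powRN_le a l t : 0 < a -> 1 <= l ->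
  \sum_(z < t | l <= z.+1%:R) z.+1%:R `^ (- a - 1) <= (1 + a^-1) * l `^ (- a).
Proof.
move=> a0 l1; have l0 : 0 < l by exact: lt_le_trans l1.
have [lt|ge] := ltrP t%:R l.
  rewrite big1 ?mulr_ge0 ?powR_ge0 ?addr_ge0 ?invr_ge0 // ?ltW // => z lz.
  exfalso; have : z.+1%:R <= t%:R :> R by rewrite ler_nat.
  by move/(le_trans lz); rewrite leNgt lt.
(* Subtracting the tail beyond t makes the induction close. *)
apply: (@le_trans _ _ ((1 + a^-1) * l `^ (- a) - t%:R `^ (- a) / a)); last first.
  by rewrite gerBl divr_ge0 ?powR_ge0 // ltW.
elim: t ge => [|t IH]; first by rewrite leNgt l0.
move=> le; rewrite big_mkcond big_ord_recr /= -big_mkcond /= le.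
have [lt|gt] := lerP l t%:R.
  have t0 : (0 < t)%N by rewrite -(ltr_nat R); exact: lt_le_trans lt.
  have := powR_diffN_ge a0 t0; rewrite -ler_pdivlMl // mulrC.
  have := IH lt; rewrite mulrBl; lra.
rewrite big1 ?add0r; last first.
  move=> z lz; exfalso; have : z.+1%:R <= t%:R :> R by rewrite ler_nat.
  by move/(le_trans lz); rewrite leNgt gt.
have mono b : 0 <= b -> t.+1%:R `^ (- b) <= l `^ (- b).
  by move=> b0; apply: powR_antimono.
have m1 := mono a (ltW a0).
have m2 : t.+1%:R `^ (- a - 1) <= l `^ (- a).
  apply: le_trans m1; apply: ler_powR; first by rewrite ler1n.
  by rewrite gerBl.
have : t.+1%:R `^ (- a) / a <= l `^ (- a) / a by rewrite ler_pM2r ?invr_gt0.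
rewrite mulrDl mul1r [a^-1 * _]mulrC; lra.
Qed.

End PowerSums.

Lemma half_uphalf n : (0 < n)%N ->
  [/\ (0 < uphalf n)%N, (n./2 <= uphalf n)%N & n./2 = 0%N -> n = 1%N].
Proof. by move=> n0; split; lia. Qed.

(** * The recursion for truncated path sums and the resulting bound on short connections *)

Section TruncatedPaths.
Variables (R : realType) (m : nat) (rho : R) (t : nat) (eta : nat -> R) (A : R) (K : nat).
Hypotheses (m2 : (1 < m)%N) (rho0 : 0 < rho) (rho1 : rho < 1).

Local Notation beta := (beta rho).
Local Notation edgew := (edgew m rho).
Local Notation kap := (kap m rho).
Local Notation pexp := (pexp m rho).

Variables (a C3 c2 : R).
Hypotheses (aE : a = 2 * beta - 1) (C3E : C3 = 1 + a^-1) (c2E : c2 = a / (2 * kap)).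
(* al and be dominate the expected number of paths of k steps from a recent vertex to u that
   have stayed above the levels lam, in the form al u^-beta + be u^(beta-1). *)
Let lam (k : nat) : R := t%:R / eta k.
Let al (k : nat) : R := t%:R `^ (beta - 1) * eta k `^ A.
Let be (k : nat) : R := t%:R `^ (- beta) * (c2 * eta k.+1 `^ A).
Local Notation above := (above lam).
Local Notation pathsum := (pathsum m rho t lam).

(** [I1] and [I2] are what the recursion for [al] and [be] demands in [pathsum_le]; [A1] makes the
    exponent A - (1 - beta) of the escape probability nonpositive. *)
Hypotheses (t0 : (0 < t)%N) (eta1 : forall k, 1 <= eta k)
  (eta_mono : forall k, eta k <= eta k.+1)
  (etaK : forall k, (k <= K)%N -> eta k <= t%:R)
  (A0 : 0 <= A) (A1 : A <= 1 - beta)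
  (I1 : forall k, (0 < k)%N -> 2 * kap * (1 + ln (eta k)) * eta k `^ A <= eta k.+1 `^ A)
  (I2 : forall k, (0 < k)%N ->
     kap * C3 * eta k `^ (A + a) + kap * c2 * eta k.+1 `^ A * (1 + ln (eta k))
     <= c2 * eta k.+2 `^ A).

(** The case k = 1 of [pathsum_le], kept as an assumption on the first vertex; [start_le_recent]
    supplies it for recent vertices. *)
Definition start_le (v : nat) : Prop := forall u, (u < t)%N ->
  edgew u v <= al 1 * powS u (- beta) + (above 0 u)%:R * be 1 * powS u (beta - 1).

Let T0 : 0 < t%:R :> R. Proof. by rewrite ltr0n. Qed.
Let eta0 k : 0 < eta k. Proof. exact: lt_le_trans (eta1 k). Qed.
Let a_gt0 : 0 < a.
Proof. by rewrite aE; have := beta_gt_half rho0 rho1; lra. Qed.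
Let a_le1 : a <= 1.
Proof. by rewrite aE; have := beta_lt1 rho0; lra. Qed.
Let k0 : 0 < kap. Proof. exact: kap_gt0. Qed.
Let C30 : 0 < C3. Proof. by rewrite C3E addr_gt0 // invr_gt0. Qed.
Let c20 : 0 < c2. Proof. by rewrite c2E divr_gt0 // mulr_gt0. Qed.
Let al0 k : 0 < al k. Proof. by rewrite mulr_gt0 ?powR_gt0. Qed.
Let be0 k : 0 < be k.
Proof. by apply: mulr_gt0; [|apply: mulr_gt0 => //]; exact: powR_gt0. Qed.
Let lam0 k : 0 < lam k. Proof. by rewrite divr_gt0. Qed.
Let tD (x y : R) : t%:R `^ (x + y) = t%:R `^ x * t%:R `^ y.
Proof. by rewrite powRD // (gt_eqF T0) implybT. Qed.
Let etaD k (x y : R) : eta k `^ (x + y) = eta k `^ x * eta k `^ y.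
Proof. by rewrite powRD // (gt_eqF (eta0 k)) implybT. Qed.
Let powS0 (z : nat) (x : R) : 0 < powS z x. Proof. exact: powS_gt0. Qed.

Lemma lam_mono k : lam k.+1 <= lam k.
Proof. by rewrite ler_pM2l // lef_pV2 ?posrE. Qed.

Lemma lam_powR k x : lam k `^ x = t%:R `^ x / eta k `^ x.
Proof. by rewrite powR_divr // ltW. Qed.

Lemma sumH_le k : \sum_(z < t | above k z) powS z (-1) <= 1 + ln (eta k).
Proof.
rewrite (eq_bigr (fun z : 'I_t => z.+1%:R^-1)); last by move=> z _; rewrite /powS powR_inv1.
apply: le_trans (sum_inv_le (lam0 k) _) _.
  by rewrite ler_pdivrMr // ler_peMr // ltW.
rewrite lerD2l ler_ln ?posrE ?divr_gt0 //.
by rewrite /lam invf_div mulrCA divff ?mulr1 // gt_eqF.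
Qed.

Lemma sumS2_le k : \sum_(z < t | above k z) powS z (a - 1) <= t%:R `^ a / a.
Proof.
apply: le_trans (sum_powR_le t a_gt0 a_le1).
rewrite [leRHS](bigID (fun z : 'I_t => above k z)) /= lerDl.
by apply: sumr_ge0 => z _; exact: powR_ge0.
Qed.

Lemma sumS3_le k : (k <= K)%N ->
  \sum_(z < t | above k z) powS z (- a - 1) <= C3 * (t%:R `^ (- a) * eta k `^ a).
Proof.
move=> kK; have l1 : 1 <= lam k by rewrite ler_pdivlMr // mul1r etaK.
apply: le_trans (sum_powRN_le t a_gt0 l1) _; rewrite -C3E lam_powR.
by rewrite [eta k `^ (- a)]powRN invrK.
Qed.

(** Induction on k over the previous vertex z. For z younger than u the edge weight is proportional
    to z^(beta-1) u^(-beta) and feeds [al]; for z older it is proportional to u^(beta-1) z^(-beta)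
    and feeds [be]. Against both terms of the bound this leaves sums with exponents -1, a - 1 and -a
    - 1. *)
Lemma pathsum_le v k u : start_le v -> (0 < k)%N -> (k <= K.+1)%N -> (u < t)%N ->
  pathsum v k u <= al k * powS u (- beta) + (above k.-1 u)%:R * be k * powS u (beta - 1).
Proof.
move=> sv; elim: k u => [|k IH] // u _ kK ut.
have [k00|kp] := posnP k.
  subst k; have [vt|tv] := ltnP v t; last first.
    rewrite /= big1 => [|z _].
      apply: addr_ge0; first by apply: mulr_ge0; exact: ltW.
      by apply: mulr_ge0; [apply: mulr_ge0 => //|]; exact: ltW.
    by rewrite ltn_eqF ?mulr0 // (leq_trans (ltn_ord z)).
  apply: le_trans (sv u ut); rewrite /= big_mkcond (bigD1 (Ordinal vt)) //= eqxx mulr1.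
  rewrite big1 ?addr0; first by case: ifP => // _; rewrite ltW // edgew_gt0.
  by move=> z; rewrite -val_eqE /= => /negbTE ->; rewrite mulr0; case: ifP.
have kK' : (k <= K)%N by [].
have IHk z := IH z kp (leqW kK').
pose X := kap * powS u (- beta); pose Y := (above k u)%:R * (kap * powS u (beta - 1)).
have X0 : 0 <= X by rewrite mulr_ge0 // ltW.
have Y0 : 0 <= Y by apply: mulr_ge0 => //; apply: mulr_ge0; exact: ltW.
apply: (@le_trans _ _ (\sum_(z < t | above k z)
   (X * (al k * powS z (-1) + be k * powS z (a - 1)) +
    Y * (al k * powS z (- a - 1) + be k * powS z (-1))))).
  apply: ler_sum => z az.
  have zl := IHk z (ltn_ord z).
  have : pathsum v k z <= al k * powS z (- beta) + be k * powS z (beta - 1).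
    apply: le_trans zl _; rewrite lerD2l -mulrA ler_piMl //.
      by rewrite mulr_ge0 // ltW.
    by case: (above _ _).
  move/(ler_wpM2l (ltW (edgew_gt0 m2 rho0 rho1 u z))) => /le_trans; apply.
  have e1 : powS z (-1) = powS z (beta - 1) * powS z (- beta).
    by rewrite -powSD; congr powS; ring.
  have e2 : powS z (a - 1) = powS z (beta - 1) * powS z (beta - 1).
    by rewrite -powSD; congr powS; rewrite aE; ring.
  have e3 : powS z (- a - 1) = powS z (- beta) * powS z (- beta).
    by rewrite -powSD; congr powS; rewrite aE; ring.
  have [uz|zu] := leqP u z.
    rewrite /edgew (maxn_idPr uz) (minn_idPl uz) -[leLHS]addr0; apply: lerD.
      by rewrite le_eqVlt; apply/orP; left; apply/eqP; rewrite /X e1 e2; ring.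
    by rewrite mulr_ge0 // addr_ge0 // mulr_ge0 // ltW.
  rewrite /edgew (maxn_idPl (ltnW zu)) (minn_idPr (ltnW zu)) -[leLHS]add0r; apply: lerD.
    by rewrite mulr_ge0 // addr_ge0 // mulr_ge0 // ltW.
  (* An older z above the level forces u above it, which is the origin of the indicator in the
     second term. *)
  have au : above k u.
    by apply: le_trans az _; rewrite ler_nat ltnW.
  by rewrite le_eqVlt; apply/orP; left; apply/eqP; rewrite /Y au mul1r e1 e3; ring.
rewrite big_split /= -!mulr_sumr !big_split /= -!mulr_sumr.
have H := sumH_le k; have S2 := sumS2_le k; have S3 := sumS3_le kK'.
have -> : al k.+1 * powS u (- beta) + (above k u)%:R * be k.+1 * powS u (beta - 1) =
   X * (al k.+1 / kap) + Y * (be k.+1 / kap).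
  by rewrite /X /Y; field; rewrite gt_eqF.
apply: lerD; apply: ler_wpM2l => //; rewrite ler_pdivlMr //.
  apply: (@le_trans _ _ ((al k * (1 + ln (eta k)) + be k * (t%:R `^ a / a)) * kap)).
    rewrite ler_pM2r //; apply: lerD; rewrite ler_pM2l //.
  (* [c2] is chosen so that this contribution is exactly half of [al k.+1]; [I1] fits the other one
     into the second half. *)
  have e : be k * (t%:R `^ a / a) * kap = t%:R `^ (beta - 1) * (eta k.+1 `^ A / 2).
    have -> : t%:R `^ (beta - 1) = t%:R `^ (- beta) * t%:R `^ a.
      by rewrite -tD; congr powR; rewrite aE; ring.
    rewrite /be c2E; field.
    by rewrite !gt_eqF.
  rewrite mulrDl e /al -!mulrA -mulrDr ler_pM2l ?powR_gt0 //.
  by have := I1 kp; lra.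
apply: (@le_trans _ _ ((al k * (C3 * (t%:R `^ (- a) * eta k `^ a)) + be k * (1 + ln (eta k))) * kap)).
  rewrite ler_pM2r //; apply: lerD; rewrite ler_pM2l //.
have e : al k * (C3 * (t%:R `^ (- a) * eta k `^ a)) * kap =
    t%:R `^ (- beta) * (kap * C3 * eta k `^ (A + a)).
  have -> : t%:R `^ (- beta) = t%:R `^ (beta - 1) * t%:R `^ (- a).
    by rewrite -tD; congr powR; rewrite aE; ring.
  by rewrite (etaD k A a) /al; ring.
rewrite mulrDl e {1}/be -[X in _ + X]mulrA -[X in _ + X]mulrA -mulrDr ler_pM2l ?powR_gt0 //.
by have := I2 kp; lra.
Qed.

Lemma al_mono k l : (k <= l)%N -> al k <= al l.
Proof.
elim: l => [|l IH]; first by rewrite leqn0 => /eqP ->.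
rewrite leq_eqVlt => /orP[/eqP -> //|kl]; apply: le_trans (IH _) _ => //.
by rewrite ler_pM2l ?powR_gt0 //; apply: powR_mono => //; exact: ltW.
Qed.

Lemma be_mono k l : (k <= l)%N -> be k <= be l.
Proof.
elim: l => [|l IH]; first by rewrite leqn0 => /eqP ->.
rewrite leq_eqVlt => /orP[/eqP -> //|kl]; apply: le_trans (IH _) _ => //.
by rewrite ler_pM2l ?powR_gt0 // ler_pM2l //; apply: powR_mono => //; exact: ltW.
Qed.

(** As [lam] decreases, a vertex below level k is below level k - 1 too, so only the [al] term is
    left; it is summed over u + 1 < t / [eta k]. *)
Lemma escape_sum_le v k : start_le v -> (0 < k)%N -> (k <= K.+1)%N ->
  \sum_(u < t | ~~ above k u) pathsum v k u <= (1 - beta)^-1 * eta k `^ (A - (1 - beta)).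
Proof.
move=> sv kp kK.
have b1 : 0 < 1 - beta by rewrite subr_gt0; exact: beta_lt1.
have b1' : 1 - beta <= 1 by have := beta_gt0 rho0; lra.
apply: (@le_trans _ _ (\sum_(u < t | ~~ above k u) al k * powS u ((1 - beta) - 1))).
  apply: ler_sum => u nu; apply: le_trans (pathsum_le sv kp kK (ltn_ord u)) _.
  have -> : above k.-1 u = false.
    apply/negP => ab; case/negP: nu; apply: le_trans ab.
    by case: k kp {kK} => // k _; exact: lam_mono.
  have -> : 1 - beta - 1 = - beta by ring.
  by rewrite !mul0r addr0.
rewrite -mulr_sumr; apply: le_trans (ler_wpM2l (ltW (al0 k)) (sum_powR_lt_le t b1 b1' (lam0 k))) _.
rewrite lam_powR /al le_eqVlt; apply/orP; left; apply/eqP.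
have -> : beta - 1 = - (1 - beta) by ring.
rewrite [t%:R `^ (- _)]powRN [eta k `^ (A - _)]powRB ?(gt_eqF (eta0 _)) ?implybT //; field.
by rewrite !gt_eqF ?powR_gt0.
Qed.

Lemma eta_le k l : (k <= l)%N -> eta k <= eta l.
Proof.
elim: l => [|l IH]; first by rewrite leqn0 => /eqP ->.
by rewrite leq_eqVlt => /orP[/eqP -> //|kl]; apply: le_trans (IH _) _.
Qed.

Let Cgood : R := 2 * C3 + 2 * c2 ^+ 2 / a + 1 + c2.

Lemma etaX_le k l x : (k <= l)%N -> x <= 4 -> 0 <= x -> eta k `^ x <= eta l ^+ 4.
Proof.
move=> kl x4 x0; apply: le_trans (_ : eta k `^ 4 <= _).
  exact: ler_powR.
have e0 := ltW (eta0 k); rewrite -powR_mulrn; last exact: ltW.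
by apply: powR_mono => //; exact: eta_le.
Qed.

(** The powers of t from the two halves combine to 1 / t. The exponents of [eta] are bounded crudely
    by 4, since the last [eta] will be a small power of t. *)
Lemma good_sum_le v w n : start_le v -> start_le w -> (w < t)%N -> above 1 w ->
  (0 < n)%N -> (uphalf n <= K)%N ->
  \sum_(y < t | above (uphalf n) y) pathsum v (uphalf n) y * pathsum w n./2 y
  <= Cgood / t%:R * eta (uphalf n).+1 ^+ 4.
Proof.
move=> sv sw wt aw np nK; set k := uphalf n.
have [kp lk n1P] := half_uphalf np.
have b0 := beta_gt0 rho0; have b1 := beta_lt1 rho0.
have [A0' A1' a0' a1'] : [/\ 0 <= A, A <= 1 - beta, 0 < a & a <= 1] by [].
have E0 : 0 <= eta k.+1 ^+ 4 by rewrite exprn_ge0 // ltW.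
have E (x : R) j : (j <= k.+1)%N -> x <= 4 -> 0 <= x -> eta j `^ x <= eta k.+1 ^+ 4.
  by move=> *; exact: etaX_le.
(* A single edge: the second half is empty, and the zero-step [pathsum] is an indicator outside the
   scope of [pathsum_le]. *)
have [l0|lp] := posnP n./2.
  have n1 := n1P l0.
  rewrite l0 /k n1 -[uphalf 1]/1%N.
  have -> : (\sum_(y < t | above 1 y) pathsum v 1 y * pathsum w 0 y) = pathsum v 1 w.
    move: (pathsum v 1) => f.
    rewrite big_mkcond (bigD1 (Ordinal wt)) //= aw eqxx mulr1 big1 ?addr0 //.
    by move=> y; rewrite -val_eqE /= => /negbTE ->; rewrite mulr0; case: ifP.
  apply: le_trans (pathsum_le sv _ _ wt) _ => //.
  have k2 : k.+1 = 2%N by rewrite /k n1.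
  rewrite k2 in E E0.
  have l1 : powS w (- beta) <= t%:R `^ (- beta) * eta 1 `^ beta.
    apply: le_trans (powR_antimono (ltW b0) (lam0 1) aw) _.
    by rewrite lam_powR [eta 1 `^ (- beta)]powRN invrK.
  have l2 : powS w (beta - 1) <= t%:R `^ (beta - 1) * eta 1 `^ (1 - beta).
    have -> : beta - 1 = - (1 - beta) by ring.
    apply: le_trans (powR_antimono _ (lam0 1) aw) _; first by lra.
    by rewrite lam_powR [eta 1 `^ (- (1 - beta))]powRN invrK.
  have ti : t%:R `^ (beta - 1) * t%:R `^ (- beta) = t%:R^-1 :> R.
    rewrite -tD -powR_inv1; last exact: ltW.
    by congr powR; ring.
  have -> : Cgood / t%:R * eta 2 ^+ 4 = t%:R^-1 * eta 2 ^+ 4 + t%:R^-1 * (c2 * eta 2 ^+ 4) +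
     (2 * C3 + 2 * c2 ^+ 2 / a) / t%:R * eta 2 ^+ 4 by rewrite /Cgood; ring.
  rewrite -[leLHS]addr0; apply: lerD; last first.
    have D0 : 0 <= 2 * C3 + 2 * c2 ^+ 2 / a.
      have s0 : 0 <= c2 ^+ 2 / a by apply: divr_ge0; [exact: sqr_ge0|exact: ltW].
      by rewrite -[2 * c2 ^+ 2 / a]mulrA addr_ge0 // mulr_ge0 // ltW.
    by rewrite mulr_ge0 // divr_ge0 // ltW.
  apply: lerD.
    apply: le_trans (ler_wpM2l (ltW (al0 1)) l1) _.
    have -> : al 1 * (t%:R `^ (- beta) * eta 1 `^ beta) = t%:R^-1 * eta 1 `^ (A + beta).
      by rewrite -ti (etaD 1 A beta) /al; ring.
    by rewrite ler_pM2l ?invr_gt0 //; apply: E => //; lra.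
  have [_|_] := boolP (above 0 w); last by rewrite !mul0r mulr_ge0 ?invr_ge0 ?mulr_ge0 // ltW.
  rewrite mul1r; apply: le_trans (ler_wpM2l (ltW (be0 1)) l2) _.
  have -> : be 1 * (t%:R `^ (beta - 1) * eta 1 `^ (1 - beta)) =
      t%:R^-1 * (c2 * (eta 2 `^ A * eta 1 `^ (1 - beta))).
    by rewrite -ti /be; ring.
  rewrite ler_pM2l ?invr_gt0 // ler_pM2l //.
  apply: (@le_trans _ _ (eta 2 `^ A * eta 2 `^ (1 - beta))).
    by rewrite ler_pM2l ?powR_gt0 //; apply: powR_mono; [lra|exact: ltW|exact: eta_le].
  by rewrite -etaD; apply: E => //; lra.
apply: (@le_trans _ _ (\sum_(y < t | above k y)
   (2 * al k ^+ 2 * powS y (- a - 1) + 2 * be k ^+ 2 * powS y (a - 1)))).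
  apply: ler_sum => y _; set z1 := powS y (- beta); set z2 := powS y (beta - 1).
  have -> : powS y (- a - 1) = z1 * z1.
    by rewrite /z1 /z2 -powSD; congr powS; rewrite aE; ring.
  have -> : powS y (a - 1) = z2 * z2.
    by rewrite /z1 /z2 -powSD; congr powS; rewrite aE; ring.
  have z10 : 0 < z1 by exact: powS0.
  have z20 : 0 < z2 by exact: powS0.
  have b2 j u' : start_le u' -> (0 < j)%N -> (j <= k)%N -> pathsum u' j y <= al k * z1 + be k * z2.
    move=> su jp jk; apply: le_trans (pathsum_le su jp (leq_trans jk (leqW nK)) (ltn_ord y)) _.
    apply: lerD; first by rewrite ler_pM2r //; exact: al_mono.
    rewrite ler_pM2r // -[leRHS]mul1r; apply: ler_pM => //; first exact: ltW.
      by case: (above _ _).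
    exact: be_mono.
  apply: (@le_trans _ _ ((al k * z1 + be k * z2) ^+ 2)).
    rewrite expr2; apply: ler_pM; rewrite ?pathsum_ge0 //; first exact: b2.
    exact: b2.
  set x := al k * z1; set y' := be k * z2.
  have -> : 2 * al k ^+ 2 * (z1 * z1) + 2 * be k ^+ 2 * (z2 * z2) = 2 * x ^+ 2 + 2 * y' ^+ 2.
    by rewrite /x /y'; ring.
  by have := sqr_ge0 (x - y'); rewrite sqrrB sqrrD; lra.
rewrite big_split /= -!mulr_sumr.
have S2 := sumS2_le k; have S3 := sumS3_le nK.
have T1 : 2 * al k ^+ 2 * \sum_(y < t | above k y) powS y (- a - 1) <=
   2 * C3 / t%:R * eta k.+1 ^+ 4.
  apply: le_trans (ler_wpM2l _ S3) _; first by rewrite mulr_ge0 ?sqr_ge0.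
  have -> : 2 * al k ^+ 2 * (C3 * (t%:R `^ (- a) * eta k `^ a)) =
     2 * C3 / t%:R * eta k `^ (A + A + a).
    have -> : t%:R^-1 = t%:R `^ (beta - 1) * t%:R `^ (beta - 1) * t%:R `^ (- a) :> R.
      rewrite -!tD -powR_inv1; last exact: ltW.
      by congr powR; rewrite aE; ring.
    by rewrite (etaD k (A + A) a) (etaD k A A) /al; ring.
  apply: ler_wpM2l; first by rewrite !mulr_ge0 ?invr_ge0 // ltW.
  by apply: E => //; lra.
have T2 : 2 * be k ^+ 2 * \sum_(y < t | above k y) powS y (a - 1) <=
   2 * c2 ^+ 2 / a / t%:R * eta k.+1 ^+ 4.
  apply: le_trans (ler_wpM2l _ S2) _; first by rewrite mulr_ge0 ?sqr_ge0.
  have -> : 2 * be k ^+ 2 * (t%:R `^ a / a) = 2 * c2 ^+ 2 / a / t%:R * eta k.+1 `^ (A + A).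
    have -> : t%:R^-1 = t%:R `^ (- beta) * t%:R `^ (- beta) * t%:R `^ a :> R.
      rewrite -!tD -powR_inv1; last exact: ltW.
      by congr powR; rewrite aE; ring.
    by rewrite (etaD k.+1 A A) /be; ring.
  apply: ler_wpM2l; first by rewrite !mulr_ge0 ?invr_ge0 ?sqr_ge0 // ltW.
  by apply: E => //; lra.
apply: le_trans (lerD T1 T2) _; rewrite -mulrDl; apply: ler_wpM2r => //.
rewrite -mulrDl ler_pM2r ?invr_gt0 // /Cgood; have := c20; lra.
Qed.

Definition escapes (v k : nat) (h : seq nat) : Prop :=
  exists p, [/\ size p = k, above_upto lam v k p && ~~ above k (last v p), uniq (v :: p),
    all (fun x => x < t)%N p & path (hadj m h) v p].

(** The least violated index is the escape time; it is positive because the starting vertex is above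
    level 0. *)
Lemma escapes_of_path h v p i : uniq (v :: p) -> all (fun x => x < t)%N p ->
  path (hadj m h) v p -> (i <= size p)%N -> ~~ above i (nth 0%N (v :: p) i) -> above 0 v ->
  exists2 k, (0 < k <= i)%N & escapes v k h.
Proof.
move=> up ap pp ip ni a0v.
have ex : exists i, ~~ above i (nth 0%N (v :: p) i) by exists i.
case: (ex_minnP ex) => k nk kmin; have ki := kmin _ ni.
have kp : (0 < k)%N by case: k nk {kmin ki} => //=; rewrite a0v.
exists k; first by rewrite kp ki.
have kszp : (k <= size p)%N by exact: leq_trans ip.
have tE : v :: take k p = take k.+1 (v :: p) by [].
exists (take k p); split.
- by rewrite size_takel.
- apply/andP; split.
    apply/allP => j; rewrite mem_iota /= add0n => jk.
    rewrite tE nth_take ?ltnS ?(ltnW jk) //; apply/negPn/negP => /kmin.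
    by rewrite leqNgt jk.
  by rewrite (last_nth 0%N) size_takel // tE nth_take.
- by rewrite tE take_uniq.
- by apply/allP => x /mem_take; exact: (allP ap).
by move: pp; rewrite -{1}(cat_take_drop k p) cat_path => /andP[].
Qed.

Definition good_path (v w k l : nat) (h : seq nat) : Prop :=
  exists p, [/\ size p = (k + l)%N,
      [&& above_upto lam v k.+1 p, all (fun j => above j (nth 0%N (v :: p) (k + l - j))) (iota 0 l)
        & last v p == w], uniq (v :: p),
      all (fun x => x < t)%N p & path (hadj m h) v p].

Definition joined (v w n0 : nat) (h : seq nat) : Prop :=
  exists p, [/\ path (hadj m h) v p, all (fun x => x < t)%N p, last v p = w,
    uniq (v :: p) & (size p <= n0)%N].

(** A violation counted from the far end is an escape of the reversed path, which starts at w. *)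
Lemma joined_cases v w n0 h : (v < t)%N -> v != w -> above 0 v -> above 0 w ->
  joined v w n0 h ->
  (exists2 k, (0 < k <= uphalf n0)%N & escapes v k h \/ escapes w k h) \/
  (exists2 n, (0 < n <= n0)%N & good_path v w (uphalf n) n./2 h).
Proof.
move=> vt vw av aw [p [pp ap lp up sp]].
set n := size p.
have np : (0 < n)%N by rewrite lt0n; apply: contra vw => /nilP p0; rewrite -lp p0.
have kn : (uphalf n <= n)%N by rewrite leq_uphalf_double -addnn leq_addr.
have kn0 : (uphalf n <= uphalf n0)%N by apply: uphalf_leq.
have ln : (n./2 <= uphalf n)%N by rewrite uphalf_half leq_addl.
have nE : (uphalf n + n./2 = n)%N by rewrite uphalf_half -addnA addnn odd_double_half.
have [/hasP[i]|/hasPn nv] := boolP (has (fun i => ~~ above i (nth 0%N (v :: p) i)) (iota 0 (uphalf n).+1)).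
  rewrite mem_iota /= add0n ltnS => ik ni.
  have [k /andP[k1 k2] ek] := escapes_of_path up ap pp (leq_trans ik kn) ni av.
  left; exists k; last by left.
  by rewrite k1 (leq_trans k2) // (leq_trans ik).
have [/hasP[j]|/hasPn nw] := boolP (has (fun j => ~~ above j (nth 0%N (v :: p) (n - j))) (iota 0 n./2)).
  rewrite mem_iota /= add0n => jl nj.
  pose q := rev (belast v p).
  have wq : w :: q = rev (v :: p) by rewrite /q [v :: p]lastI rev_rcons lp.
  have uq : uniq (w :: q) by rewrite wq rev_uniq.
  have aq : all (fun x => x < t)%N q.
    have : all (fun x => x < t)%N (w :: q) by rewrite wq all_rev /= vt.
    by case/andP.
  have pq : path (hadj m h) w q.
    rewrite -lp rev_path; apply: sub_path pp => x y; by rewrite /= hadj_sym.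
  have jn : (j <= n)%N by rewrite (leq_trans (ltnW jl)) // (leq_trans ln).
  have sq : size q = n by rewrite size_rev size_belast.
  have nj' : ~~ above j (nth 0%N (w :: q) j).
    by rewrite wq nth_rev /= ?ltnS // subSS.
  have jq : (j <= size q)%N by rewrite sq.
  have [k /andP[k1 k2] ek] := escapes_of_path uq aq pq jq nj' aw.
  left; exists k; last by right.
  by rewrite k1 (leq_trans k2) // (leq_trans (ltnW jl)) // (leq_trans ln).
right; exists n; first by rewrite np.
exists p; split=> //; rewrite nE; apply/and3P; split; last by rewrite lp.
  by apply/allP => i /nv; rewrite negbK.
by apply/allP => i /nw; rewrite negbK.
Qed.

Lemma joined_prob_le v w n0 : (v < t)%N -> (w < t)%N -> v != w ->
  start_le v -> start_le w -> above 0 v -> above 0 w -> uphalf n0 = K ->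
  pexp (t * m) (fun h => `[< joined v w n0 h >]%:R) [::] <=
  2 * (1 - beta)^-1 * (\sum_(1 <= k < K.+1) eta k `^ (A - (1 - beta))) +
  n0%:R * (Cgood / t%:R * eta K.+1 ^+ 4).
Proof.
move=> vt wt vw sv sw av aw nK.
pose ev := fun h => \sum_(1 <= k < K.+1) (`[< escapes v k h >]%:R + `[< escapes w k h >]%:R)
   + \sum_(1 <= n < n0.+1) `[< good_path v w (uphalf n) n./2 h >]%:R : R.
apply: (@le_trans _ _ (pexp (t * m) ev [::])).
  apply: pexp_le => // h _ _; case: asboolP => [jo|_]; last first.
    by apply: addr_ge0; apply: sumr_ge0 => k _; rewrite ?addr_ge0.
  rewrite /ev; case: (joined_cases vt vw av aw jo) => [[k /andP[k1 k2] ek]|[n /andP[n1 n2] gn]].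
    rewrite -[leLHS]addr0; apply: lerD; last by apply: sumr_ge0.
    rewrite big_mkcond (bigD1_seq k) ?iota_uniq //=; last by rewrite mem_index_iota k1 ltnS -nK.
    rewrite -[leLHS]addr0; apply: lerD; last by apply: sumr_ge0 => i _; rewrite addr_ge0.
    by case: ek => /asboolP -> /=; rewrite ?lerDl ?lerDr.
  rewrite -[leLHS]add0r; apply: lerD; first by apply: sumr_ge0 => k _; rewrite addr_ge0.
  rewrite big_mkcond (bigD1_seq n) ?iota_uniq //=; last by rewrite mem_index_iota n1 ltnS.
  rewrite -[leLHS]addr0; apply: lerD; last by apply: sumr_ge0.
  by move/asboolP: gn => ->.
rewrite /ev pexpDf !pexp_sum; apply: lerD.
  rewrite mulr_sumr big_nat [leRHS]big_nat; apply: ler_sum => k /andP[k1 k2].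
  rewrite pexpDf; set X := eta k `^ _.
  have -> : 2 / (1 - beta) * X = (1 - beta)^-1 * X + (1 - beta)^-1 * X by ring.
  have esc u : (u < t)%N -> start_le u ->
      pexp (t * m) (fun h => `[< escapes u k h >]%:R) [::] <=
      (1 - beta)^-1 * X.
    move=> ut su; apply: le_trans (escape_prob_le m2 rho0 rho1 lam k ut) _.
    exact: escape_sum_le (ltnW k2).
  by apply: lerD; exact: esc.
apply: (@le_trans _ _ (\sum_(1 <= n < n0.+1) (Cgood / t%:R * eta K.+1 ^+ 4))).
  rewrite big_nat [leRHS]big_nat; apply: ler_sum => n /andP[n1 n2].
  have a1w : above 1 w by apply: le_trans (lam_mono 0) aw.
  have nkK : (uphalf n <= K)%N by rewrite -nK; apply: uphalf_leq.
  apply: le_trans (good_prob_le m2 rho0 rho1 lam (uphalf n) n./2 vt wt) _.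
  apply: le_trans (good_sum_le sv sw wt a1w n1 nkK) _.
  apply: ler_wpM2l.
    have s0 : 0 <= c2 ^+ 2 / a by apply: divr_ge0; [exact: sqr_ge0|exact: ltW].
    rewrite divr_ge0 // /Cgood -[2 * c2 ^+ 2 / a]mulrA.
    by move: (c2 ^+ 2 / a) s0 (C30) (c20) => z *; lra.
  rewrite ler_pXn2r ?nnegrE ?(ltW (eta0 _)) //; exact: eta_le.
by rewrite sumr_const_nat subn1 /= mulr_natl.
Qed.

End TruncatedPaths.

(** * Properties of all large reals *)

Section Eventually.
Variable R : realType.

Definition evR (P : R -> Prop) : Prop := exists B, forall x, B <= x -> P x.

Lemma evR_and P Q : evR P -> evR Q -> evR (fun x => P x /\ Q x).
Proof.
move=> [a Pa] [b Qb]; exists (Num.max a b) => x; rewrite ge_max => /andP[ax bx].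
by split; [exact: Pa|exact: Qb].
Qed.

Lemma evR_imp (P Q : R -> Prop) : (forall x, P x -> Q x) -> evR P -> evR Q.
Proof. by move=> PQ [a Pa]; exists a => x /Pa/PQ. Qed.

Lemma evR_ge a : evR (fun x => a <= x).
Proof. by exists a. Qed.

Lemma evR_forall P : evR P -> evR (fun x => forall y, x <= y -> P y).
Proof. by move=> [a Pa]; exists a => x ax y xy; apply: Pa; exact: le_trans xy. Qed.

Lemma evR_exists P : evR P -> exists x, P x.
Proof. by move=> [a Pa]; exists a; apply: Pa. Qed.

Lemma evR_expR C d : 0 < d -> evR (fun x => C * (1 + x) <= expR (d * x)).
Proof.
move=> d0; exists (Num.max 1 (4 * `|C| / d ^+ 2)) => x.
rewrite ge_max => /andP[x1 xC].
have dx : 0 <= d * x by rewrite mulr_ge0 //; [exact: ltW|exact: le_trans x1].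
have := expR_ge1Dxn 1 dx; rewrite (_ : 2`!%:R = 2) // => le; apply: le_trans le.
have x0 : 0 < x by exact: lt_le_trans x1.
have c1 : C * (1 + x) <= `|C| * (1 + x).
  by apply: ler_wpM2r; [rewrite addr_ge0 // ltW|exact: ler_norm].
have c2 : `|C| * (1 + x) <= `|C| * (2 * x) by apply: ler_wpM2l => //; lra.
move: xC; rewrite ler_pdivrMr ?exprn_gt0 // => xC.
have := ler_wpM2r (ltW x0) xC; rewrite exprMn.
have -> : x * d ^+ 2 * x = d ^+ 2 * x ^+ 2 by ring.
by move: c1 c2; move: (d ^+ 2 * x ^+ 2) => z; lra.
Qed.

Lemma evR_powR_lt C w : w < 1 -> evR (fun x => C * x `^ w <= x).
Proof.
move=> w1; have w0 : 0 < 1 - w by rewrite subr_gt0.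
exists (Num.max 1 ((1 + `|C|) `^ (1 - w)^-1)) => x; rewrite ge_max => /andP[x1 xC].
have x0 : 0 < x by exact: lt_le_trans x1.
have c0 : 0 < 1 + `|C| by rewrite ltr_pwDl.
have : 1 + `|C| <= x `^ (1 - w).
  have := powR_mono (ltW w0) (powR_ge0 _ _) xC.
  by rewrite -powRrM mulVf ?gt_eqF // powRr1 // ltW.
have xw : 0 < x `^ w by exact: powR_gt0.
move=> /(ler_wpM2r (ltW xw)); rewrite -powRD ?(gt_eqF x0) ?implybT // subrK powRr1 ?(ltW x0) //.
apply: le_trans; apply: ler_wpM2r; first exact: ltW.
by apply: le_trans (ler_norm C) _; rewrite lerDr.
Qed.

Lemma evR_ln_nat P : evR P -> exists T : nat, forall t, (T <= t)%N -> P (ln t%:R).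
Proof.
move=> [a Pa]; exists (Num.bound (expR a)) => t Tt; apply: Pa.
have e0 := expR_gt0 a.
have lt : expR a < t%:R.
  by apply: lt_le_trans (archi_boundP (ltW e0)) _; rewrite ler_nat.
by rewrite -[a]expRK ler_ln ?posrE ?(lt_trans e0 lt) //; exact: ltW.
Qed.

End Eventually.

Lemma uphalf_natr_le (R : realType) n : (uphalf n).+1%:R <= n%:R / 2 + 2 :> R.
Proof.
have : (2 * uphalf n <= n + 1)%N by lia.
have e : (uphalf n).+1%:R = (uphalf n)%:R + 1 :> R by rewrite -natr1.
by rewrite -(ler_nat R) natrM natrD e; lra.
Qed.

Lemma double_sum_le (R : realType) t (f : 'I_t -> 'I_t -> R) (g : nat -> R) c : (0 < t)%N ->
  (forall v w : 'I_t, f v w <= g v + g w + (v == w)%:R + c) ->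
  \sum_(v < t) \sum_(w < t) f v w / t%:R ^+ 2 <=
  2 * (\sum_(v < t) g v) / t%:R + t%:R^-1 + c.
Proof.
move=> t0 fg; have T0 : 0 < t%:R :> R by rewrite ltr0n.
have E (x : R) : \sum_(i < t) x = t%:R * x by rewrite sumr_const card_ord mulr_natl.
have D (v : 'I_t) : \sum_(w < t) (v == w)%:R = 1 :> R.
  by rewrite (bigD1 v) //= eqxx big1 ?addr0 // => w wv; rewrite eq_sym (negbTE wv).
apply: (@le_trans _ _ (\sum_(v < t) (t%:R * g v + \sum_(w < t) g w + 1 + t%:R * c) / t%:R ^+ 2)).
  apply: ler_sum => v _; rewrite -mulr_suml ler_pM2r ?invr_gt0 ?exprn_gt0 //.
  apply: le_trans (ler_sum _ (fun w _ => fg v w)) _.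
  by rewrite !big_split /= D !E.
rewrite -mulr_suml !big_split /= !E -mulr_sumr le_eqVlt; apply/orP; left; apply/eqP.
by field; rewrite gt_eqF.
Qed.

(** * Lower bound on the distance *)

Section LowerBound.
Variables (R : realType) (m : nat) (rho : R).
Hypotheses (m2 : (1 < m)%N) (rho0 : 0 < rho) (rho1 : rho < 1).

Local Notation beta := (beta rho).
Local Notation kap := (kap m rho).
Local Notation pexp := (pexp m rho).
Let a : R := 2 * beta - 1.
Let C3 : R := 1 + a^-1.
Let c2 : R := a / (2 * kap).
Let l : R := - ln rho.

Lemma l_gt0 : 0 < l.
Proof. by rewrite /l oppr_gt0 ln_lt0 // rho0. Qed.

Lemma beta_compl : 1 - beta = beta * rho.
Proof. by rewrite -[X in X - _](beta_eq rho0); ring. Qed.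

(* The growth rate theta of the truncation levels has to exceed (beta / (1 - beta))^(1/2) =
   rho^(-1/2), while n0 / 2 levels must not descend below a power of t. *)
Lemma truncation_exponents x : 0 < x -> x * l < 4 ->
  exists th A, [/\ 1 < th, x / 2 * ln th < 1, 0 < A, A < 1 - beta
     & A + a < A * th ^+ 2].
Proof.
move=> x0 xl; have l0 := l_gt0; have xl0 : 0 < x * l by rewrite mulr_gt0.
(* Then x l (1 + y) is the midpoint of x l and 4, and th ^ 2 exceeds 1 / rho by the factor exp (l
   y). *)
pose y := (4 / (x * l) - 1) / 2.
have y0 : 0 < y by rewrite divr_gt0 // subr_gt0 ltr_pdivlMr // mul1r.
have xy : x * l * (1 + y) < 4.
  have -> : x * l * (1 + y) = (x * l + 4) / 2     by rewrite /y; move: (x * l) xl0 => z z0; field; rewrite gt_eqF.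
  by lra.
pose th := expR (l * (1 + y) / 2).
have th1 : 1 < th by rewrite expR_gt1 divr_gt0 // mulr_gt0 // addr_gt0.
have th2 : th ^+ 2 = rho^-1 * expR (l * y).
  rewrite -expRM_natl; have -> : 2%:R * (l * (1 + y) / 2) = l + l * y by field.
  by rewrite expRD /l expRN lnK ?posrE.
have ely : 1 < expR (l * y) by rewrite expR_gt1 mulr_gt0.
have b0 := beta_gt0 rho0; have b1 := beta_lt1 rho0.
set s := 1 - beta; have s0 : 0 < s by rewrite subr_gt0.
have d0 : 0 < s * th ^+ 2 - beta.
  have -> : s * th ^+ 2 = beta * expR (l * y).
    by rewrite /s beta_compl th2; field; rewrite gt_eqF.
  by rewrite subr_gt0 ltr_pMr.
have t20 : 0 < th ^+ 2 by rewrite exprn_gt0 // (lt_trans _ th1).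
have t21 : 1 < th ^+ 2 by rewrite exprn_egt1.
(* At A = s the last inequality reads beta < s th ^ 2, which is strict; [sg] is a decrease of A
   small enough to preserve it. *)
pose sg := Num.min (s / 2) ((s * th ^+ 2 - beta) / (2 * th ^+ 2)).
have sg0 : 0 < sg by rewrite lt_min !divr_gt0 // mulr_gt0.
have sg1 : sg <= s / 2 by rewrite ge_min lexx.
have sg2 : sg * th ^+ 2 <= (s * th ^+ 2 - beta) / 2.
  have : sg <= (s * th ^+ 2 - beta) / (2 * th ^+ 2) by rewrite ge_min lexx orbT.
  rewrite ler_pdivlMr ?mulr_gt0 //; move: (th ^+ 2) => w; lra.
exists th, (s - sg); split => //.
- rewrite /th expRK.
  have -> : x / 2 * (l * (1 + y) / 2) = x * l * (1 + y) / 4 by field.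
  by lra.
- by lra.
- by lra.
have -> : s - sg + a = beta - sg by rewrite /s /a; ring.
by rewrite mulrBl; lra.
Qed.

(** These are [I1] and [I2] with L = ln (eta k): consecutive levels have logarithms L, th L and th ^
    2 L. Positive gaps between the exponents absorb the constants and the factor 1 + L for large
    L. *)
Lemma exp_levels A th : 1 < th -> 0 < A -> A < 1 - beta -> A + a < A * th ^+ 2 ->
  evR (fun L => 2 * kap * (1 + L) * expR (A * L) <= expR (A * (th * L)) /\
    kap * C3 * expR ((A + a) * L) + kap * c2 * expR (A * (th * L)) * (1 + L)
     <= c2 * expR (A * (th ^+ 2 * L))).
Proof.
move=> th1 A0 A1 Aa; set D := A * th ^+ 2 - (A + a).
have D0 : 0 < D by rewrite subr_gt0.
have th10 : 0 < th - 1 by rewrite subr_gt0.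
have th0 : 0 < th by exact: lt_trans th1.
have k0 := kap_gt0 m2 rho0 rho1.
have a0 : 0 < a by rewrite /a; have := beta_gt_half rho0 rho1; lra.
have c20 : 0 < c2 by rewrite divr_gt0 // mulr_gt0.
have C30 : 0 < C3 by rewrite addr_gt0 // invr_gt0.
have d1 : 0 < A * (th - 1) by rewrite mulr_gt0.
have d2 : 0 < A * th * (th - 1) by rewrite !mulr_gt0.
apply: evR_imp (evR_and (evR_and (evR_expR (2 * kap) d1) (evR_expR (2 * kap) d2))
  (evR_and (evR_expR (2 * kap * C3 / c2) D0) (evR_ge 0))) => L [[h1 h2] [h3 L0]]; split.
  have -> : A * (th * L) = A * (th - 1) * L + A * L by ring.
  by rewrite expRD ler_pM2r ?expR_gt0.
have e1 : kap * C3 * expR ((A + a) * L) <= c2 / 2 * expR (A * (th ^+ 2 * L)).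
  have -> : A * (th ^+ 2 * L) = D * L + (A + a) * L by rewrite /D; ring.
  rewrite expRD mulrA ler_pM2r ?expR_gt0 //.
  apply: (@le_trans _ _ (c2 / 2 * (2 * kap * C3 / c2))).
    by rewrite le_eqVlt; apply/orP; left; apply/eqP; field; rewrite gt_eqF.
  apply: ler_wpM2l; first by rewrite divr_ge0 // ltW.
  apply: le_trans h3.
  have pos : 0 < 2 * kap * C3 / c2 by rewrite divr_gt0 // mulr_gt0 // mulr_gt0.
  by rewrite ler_peMr ?lerDl //; exact: ltW.
have e2 : kap * c2 * expR (A * (th * L)) * (1 + L) <= c2 / 2 * expR (A * (th ^+ 2 * L)).
  have -> : A * (th ^+ 2 * L) = A * th * (th - 1) * L + A * (th * L) by ring.
  have -> : kap * c2 * expR (A * (th * L)) * (1 + L) =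
            c2 / 2 * (2 * kap * (1 + L)) * expR (A * (th * L)) by field.
  by rewrite expRD [leRHS]mulrA ler_pM2r ?expR_gt0 // ler_pM2l // divr_gt0.
have -> : c2 * expR (A * (th ^+ 2 * L)) =
   c2 / 2 * expR (A * (th ^+ 2 * L)) + c2 / 2 * expR (A * (th ^+ 2 * L)) by field.
exact: lerD.
Qed.

(** For v + 1 at least t z0, the powers of v + 1 are within constants depending on z0 of those of t;
    B is taken large enough for the first levels to absorb these constants. *)
Lemma start_le_recent A th B z0 t v : 1 < th -> 0 < A -> (0 < t)%N -> (v < t)%N ->
  0 < z0 -> t%:R * z0 <= v.+1%:R ->
  kap * z0 `^ (beta - 1) <= expR (A * (B * th)) ->
  kap * z0 `^ (- beta) <= c2 * expR (A * (B * th ^+ 2)) ->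
  z0^-1 <= expR B ->
  start_le m rho t (fun k => expR (B * th ^+ k)) A c2 v.
Proof.
move=> th1 A0 t0 vt z00 vz h1 h2 h3 u ut.
have T0 : 0 < t%:R :> R by rewrite ltr0n.
have k0 := kap_gt0 m2 rho0 rho1.
have b0 := beta_gt0 rho0; have b1 := beta_lt1 rho0.
have a0 : 0 < a by rewrite /a; have := beta_gt_half rho0 rho1; lra.
have c20 : 0 < c2 by rewrite divr_gt0 // mulr_gt0.
have tz0 : 0 < t%:R * z0 by rewrite mulr_gt0.
have pe k : expR (B * th ^+ k) `^ A = expR (A * (B * th ^+ k)).
  by rewrite powRE ?expR_gt0 // expRK.
have [uv|vu] := leqP u v.
  rewrite /edgew (maxn_idPr uv) (minn_idPl uv) -[leLHS]addr0; apply: lerD; last first.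
    apply: mulr_ge0; last exact: powR_ge0.
    by apply: mulr_ge0 => //; rewrite mulr_ge0 ?powR_ge0 // mulr_ge0 ?powR_ge0 // ltW.
  rewrite ler_pM2r ?powS_gt0 // pe expr1.
  apply: (@le_trans _ _ (kap * (t%:R * z0) `^ (beta - 1))).
    rewrite ler_pM2l // (_ : beta - 1 = - (1 - beta)); last by ring.
    by apply: powR_antimono => //; lra.
  rewrite powRM ?(ltW T0) ?(ltW z00) // mulrCA ler_pM2l ?powR_gt0 //.
have -> : above (fun k => t%:R / expR (B * th ^+ k)) 0 u.
  apply: le_trans (_ : t%:R * z0 <= _).
    rewrite ler_pM2l // expr0 mulr1 -[leRHS]invrK lef_pV2 ?posrE ?expR_gt0 ?invr_gt0 //.
  by apply: le_trans vz _; rewrite ler_nat ltnW.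
rewrite /edgew (maxn_idPl (ltnW vu)) (minn_idPr (ltnW vu)) -[leLHS]add0r; apply: lerD.
  by apply: mulr_ge0; [apply: mulr_ge0|]; exact: powR_ge0.
rewrite mul1r mulrAC ler_pM2r ?powS_gt0 // pe.
apply: (@le_trans _ _ (kap * (t%:R * z0) `^ (- beta))).
  by rewrite ler_pM2l //; apply: powR_antimono => //; exact: ltW.
by rewrite powRM ?(ltW T0) ?(ltW z00) // mulrCA ler_pM2l ?powR_gt0.
Qed.

Lemma geometric_sum_le (th : R) K : 1 < th ->
  \sum_(1 <= k < K) (th ^+ k)^-1 <= (th - 1)^-1.
Proof.
move=> th1; have th0 : 0 < th by exact: lt_trans th1.
have d0 : 0 < th - 1 by rewrite subr_gt0.
case: K => [|K]; first by rewrite big_geq // invr_ge0 ltW.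
have : \sum_(1 <= k < K.+1) (th ^+ k)^-1 = (th - 1)^-1 * (1 - (th ^+ K)^-1).
  elim: K => [|K IH]; first by rewrite big_geq // expr0 invr1 subrr mulr0.
  rewrite big_nat_recr //= IH exprS; field.
  by rewrite !gt_eqF ?exprn_gt0.
move=> ->; rewrite ler_piMr ?invr_ge0 ?(ltW d0) // gerBl invr_ge0.
by apply: exprn_ge0; exact: ltW.
Qed.

Lemma pexp_bool_le1 k (P : seq nat -> Prop) h : valid m h ->
  pexp k (fun h' => `[< P h' >]%:R) h <= 1.
Proof.
move=> vh; apply: le_trans (_ : pexp k (fun=> 1) h <= _); last by rewrite pexp_cst.
by apply: pexp_le => // h' _ _; case: (`[< _ >]).
Qed.

Lemma lower_bound x e : 0 < x -> x * l < 4 -> 0 < e ->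
  exists T : nat, forall t n0 : nat, (T <= t)%N -> n0%:R <= x * ln (ln t%:R) ->
  \sum_(v < t) \sum_(w < t)
    pexp (t * m) (fun h => `[< joined m t v w n0 h >]%:R) [::] / t%:R ^+ 2 <= e.
Proof.
move=> x0 xl e0; have [th [A [th1 om1 A0 A1 Aa]]] := truncation_exponents x0 xl.
have th0 : 0 < th by exact: lt_trans th1.
have k0 := kap_gt0 m2 rho0 rho1.
have b0 := beta_gt0 rho0; have b1 := beta_lt1 rho0.
have a0 : 0 < a by rewrite /a; have := beta_gt_half rho0 rho1; lra.
have c20 : 0 < c2 by rewrite divr_gt0 // mulr_gt0.
have s0 : 0 < 1 - beta by rewrite subr_gt0.
set sg := 1 - beta - A; have sg0 : 0 < sg by rewrite /sg; lra.
(* Vertices older than t z0 are given up; the two endpoints together cost 2 z0 = e / 4. *)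
set z0 := e / 8; have z00 : 0 < z0 by rewrite divr_gt0.
have d1 : 0 < A * th by rewrite mulr_gt0.
have d2 : 0 < A * th ^+ 2 by rewrite mulr_gt0 // exprn_gt0.
have [B [[[lev B2] [B3 B4]] [B5 B1]]] := evR_exists
  (evR_and (evR_and (evR_and (evR_forall (exp_levels th1 A0 A1 Aa))
      (evR_expR (kap * z0 `^ (beta - 1)) d1))
    (evR_and (evR_expR (kap * z0 `^ (- beta) / c2) d2) (evR_expR z0^-1 ltr01)))
   (evR_and (evR_ge (8 / ((1 - beta) * sg * (th - 1) * e))) (evR_ge 1))).
have B0 : 0 < B by exact: lt_le_trans B1.
have simp C y : 0 <= C -> C * (1 + B) <= y -> C <= y.
  by move=> C0; apply: le_trans; rewrite ler_peMr // lerDl ltW.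
have {}B2 : kap * z0 `^ (beta - 1) <= expR (A * (B * th)).
  have -> : A * (B * th) = A * th * B by ring.
  by apply: simp B2; rewrite mulr_ge0 ?powR_ge0 // ltW.
have {}B3 : kap * z0 `^ (- beta) <= c2 * expR (A * (B * th ^+ 2)).
  have -> : A * (B * th ^+ 2) = A * th ^+ 2 * B by ring.
  rewrite [c2 * _]mulrC -ler_pdivrMr //; apply: simp B3.
  by rewrite divr_ge0 ?(ltW c20) // mulr_ge0 ?powR_ge0 // ltW.
have {}B4 : z0^-1 <= expR B.
  by apply: simp; [rewrite invr_ge0 ltW|move: B4; rewrite mul1r].
pose eta k := expR (B * th ^+ k).
pose Cg := 2 * C3 + 2 * c2 ^+ 2 / a + 1 + c2.
pose om := x / 2 * ln th.
have lth0 : 0 < ln th by rewrite ln_gt0.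
have f2 : 0 < 3 / 4 :> R by lra.
have [T HT] := evR_ln_nat (evR_and (evR_and (evR_powR_lt (16 * B * th ^+ 2) om1)
   (evR_expR (4 * x * Cg / e) f2)) (evR_and (evR_expR (4 / e) ltr01) (evR_ge 1))).
exists T => t n0 /HT {HT} [[F1 F2] [F3 u1]] n0x.
set u := ln t%:R in F1 F2 F3 u1 n0x; have u0 : 0 < u by exact: lt_le_trans u1.
have t0 : (0 < t)%N.
  by rewrite lt0n; apply/eqP => tz; move: u0; rewrite /u tz ln0 // ltxx.
have T0 : 0 < t%:R :> R by rewrite ltr0n.
have tE : t%:R = expR u by rewrite lnK ?posrE.
pose K := uphalf n0.
(* K is about n0 / 2, and [om] < 1 bounds th ^ K by a constant times a power of ln t below the
   first. Hence the last [eta] is at most t^(1/16), and its fourth power t^(1/4). *)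
have etaK1 : B * th ^+ K.+1 <= u / 16.
  rewrite ler_pdivlMr //; apply: le_trans F1.
  have -> : B * th ^+ K.+1 * 16 = 16 * B * th ^+ K.+1 by ring.
  have -> : 16 * B * th ^+ 2 * u `^ om = 16 * B * (th ^+ 2 * u `^ om) by ring.
  rewrite ler_pM2l ?mulr_gt0 // powRE //.
  rewrite -[th]lnK ?posrE // -!expRM_natr -expRD ler_expR.
  have KE := uphalf_natr_le R n0.
  apply: (@le_trans _ _ (ln th * (n0%:R / 2 + 2))); first by rewrite ler_pM2l.
  rewrite /om mulrDr [ln th * 2 + _]addrC lerD2r.
  have := ler_wpM2l (ltW lth0) n0x; lra.
have eta_u k : (k <= K.+1)%N -> B * th ^+ k <= u / 16.
  move=> kK; apply: le_trans etaK1; rewrite ler_pM2l //.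
  by apply: ler_weXn2l => //; exact: ltW.
have eta1 k : 1 <= eta k.
  by rewrite /eta -expR0 ler_expR mulr_ge0 ?exprn_ge0 // ltW.
have eta_mono k : eta k <= eta k.+1.
  by rewrite ler_expR ler_pM2l //; apply: ler_weXn2l => //; exact: ltW.
have etaK k : (k <= K)%N -> eta k <= t%:R.
  move=> kK; rewrite tE ler_expR; apply: le_trans (eta_u k (leqW kK)) _; lra.
have pe k y : eta k `^ y = expR (y * (B * th ^+ k)).
  by rewrite powRE ?expR_gt0 // expRK.
have Bth k : B <= B * th ^+ k by rewrite ler_peMr ?(ltW B0) // exprn_ege1 // ltW.
have I1 k : (0 < k)%N -> 2 * kap * (1 + ln (eta k)) * eta k `^ A <= eta k.+1 `^ A.
  move=> _; have [h1 _] := lev _ (Bth k).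
  have e1 : B * th ^+ k.+1 = th * (B * th ^+ k) by rewrite exprS; ring.
  by rewrite !pe expRK e1.
have I2 k : (0 < k)%N -> kap * C3 * eta k `^ (A + a) +
    kap * c2 * eta k.+1 `^ A * (1 + ln (eta k)) <= c2 * eta k.+2 `^ A.
  move=> _; have [_ h2] := lev _ (Bth k).
  have e1 : B * th ^+ k.+1 = th * (B * th ^+ k) by rewrite exprS; ring.
  have e2 : B * th ^+ k.+2 = th ^+ 2 * (B * th ^+ k) by rewrite 2!exprS; ring.
  by rewrite !pe expRK e1 e2.
have Cg0 : 0 < Cg.
  have C30 : 0 < C3 by rewrite addr_gt0 // invr_gt0.
  have q0 : 0 <= c2 ^+ 2 / a by apply: divr_ge0; [exact: sqr_ge0|exact: ltW].
  rewrite /Cg -[2 * c2 ^+ 2 / a]mulrA; clear -C30 q0 c20.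
  by move: (c2 ^+ 2 / a) q0 => q q0; lra.
(* Bounding exp (-y) by 1 / y leaves a geometric series in 1 / th with a factor 1 / B, which makes
   it small. *)
have tail : 2 * (1 - beta)^-1 * (\sum_(1 <= k < K.+1) eta k `^ (A - (1 - beta))) <= e / 4.
  apply: (@le_trans _ _ (2 * (1 - beta)^-1 * ((sg * B)^-1 * (th - 1)^-1))).
    apply: ler_wpM2l; first by rewrite mulr_ge0 // invr_ge0 ltW.
    apply: (@le_trans _ _ ((sg * B)^-1 * \sum_(1 <= k < K.+1) (th ^+ k)^-1)).
      rewrite mulr_sumr; apply: ler_sum => k _; rewrite pe.
      have -> : (A - (1 - beta)) * (B * th ^+ k) = - (sg * B * th ^+ k) by rewrite /sg; ring.
      have p0 : 0 < sg * B * th ^+ k by rewrite !mulr_gt0 // exprn_gt0.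
      rewrite expRN -invfM lef_pV2 ?posrE ?expR_gt0 //.
      by apply: le_trans (expR_ge1Dx _); rewrite lerDr.
    apply: ler_wpM2l; first by rewrite invr_ge0 mulr_ge0 // ltW.
    exact: geometric_sum_le.
  have th10 : 0 < th - 1 by rewrite subr_gt0.
  move: B5; rewrite ler_pdivrMr ?mulr_gt0 // => B5.
  have -> : 2 * (1 - beta)^-1 * ((sg * B)^-1 * (th - 1)^-1) =
     2 / ((1 - beta) * (sg * B * (th - 1))) by field; rewrite !gt_eqF.
  rewrite ler_pdivrMr ?mulr_gt0 //; lra.
have final : n0%:R * (Cg / t%:R * eta K.+1 ^+ 4) <= e / 4.
  have n0u : n0%:R <= x * (1 + u).
    apply: le_trans n0x _; rewrite ler_pM2l //.
    by apply: le_trans (ltW (ln_sublinear u0)) _; rewrite lerDr.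
  have eK : eta K.+1 ^+ 4 <= expR (u / 4).
    by rewrite /eta -expRM_natl ler_expR; have := etaK1; lra.
  apply: (@le_trans _ _ (x * (1 + u) * (Cg / t%:R * expR (u / 4)))).
    apply: ler_pM => //.
      by rewrite mulr_ge0 ?exprn_ge0 ?expR_ge0 // divr_ge0 // ltW.
    by rewrite ler_pM2l // divr_gt0.
  have -> : x * (1 + u) * (Cg / t%:R * expR (u / 4)) =
     (4 * x * Cg / e * (1 + u)) * (expR (3 / 4 * u))^-1 * (e / 4).
    have -> : t%:R^-1 = (expR (3 / 4 * u))^-1 * (expR (u / 4))^-1.
      rewrite -invfM -expRD tE; congr (expR _)^-1; by field.
    by field; rewrite !gt_eqF ?expR_gt0.
  by rewrite ler_piMl ?ler_pdivrMr ?expR_gt0 ?mul1r // divr_ge0 // ltW.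
have invt : t%:R^-1 <= e / 4.
  have : 4 / e <= t%:R.
    by rewrite tE; apply: le_trans (_ : 4 / e * (1 + u) <= _); [rewrite ler_peMr ?lerDl ?divr_ge0 // ltW|move: F3; rewrite mul1r].
  by rewrite ler_pdivrMr // -ler_pdivrMl // ler_pdivlMr // mulrC => h; rewrite mulrC.
pose old v := (~~ (t%:R * z0 <= v.+1%:R))%:R : R.
have pt (v w : 'I_t) : pexp (t * m) (fun h => `[< joined m t v w n0 h >]%:R) [::] <=
    old v + old w + (v == w)%:R + e / 2.
  have e2 : 0 <= e / 2 by rewrite divr_ge0 // ltW.
  have p1 := pexp_bool_le1 (t * m) (fun h => joined m t v w n0 h) (@valid_nil m).
  rewrite /old; have [rv|ov] := boolP (t%:R * z0 <= v.+1%:R); last first.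
    by apply: le_trans p1 _; rewrite /= -!addrA lerDl !addr_ge0.
  have [rw|ow] := boolP (t%:R * z0 <= w.+1%:R); last first.
    by apply: le_trans p1 _; rewrite /= add0r -!addrA lerDl !addr_ge0.
  have [->|vw] := eqVneq v w.
    by apply: le_trans (pexp_bool_le1 _ _ (@valid_nil m)) _; rewrite /= !add0r lerDl.
  rewrite /= !add0r.
  have ab (y : 'I_t) : t%:R * z0 <= y.+1%:R -> above (fun k => t%:R / eta k) 0 y.
    apply: le_trans; rewrite ler_pM2l // /eta expr0 mulr1.
    by rewrite -[leRHS]invrK lef_pV2 ?posrE ?expR_gt0 ?invr_gt0.
  have st (y : 'I_t) : t%:R * z0 <= y.+1%:R -> start_le m rho t eta A c2 y.
    by move=> ry; apply: start_le_recent ry B2 B3 B4.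
  apply: le_trans (joined_prob_le m2 rho0 rho1 (erefl a) (erefl C3) (erefl c2) t0 eta1 eta_mono etaK
    (ltW A0) (ltW A1) I1 I2 (ltn_ord v) (ltn_ord w) vw (st v rv) (st w rw) (ab v rv) (ab w rw) (erefl K)) _.
  rewrite -/Cg; have := tail; have := final; lra.
have oldsum : \sum_(v < t) old v <= t%:R * z0.
  have tz : 0 < t%:R * z0 by rewrite mulr_gt0.
  have := @sum_powR_lt_le R 1 (t%:R * z0) t ltr01 (lexx 1) tz.
  rewrite subrr divr1 powRr1 ?(ltW tz) //.
  apply: le_trans; rewrite [leRHS]big_mkcond /=; apply: ler_sum => v _.
  by rewrite /old powRr0; case: (t%:R * z0 <= _).
apply: le_trans (double_sum_le t0 pt) _.
have h1 : 2 * (\sum_(v < t) old v) / t%:R <= e / 4.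
  by rewrite ler_pdivrMr //; move: oldsum; rewrite /z0; lra.
apply: (@le_trans _ _ (e / 4 + e / 4 + e / 2)); last by lra.
by apply: lerD => //; apply: lerD.
Qed.

End LowerBound.

(* [lia] on the hypotheses about [nat] only: zify would process the whole context. *)
Ltac nlia :=
  repeat match goal with
  | H : ?P |- _ => lazymatch type of P with
    | Prop => lazymatch P with
      | is_true (leq _ _) => fail
      | _ = _ :> nat => fail
      | _ => clear H
      end
    | _ => fail
    end
  end; lia.

Lemma sum_count_mem_lt (h : seq nat) a :
  (\sum_(u < a) count_mem (val u) h = count (fun x => x < a)%N h)%N.
Proof.
elim: h => [|x h IH] /=; first by rewrite big1.
rewrite big_split /= IH; congr addn.
have [xa|ax] := ltnP x a.
  rewrite (bigD1 (Ordinal xa)) //= eqxx big1 // => i.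
  by rewrite -val_eqE /= eq_sym => /negbTE ->.
by rewrite big1 // => i _; rewrite gtn_eqF // (leq_trans (ltn_ord i)).
Qed.

(** * Lower tail of the weight of the oldest vertices *)

Section Urn.
Variables (R : realType) (m : nat) (rho : R).
Hypotheses (m2 : (1 < m)%N) (rho0 : 0 < rho) (rho1 : rho < 1).

Local Notation totw := (totw rho).
Local Notation stp := (stp m rho).
Local Notation wt := (wt m rho).
Local Notation pexp := (pexp m rho).
Local Notation beta := (beta rho).

Definition oldw (a : nat) (h : seq nat) : R :=
  (a * m)%:R * rho + (count (fun x => x < a)%N h)%:R.

Lemma oldwE a h : oldw a h = \sum_(u < a) wt h u.
Proof.
rewrite big_split /= -natr_sum sum_count_mem_lt sumr_const card_ord.
by rewrite /oldw natrM -[m%:R * rho *+ a]mulr_natl mulrA.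
Qed.

Lemma oldw_rcons a h v : oldw a (rcons h v) = oldw a h + (v < a)%N%:R.
Proof. by rewrite /oldw -cats1 count_cat /= addn0 natrD addrA. Qed.

Lemma count_old_ge a h : valid m h -> (a * m <= size h)%N ->
  (a * m <= count (fun x => x < a)%N h)%N.
Proof.
move=> vh le; rewrite -(cat_take_drop (a * m) h) count_cat.
apply: leq_trans (leq_addr _ _).
have sz : size (take (a * m) h) = (a * m)%N by rewrite size_takel.
suff : all (fun x => x < a)%N (take (a * m) h) by rewrite all_count sz => /eqP ->.
apply/allP => x /(nthP 0%N)[i]; rewrite sz => ia <-; rewrite nth_take //.
apply: leq_ltn_trans (vh i (leq_trans ia le)) _.
by rewrite ltn_divLR //; nlia.
Qed.

Lemma stp_old h u a : (a * m <= size h)%N -> (u < a)%N -> stp h u = wt h u / totw (size h).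
Proof.
move=> le ua; apply: stp_eq => //; apply: leqW; apply: leq_trans le.
by rewrite mulnC leq_mul2r ua orbT.
Qed.

Lemma sum_stp_old a h : (a * m <= size h)%N -> (0 < a)%N ->
  \sum_(v < (size h %/ m).+1) stp h v * (v < a)%N%:R = oldw a h / totw (size h).
Proof.
move=> le a0; rewrite oldwE mulr_suml.
have ah : (a <= (size h %/ m).+1)%N by rewrite leqW // leq_divRL //; nlia.
rewrite (big_ord_widen _ (fun u => wt h u / totw (size h)) ah) big_mkcond /=.
rewrite [RHS]big_mkcond /=; apply: eq_bigr => v _.
by case: ltnP => va; rewrite ?mulr0 // mulr1 (stp_old le va).
Qed.

Lemma oldw_gt a h : valid m h -> (0 < a)%N -> (a * m <= size h)%N -> a.+1%:R < oldw a h.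
Proof.
move=> vh a0 le; have c := count_old_ge vh le; rewrite /oldw.
apply: lt_le_trans (_ : (a * m)%:R * rho + (a * m)%:R <= _); last by rewrite lerD2l ler_nat.
have : (a.+1 <= a * m)%N by nia.
rewrite -(ler_nat R) => h1; have : 0 < (a * m)%:R * rho by rewrite mulr_gt0 // ltr0n muln_gt0 a0; nlia.
lra.
Qed.

(** The old weight W becomes W + 1 with probability W / c, c being the total. The shift in 1 / (W -
    1) makes its expectation an exact multiple: (1 - W / c) / (W - 1) + 1 / c = (1 - 1 / c) / (W -
    1). *)
Lemma urn_step a h : valid m h -> (0 < a)%N -> (a * m <= size h)%N ->
  \sum_(v < (size h %/ m).+1) stp h v * (oldw a (rcons h v) - 1)^-1 =
  (oldw a h - 1)^-1 * (1 - (totw (size h))^-1).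
Proof.
move=> vh a0 le; have W1 := oldw_gt vh a0 le; set W := oldw a h in W1 *.
have W0 : 1 < W by apply: lt_trans W1; rewrite ltr1n.
have c0 := totw_gt0 rho0 (size h); set c := totw (size h) in c0 *.
have e v : stp h v * (oldw a (rcons h v) - 1)^-1 =
   (W - 1)^-1 * stp h v + (W^-1 - (W - 1)^-1) * (stp h v * (v < a)%N%:R).
  rewrite oldw_rcons -/W; case: (v < a)%N; last by rewrite !mulr0 !addr0 mulrC.
  by rewrite addrK !mulr1; ring.
under eq_bigr => v _ do rewrite e.
rewrite big_split /= -!mulr_sumr sum_stp // sum_stp_old // -/W -/c.
by field; repeat (apply/andP; split); rewrite ?gt_eqF //; lra.
Qed.

Lemma totw_inv_ge i : beta / i.+1%:R <= (totw i)^-1.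
Proof.
have b0 := beta_gt0 rho0; have b1 := beta_lt1 rho0.
rewrite totwE // invf_div ler_pM2l // lef_pV2 ?posrE ?ltr0n //.
  by rewrite -natr1; lra.
by have : 0 <= i%:R :> R by []; lra.
Qed.

Lemma totw_inv_le i : (0 < i)%N -> (totw i)^-1 <= beta / i%:R.
Proof.
move=> i0; have b0 := beta_gt0 rho0; have b1 := beta_lt1 rho0.
have I0 : 0 < i%:R :> R by rewrite ltr0n.
rewrite totwE // invf_div ler_pM2l // lef_pV2 ?posrE //; lra.
Qed.

Lemma totw_ge_nat i : i%:R <= totw i.
Proof. by rewrite /totw mulrDr mulr1 -addrA lerDl addr_ge0 ?mulr_ge0 // ltW. Qed.

Lemma prod_decay_le a b : (0 < a)%N -> (a <= b)%N ->
  \prod_(a <= i < b) (1 - (totw i)^-1) <= (a.+1%:R / b.+1%:R) `^ beta.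
Proof.
move=> a0; have b0 := beta_gt0 rho0; elim: b => [|b IH].
  by rewrite leqn0 => /eqP e; rewrite e in a0.
rewrite leq_eqVlt => /orP[/eqP <-|]; first by rewrite big_geq // divff ?powR1 // pnatr_eq0.
rewrite ltnS => ab; rewrite big_nat_recr //=.
have nn i : (a <= i)%N -> 0 <= 1 - (totw i)^-1.
  move=> ai; rewrite subr_ge0 invf_le1 ?totw_gt0 //; apply: le_trans (totw_ge_nat i).
  by rewrite ler1n (leq_trans a0).
apply: (@le_trans _ _ ((a.+1%:R / b.+1%:R) `^ beta * (b.+1%:R / b.+2%:R) `^ beta)).
  apply: ler_pM; [|exact: nn|exact: IH|].
    by rewrite big_nat; apply: prodr_ge0 => i /andP[ai _]; exact: nn.
  rewrite powRE ?divr_gt0 ?ltr0n //.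
  apply: le_trans (_ : expR (- (beta / b.+1%:R)) <= _).
    apply: le_trans (expR_ge1Dx _); rewrite lerD2l lerN2; exact: totw_inv_ge.
  rewrite ler_expR -mulrN ler_pM2l // -[b.+1%:R / b.+2%:R]invf_div lnV ?posrE ?divr_gt0 ?ltr0n //.
  rewrite lerN2; have := @ln_le_sub1 R (b.+2%:R / b.+1%:R); rewrite divr_gt0 ?ltr0n // => /(_ isT) le.
  apply: le_trans le _; rewrite -[b.+2%:R]natr1 le_eqVlt; apply/orP; left; apply/eqP.
  by rewrite mulrDl mul1r divff ?pnatr_eq0 // addrAC subrr add0r.
rewrite -powRM ?divr_ge0 //.
have -> // : a.+1%:R / b.+1%:R * (b.+1%:R / b.+2%:R) = a.+1%:R / b.+2%:R :> R.
by rewrite mulrA mulfVK // pnatr_eq0.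
Qed.

(* Markov's inequality for (oldw a h - 1)^-1: its conditional expectation is multiplicative. *)
Lemma urn_low_prob a T x : (0 < a)%N -> (a <= T)%N -> 0 <= x ->
  pexp (T * m) (fun h => `[< oldw a h <= x >]%:R) [::] <=
  2 * x * (a%:R^-1 * (a%:R / T%:R) `^ beta).
Proof.
move=> a0 aT x0; have b0 := beta_gt0 rho0; have b1 := beta_lt1 rho0.
have A0 : 0 < a%:R :> R by rewrite ltr0n.
have T0 : 0 < T%:R :> R by rewrite ltr0n (leq_trans a0).
have amT : (a * m <= T * m)%N by rewrite leq_mul2r aT orbT.
have am0 : (0 < a * m)%N by rewrite muln_gt0 a0; nlia.
have -> : (T * m = a * m + (T * m - a * m))%N by nlia.
rewrite pexpD -[leRHS](pexp_cst m2 rho0 (a * m) _ (@valid_nil m)).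
apply: pexp_le => // h [vh _]; rewrite add0n => sz.
pose F h' := (oldw a h' - 1)^-1 * \prod_(size h' <= i < T * m) (1 - (totw i)^-1).
have pr0 n : (0 < n)%N -> 0 <= \prod_(n <= i < T * m) (1 - (totw i)^-1).
  move=> n0; rewrite big_nat; apply: prodr_ge0 => i /andP[ni _].
  rewrite subr_ge0 invf_le1 ?totw_gt0 //; apply: le_trans (totw_ge_nat i).
  by rewrite ler1n (leq_trans n0).
apply: (@le_trans _ _ (pexp (T * m - a * m) (fun h' => x * F h') h)).
  apply: pexp_le => // h' ex sz'; have vh' : valid m h' by case: ex.
  have le' : (a * m <= size h')%N by rewrite sz' sz leq_addr.
  have W1 := oldw_gt vh' a0 le'.
  have W0 : 1 < oldw a h' by apply: lt_trans W1; rewrite ltr1n.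
  have -> : F h' = (oldw a h' - 1)^-1 by rewrite /F sz' sz subnKC // big_geq ?mulr1.
  case: asboolP => [le|_]; last by rewrite divr_ge0 //; lra.
  by rewrite ler_pdivlMr ?mul1r; lra.
rewrite pexpM -mulrA mulrCA; apply: ler_wpM2l => //.
apply: (@le_trans _ _ (F h)).
  apply: pexp_super => // h' ex sz'; have vh' : valid m h' by case: ex.
  have le' : (a * m <= size h')%N by rewrite -sz; exact: extends_size ex.
  have lt' : (size h' < T * m)%N by move: sz'; rewrite sz subnKC.
  rewrite /F; under [leLHS]eq_bigr => v _ do rewrite size_rcons mulrA.
  rewrite -mulr_suml urn_step // [in leRHS]big_ltn //.
  by rewrite mulrA.
have W1 : a.+1%:R < oldw a h by apply: oldw_gt => //; rewrite sz.
have l1 : (oldw a h - 1)^-1 <= a%:R^-1.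
  by rewrite lef_pV2 ?posrE //; move: W1; rewrite -natr1; have := A0; lra.
rewrite /F sz mulrCA; apply: ler_pM => //.
- by rewrite invr_ge0; move: W1; rewrite -natr1; have := A0; lra.
- by apply: pr0.
apply: le_trans (prod_decay_le am0 amT) _.
apply: (@le_trans _ _ ((2 * (a%:R / T%:R)) `^ beta)).
  apply: powR_mono; [exact: ltW|by rewrite divr_ge0|].
  rewrite mulrA ler_pdivrMr ?ltr0n // mulrAC ler_pdivlMr //.
  rewrite -!natrM ler_nat mulSn mulnS.
  have e : (2 * a * (T * m) = 2 * (a * m * T))%N by ring.
  by have := leq_pmull T am0; rewrite e; nlia.
rewrite powRM ?divr_ge0 //; apply: ler_wpM2r; first exact: powR_ge0.
by apply: ler1_powR (ltW b1); rewrite ler1n.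
Qed.

End Urn.

(** * Climbing through the levels with fresh connectors *)

Section Climbing.
Variables (R : realType) (m : nat) (rho : R) (T t L : nat) (h0 : seq nat).
Hypotheses (m2 : (1 < m)%N) (rho0 : 0 < rho) (rho1 : rho < 1).
Hypotheses (sz0 : size h0 = (T * m)%N) (Tt : (T <= t)%N).

Local Notation totw := (totw rho).
Local Notation stp := (stp m rho).
Local Notation wt := (wt m rho).
Local Notation pexp := (pexp m rho).

(** [S k] is level k, [X k] a lower bound on the weight of each of its vertices and [Q k] on the
    total weight of the next level, all at time T. Weights only grow and [totw] is largest at time
    t, so by [qE] a new vertex sends its first edge to a given vertex of level k and its second to
    level k + 1 with probability at least [q k]. *)
Variables (S : nat -> pred nat) (X Q q : nat -> R).
Hypotheses (ST : forall k u, S k u -> (u < T)%N)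
  (SX : forall k u, (k < L)%N -> S k u -> X k <= wt h0 u)
  (SQ : forall k, (k < L)%N -> Q k <= \sum_(u < T | S k.+1 u) wt h0 u)
  (X0 : forall k, (k < L)%N -> 0 <= X k) (Q0 : forall k, (k < L)%N -> 0 <= Q k)
  (q0 : forall k, (k < L)%N -> 0 < q k) (q1 : forall k, (k < L)%N -> q k <= 1)
  (qE : forall k, (k < L)%N -> q k <= X k / totw (t * m) * (Q k / totw (t * m))).

Definition stuck (k u : nat) (h : seq nat) : Prop :=
  ~ exists2 w, S L w & reach t m h u w (2 * (L - k)).

Definition wait (k : nat) : R := \sum_(k <= i < L) (q i)^-1.

Lemma wait_ge0 k : 0 <= wait k.
Proof.
by rewrite /wait big_nat; apply: sumr_ge0 => i /andP[_ iL]; rewrite invr_ge0 ltW // q0.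
Qed.

Lemma waitS k : (k < L)%N -> wait k = (q k)^-1 + wait k.+1.
Proof. by move=> kL; rewrite /wait big_ltn. Qed.

Lemma totw_mono i j : (i <= j)%N -> totw i <= totw j.
Proof.
by move=> ij; rewrite lerD2r ler_wpM2r ?ler_nat // addr_ge0 // ltW.
Qed.

Lemma stp_lower h u : extends m h0 h -> (size h <= t * m)%N -> (u < T)%N ->
  wt h0 u / totw (t * m) <= stp h u.
Proof.
move=> ex sh uT; rewrite (@stp_old _ _ _ m2 rho0 rho1 _ _ T) //; last by rewrite -sz0; exact: extends_size ex.
apply: ler_pM; rewrite ?invr_ge0 ?(ltW (wt_gt0 _ _ _ _)) ?(ltW (totw_gt0 _ _)) //.
  exact: wt_extends ex.
by rewrite lef_pV2 ?posrE ?totw_gt0 //; exact: totw_mono.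
Qed.

Lemma stuck_connected k u v h h' s : (k < L)%N -> size h = (s * m)%N -> (T <= s)%N -> (s < t)%N ->
  (u < T)%N -> (v < T)%N -> extends m (rcons (rcons h u) v) h' ->
  stuck k u h' -> stuck k.+1 v h'.
Proof.
move=> kL sz Ts st uT vT ex nk [w Sw rw]; apply: nk; exists w => //.
have e0 : nth 0%N h' (m * s + 0) = u.
  rewrite (extends_nth ex) ?size_rcons ?sz; last by rewrite mulnC addn0; nlia.
  by rewrite !nth_rcons size_rcons sz mulnC addn0 ltnS leqnn ltnn eqxx.
have e1 : nth 0%N h' (m * s + 1) = v.
  rewrite (extends_nth ex) ?size_rcons ?sz; last by rewrite mulnC addn1; nlia.
  by rewrite nth_rcons size_rcons sz mulnC addn1 ltnn eqxx.
have -> : (2 * (L - k) = (1 + 1) + 2 * (L - k.+1))%N by nlia.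
have uT' : (u < t)%N by exact: leq_trans Tt.
have vT' : (v < t)%N by exact: leq_trans Tt.
apply: reach_trans rw; apply: (@reach_trans _ _ _ _ s); apply: reach_adj => //.
  by apply/hadjP; exists 0%N; [nlia|right].
by apply/hadjP; exists 1%N => //; left.
Qed.

(* Each new vertex joins u to the next level with probability at least q k, through its first
   two edges; wait k bounds the expected number of vertices needed to climb from level k. *)
Lemma climb r s k u h : extends m h0 h -> size h = (s * m)%N -> (s + r)%N = t ->
  (T <= s)%N -> (k <= L)%N -> S k u ->
  r%:R * pexp (r * m) (fun h' => `[< stuck k u h' >]%:R) h <= wait k.
Proof.
elim: r s k u h => [|r IH] s k u h ex sz srt Ts kL Su.
  by rewrite mul0r wait_ge0.
have vh : valid m h by case: ex.
have [kL'|kLe] := ltnP k L; last first.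
  have kE : k = L by nlia.
  rewrite (@pexp_const _ _ _ m2 rho0 _ _ 0) ?mulr0 ?wait_ge0 // => h' _ _.
  case: asboolP => // nk; exfalso; apply: nk; exists u; rewrite -?kE // subnn muln0.
  by apply: reach_refl; apply: leq_trans Tt; exact: ST Su.
have P1 : pexp (r.+1 * m) (fun h' => `[< stuck k u h' >]%:R) h <= 1.
  exact: pexp_bool_le1.
(* With at most [wait k] vertices left the claim is trivial; the opposite inequality closes the
   final estimate. *)
have [f1|f1] := lerP r.+1%:R (wait k).
  by apply: le_trans f1; rewrite ler_piMr.
have qk0 := q0 kL'; have qk1 := q1 kL'.
have wk := waitS kL'; have wk1 := wait_ge0 k.+1.
have wge1 : 1 <= wait k by rewrite wk -[leLHS]addr0 lerD // invf_ge1.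
have r0 : (0 < r)%N.
  by case: (r) f1 => // /(le_lt_trans wge1); rewrite ltxx.
have R0 : 0 < r%:R :> R by rewrite ltr0n.
set bk := wait k / r%:R; set bk' := wait k.+1 / r%:R.
have uT := ST Su.
have st : (s < t)%N by nlia.
pose D := bk - bk'.
have D0 : 0 <= D by rewrite /D /bk /bk' -mulrBl wk addrK divr_ge0 ?invr_ge0 // ltW.
(* Whatever the first two edges do, the induction hypothesis with one vertex less gives [bk]; the
   other m - 2 edges are averaged out. *)
have low : forall h2, extends m h h2 -> size h2 = (s * m + 2)%N ->
    pexp (m - 2 + r * m) (fun h' => `[< stuck k u h' >]%:R) h2 <= bk.
  move=> h2 ex2 sz2; rewrite pexpD.
  have vh2 : valid m h2 by case: ex2.
  rewrite -[leRHS](pexp_cst m2 rho0 (m - 2) _ vh2); apply: pexp_le => // h3 ex3 sz3.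
  rewrite /bk ler_pdivlMr // mulrC; apply: (IH s.+1) => //.
  - exact: extends_trans ex (extends_trans ex2 ex3).
  - by rewrite sz3 sz2 mulSn; nlia.
  - by nlia.
  exact: leqW.
have low' : forall v, S k.+1 v -> extends m h (rcons (rcons h u) v) ->
    pexp (m - 2 + r * m) (fun h' => `[< stuck k u h' >]%:R) (rcons (rcons h u) v) <= bk'.
  move=> v Sv ex2; rewrite pexpD.
  have vh2 : valid m (rcons (rcons h u) v) by case: ex2.
  rewrite -[leRHS](pexp_cst m2 rho0 (m - 2) _ vh2); apply: pexp_le => // h3 ex3 sz3.
  have sz2 : size (rcons (rcons h u) v) = (s * m + 2)%N by rewrite !size_rcons sz; nlia.
  have vh3 : valid m h3 by case: ex3.
  apply: (@le_trans _ _ (pexp (r * m) (fun h' => `[< stuck k.+1 v h' >]%:R) h3)).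
    apply: pexp_le => // h' ex' _; case: asboolP => // sk.
    have := stuck_connected kL' sz Ts st uT (ST Sv) (extends_trans ex3 ex') sk.
    by move/asboolP => ->.
  rewrite /bk' ler_pdivlMr // mulrC; apply: (IH s.+1) => //.
  - exact: extends_trans ex (extends_trans ex2 ex3).
  - by rewrite sz3 sz2 mulSn; nlia.
  - by nlia.
  exact: leqW.
have key : pexp (r.+1 * m) (fun h' => `[< stuck k u h' >]%:R) h <= bk - q k * D.
  have -> : (r.+1 * m = 1 + (1 + (m - 2 + r * m)))%N by rewrite mulSn; nlia.
  rewrite pexpD /=.
  pose ps v := \sum_(w < ((size h).+1 %/ m).+1) stp (rcons h v) w *
     (bk - ((v == u) && S k.+1 w)%:R * D).
  apply: (@le_trans _ _ (\sum_(v < (size h %/ m).+1) stp h v * ps v)).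
    apply: ler_sum => v _; apply: ler_wpM2l; first exact: stp_ge0.
    have exv : extends m h (rcons h v) by apply: extends_rcons => //; rewrite -ltnS.
    have vhv : valid m (rcons h v) by case: exv.
    rewrite /ps size_rcons; apply: ler_sum => w _; apply: ler_wpM2l; first exact: stp_ge0.
    have exw : extends m h (rcons (rcons h v) w).
      apply: extends_trans exv _; apply: extends_rcons => //.
      by rewrite size_rcons -ltnS.
    have [/andP[/eqP vu Sw]|_] := boolP ((val v == u) && S k.+1 w).
      rewrite mul1r /D opprB addrC subrK; rewrite vu in exw *; exact: low'.
    by rewrite mul0r subr0; apply: low => //; rewrite !size_rcons sz; nlia.
  have us : (u < (size h %/ m).+1)%N by rewrite sz mulnK ?ltnS; nlia.
  have psE v : (v <= size h %/ m)%N -> ps v = bk - (v == u)%:R * (D * \sum_(w < ((size h).+1 %/ m).+1) stp (rcons h v) w * (S k.+1 w)%:R).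
    move=> vs; rewrite /ps; under eq_bigr => w _ do rewrite mulrBr.
    rewrite big_split /= -mulr_suml.
    have vhv : valid m (rcons h v) by apply: valid_rcons.
    have := sum_stp m2 rho0 vhv; rewrite size_rcons => ->; rewrite mul1r sumrN; congr (_ - _).
    rewrite mulrA mulr_sumr; apply: eq_bigr => w _.
    by rewrite -mulnb natrM; ring.
  rewrite (eq_bigr (fun v : 'I_ _ => bk * stp h v - stp h v * ((v == u :> nat)%:R *
     (D * \sum_(w < ((size h).+1 %/ m).+1) stp (rcons h v) w * (S k.+1 w)%:R)))); last first.
    move=> v _; rewrite psE; last by rewrite -ltnS.
    by rewrite mulrBr [bk * _]mulrC.
  rewrite big_split /= -mulr_sumr sum_stp // mulr1 lerD2l sumrN lerN2.
  rewrite (bigD1 (Ordinal us)) //= eqxx mul1r [X in _ + X]big1 ?addr0; last first.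
    by move=> v; rewrite -val_eqE /= => /negbTE ->; rewrite mul0r mulr0.
  rewrite mulrCA mulrC ler_wpM2l //; apply: le_trans (qE kL') _.
  have exu : extends m h0 (rcons h u).
    apply: extends_trans ex _; apply: extends_rcons => //; by rewrite -ltnS.
  have szl : ((size h).+1 <= t * m)%N by rewrite sz ltn_mul2r st andbT; nlia.
  apply: ler_pM; rewrite ?divr_ge0 ?X0 ?Q0 ?(ltW (totw_gt0 _ _)) //.
    apply: le_trans (stp_lower ex (ltnW szl) uT).
    by rewrite ler_pM2r ?invr_gt0 ?totw_gt0 //; exact: SX.
  have TS : (T <= ((size h).+1 %/ m).+1)%N.
    apply: leqW; rewrite leq_divRL ?sz; last by nlia.
    by apply: leqW; rewrite leq_mul2r Ts orbT.
  rewrite ler_pdivrMr ?totw_gt0 //; apply: le_trans (SQ kL') _.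
  rewrite -ler_pdivrMr ?totw_gt0 // mulr_suml.
  rewrite (big_ord_widen_cond _ (fun w => S k.+1 w) (fun w => wt h0 w / totw (t * m)) TS).
  rewrite big_mkcond; apply: ler_sum => w _; case: ifP => [/andP[Sw wT]|_].
    by rewrite Sw mulr1; apply: stp_lower => //; rewrite size_rcons.
  by rewrite mulr_ge0 // stp_ge0.
apply: le_trans (ler_wpM2l (ler0n _ _) key) _.
(* As D = 1 / (r q k), one vertex lowers the waiting time by one unit; (r + 1) (wait k - 1) / r is
   at most wait k exactly when wait k is at most r + 1. *)
have -> : bk - q k * D = (wait k - 1) / r%:R.
  by rewrite /D /bk /bk' wk; field; rewrite !gt_eqF.
rewrite mulrA ler_pdivrMr // -natr1.
by move: f1; rewrite -natr1; move: (wait k) (r%:R) => z1 z2; nra.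
Qed.

End Climbing.

(** * Ancestral lines along first edges *)

Section Ancestors.
Variables (m a : nat).
Hypothesis m2 : (1 < m)%N.

Definition parent (h : seq nat) (u : nat) : nat := nth 0%N h (m * u).

(** A vertex not below a whose first edge is a loop stays forever, so loops are charged to this
    event. *)
Fixpoint stays (h : seq nat) (i u : nat) : bool :=
  if i is i'.+1 then (a <= u)%N && stays h i' (parent h u) else true.

Fixpoint exits (h : seq nat) (v i u : nat) : bool :=
  if (u < a)%N then u == v
  else if i is i'.+1 then exits h v i' (parent h u) else false.

Lemma parent_le h u : valid m h -> (m * u < size h)%N -> (parent h u <= u)%N.
Proof. by move=> vh lt; apply: leq_trans (vh _ lt) _; rewrite mulKn //; nlia. Qed.

Lemma parent_known h u : valid m h -> (m * u < size h)%N -> (m * parent h u < size h)%N.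
Proof.
move=> vh lt; apply: leq_ltn_trans (lt); rewrite leq_mul2l.
by apply/orP; right; exact: parent_le.
Qed.

Lemma parent_rcons h w u : (m * u < size h)%N -> parent (rcons h w) u = parent h u.
Proof. by move=> lt; rewrite /parent nth_rcons lt. Qed.

Lemma stays_rcons h w i u : valid m h -> (m * u < size h)%N ->
  stays (rcons h w) i u = stays h i u.
Proof.
move=> vh; elim: i u => [|i IH] u lt //=.
by rewrite parent_rcons // IH // parent_known.
Qed.

Lemma exits_rcons h w v i u : valid m h -> (m * u < size h)%N ->
  exits (rcons h w) v i u = exits h v i u.
Proof.
move=> vh; elim: i u => [|i IH] u lt //=.
by rewrite parent_rcons // IH // parent_known.
Qed.

Lemma exitsS h v i u : exits h v i u -> exits h v i.+1 u.
Proof.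
elim: i u => [|i IH] u /=; first by case: ltnP.
by case: ltnP => // _; exact: IH.
Qed.

Lemma exits_self h v i u : (a <= u)%N -> parent h u = u -> exits h v i u = false.
Proof. by move=> au pu; elim: i => [|i IH] /=; rewrite ltnNge au //= pu. Qed.

Lemma not_stays_exits T h i u : valid m h -> size h = (T * m)%N -> (u < T)%N ->
  ~~ stays h i u -> exists2 v, (v < a)%N & exits h v i u /\ reach T m h u v i.
Proof.
move=> vh sz; elim: i u => [|i IH] u uT //=.
rewrite negb_and -ltnNge; have [ua _|au /= ns] := ltnP u a.
  by exists u => //; split=> //; apply: reachW (reach_refl _ _ uT).
have known : (m * u < size h)%N by rewrite sz mulnC ltn_mul2r uT andbT; nlia.
have pT : (parent h u < T)%N by apply: leq_ltn_trans uT; exact: parent_le.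
have [v va [ev rv]] := IH _ pT ns; exists v => //; split=> //.
rewrite -add1n; apply: reach_trans rv; apply: reach_adj => //.
by apply/hadjP; exists 0%N; [nlia|left; rewrite addn0].
Qed.

Lemma count_mem_new h u : valid m h -> (size h <= m * u)%N -> count_mem u h = 0%N.
Proof.
move=> vh le; apply/count_memPn/negP => /(nthP 0%N)[i ilt e].
have := vh i ilt; rewrite e leq_divRL; last nlia.
by rewrite mulnC => /leq_ltn_trans/(_ ilt); rewrite ltnNge le.
Qed.

End Ancestors.

(** * Most ancestral lines soon reach an old vertex with many hits *)

Section FamilyWeights.
Variables (R : realType) (m a T : nat) (rho : R).
Hypotheses (m2 : (1 < m)%N) (rho0 : 0 < rho) (rho1 : rho < 1).
Hypotheses (a0 : (0 < a)%N) (aT : (a <= T)%N).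

Local Notation totw := (totw rho).
Local Notation stp := (stp m rho).
Local Notation wt := (wt m rho).
Local Notation pexp := (pexp m rho).
Local Notation beta := (beta rho).

(** Weight of a family with membership g; a vertex joins once its first edge, which determines its
    parent, is placed. *)
Definition famw (g : seq nat -> nat -> R) (h : seq nat) : R :=
  \sum_(u < T) (m * u < size h)%N%:R * (wt h u * g h u).

Section Step.
Variable g : seq nat -> nat -> R.
Hypothesis g_rcons : forall h w u, valid m h -> (m * u < size h)%N ->
  g (rcons h w) u = g h u.

Lemma famw_rcons h w : valid m h -> (size h < T * m)%N -> (w <= size h %/ m)%N ->
  famw g (rcons h w) = famw g h + (m * w < size h)%N%:R * g h w +
   (m %| size h)%N%:R * ((m%:R * rho + (w == size h %/ m)%N%:R) * g (rcons h w) (size h %/ m)).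
Proof.
move=> vh nT ws; set n := size h; set s := (n %/ m)%N.
have sT : (s < T)%N by rewrite /s ltn_divLR //; nlia.
have wT : (w < T)%N by exact: leq_ltn_trans sT.
have e (u : 'I_T) : (m * u < size (rcons h w))%N%:R * (wt (rcons h w) u * g (rcons h w) u) =
   (m * u < n)%N%:R * (wt h u * g h u) + (m * u < n)%N%:R * ((w == u)%:R * g h u) +
   (m * u == n)%N%:R * ((m%:R * rho + (w == u)%:R) * g (rcons h w) u).
  rewrite size_rcons ltnS wt_rcons -/n; case: ltngtP => [lt|gt|eq] /=.
  - by rewrite g_rcons //; ring.
  - by ring.
  rewrite /wt (count_mem_new m2 vh) ?eq // addr0; ring.
rewrite {1}/famw; under eq_bigr => u _ do rewrite e.
rewrite !big_split /=; congr (_ + _ + _).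
  rewrite (bigD1 (Ordinal wT)) //= eqxx mul1r big1 ?addr0 // => u.
  by rewrite -val_eqE /= eq_sym => /negbTE ->; rewrite mul0r mulr0.
rewrite (bigD1 (Ordinal sT)) //= big1 ?addr0; last first.
  move=> u; rewrite -val_eqE /= => us; case: eqP => [e'|_]; last by rewrite mul0r.
  by case/eqP: us; rewrite /s -e' mulKn //; nlia.
by rewrite mulnC -dvdn_eq.
Qed.

Hypothesis g_ge0 : forall h u, 0 <= g h u.

Lemma sum_famw_le h : valid m h -> (size h < T * m)%N ->
  \sum_(w < (size h %/ m).+1) stp h w * ((m * w < size h)%N%:R * g h w) <=
  famw g h / totw (size h).
Proof.
move=> vh nT; set n := size h.
have sT : ((n %/ m).+1 <= T)%N by rewrite ltn_divLR //; nlia.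
have c0 := totw_gt0 rho0 n.
rewrite /famw mulr_suml.
rewrite (big_ord_widen _ (fun w => stp h w * ((m * w < n)%N%:R * g h w)) sT) big_mkcond.
apply: ler_sum => w _; case: ifP => _; last first.
  by rewrite divr_ge0 ?mulr_ge0 ?(ltW (wt_gt0 _ _ _ _)) ?(ltW c0).
rewrite mulrCA -[leRHS]mulrA; apply: ler_wpM2l => //.
by rewrite [leRHS]mulrAC; apply: ler_wpM2r => //; exact: stp_le.
Qed.

Lemma famw_initial h : valid m h -> size h = (a * m)%N ->
  famw g h = \sum_(u < a) wt h u * g h u.
Proof.
move=> vh sz; rewrite /famw (big_ord_widen _ (fun u => wt h u * g h u) aT) [RHS]big_mkcond.
apply: eq_bigr => u _; rewrite sz mulnC ltn_mul2r.
by have -> : (0 < m)%N by [nlia]; rewrite /=; case: ltnP; rewrite ?mul1r ?mul0r.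
Qed.

End Step.

Lemma oldw_initial h : valid m h -> size h = (a * m)%N -> oldw m rho a h <= 2 * (a * m)%:R.
Proof.
move=> vh sz; rewrite /oldw.
have : (count (fun x => x < a)%N h <= a * m)%N by rewrite -sz count_size.
rewrite -(ler_nat R) => c; have r1 := rho1.
have : (a * m)%:R * rho <= (a * m)%:R by rewrite ler_piMr // ltW.
lra.
Qed.

Lemma prod_growth_nat_le k x y : (0 < x)%N -> (x <= y)%N ->
  \prod_(x <= i < y) (1 + k%:R / totw i) <= (y%:R / x%:R) ^+ k.
Proof.
move=> x0; elim: y => [|y IH].
  by rewrite leqn0 => /eqP e; rewrite e in x0.
rewrite leq_eqVlt => /orP[/eqP <-|]; first by rewrite big_geq // divff ?expr1n // pnatr_eq0 -lt0n.
rewrite ltnS => xy; rewrite big_nat_recr //=.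
have y0 : (0 < y)%N by exact: leq_trans xy.
have Y0 : 0 < y%:R :> R by rewrite ltr0n.
have nn i : 0 <= 1 + k%:R / totw i by rewrite addr_ge0 // divr_ge0 // ltW // totw_gt0.
apply: (@le_trans _ _ ((y%:R / x%:R) ^+ k * (y.+1%:R / y%:R) ^+ k)).
  apply: ler_pM => //; [by apply: prodr_ge0|exact: IH|].
  apply: (@le_trans _ _ (1 + k%:R * y%:R^-1)).
    rewrite lerD2l ler_wpM2l // lef_pV2 ?posrE ?totw_gt0 //; exact: totw_ge_nat.
  have -> : y.+1%:R / y%:R = 1 + y%:R^-1 :> R by rewrite -natr1 mulrDl divff ?mul1r // gt_eqF.
  have z0 : 0 <= y%:R^-1 :> R by rewrite invr_ge0.
  elim: (k) => [|j IHj]; first by rewrite expr0 mul0r addr0.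
  rewrite exprS -natr1; move: z0 IHj; move: (y%:R^-1) ((1 + _) ^+ j) (j%:R) (ler0n R j) => z E J J0 z0 IHj.
  have := ler_wpM2l (addr_ge0 ler01 z0) IHj.
  have : 0 <= J * z * z by rewrite !mulr_ge0.
  nra.
rewrite -exprMn; have -> // : y%:R / x%:R * (y.+1%:R / y%:R) = y.+1%:R / x%:R :> R.
by rewrite mulrC mulrA mulfVK // gt_eqF.
Qed.

Variable hh : nat.

(* The factor 2 ^+ i is what makes the i-th generation rare: the expected total grows only
   polynomially in T / a. *)
Definition genw (h : seq nat) (u : nat) : R :=
  \sum_(i < hh.+1) 2 ^+ i * (stays m a h i u)%:R.

Lemma genw_rcons h w u : valid m h -> (m * u < size h)%N -> genw (rcons h w) u = genw h u.
Proof. by move=> vh lt; apply: eq_bigr => i _; rewrite stays_rcons. Qed.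

Lemma genw_ge0 h u : 0 <= genw h u.
Proof. by apply: sumr_ge0 => i _; rewrite mulr_ge0 // exprn_ge0. Qed.

Lemma genw_ge1 h u : 1 <= genw h u.
Proof.
rewrite /genw big_ord_recl /= expr0 mul1r lerDl.
by apply: sumr_ge0 => i _; rewrite mulr_ge0 // exprn_ge0.
Qed.

Lemma genw_le h u : genw h u <= 2 ^+ hh.+1.
Proof.
apply: (@le_trans _ _ (\sum_(i < hh.+1) 2 ^+ i)).
  by apply: ler_sum => i _; rewrite ler_piMr ?exprn_ge0 //; case: (stays _ _ _ _ _).
elim: (hh.+1) => [|k IH]; first by rewrite big_ord0 exprn_ge0.
by rewrite big_ord_recr /= exprS; lra.
Qed.

(** A child shifts every generation by one, doubling its term, and adds the term 1 of generation 0,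
    which is at most [genw] of the parent. *)
Lemma genw_child h w s : valid m h -> size h = (m * s)%N -> (w < s)%N ->
  genw (rcons h w) s <= 3 * genw h w.
Proof.
move=> vh sz ws; have g1 := genw_ge1 h w.
have wn : (m * w < size h)%N by rewrite sz ltn_mul2l ws andbT; nlia.
suff : genw (rcons h w) s <= 1 + 2 * genw h w by lra.
rewrite {1}/genw big_ord_recl /= expr0 mul1r lerD2l mulr_sumr [leRHS]big_ord_recr /=.
rewrite -[leLHS]addr0; apply: lerD; last by rewrite !mulr_ge0 // exprn_ge0.
apply: ler_sum => i _; rewrite /bump add1n exprS -mulrA ler_pM2l // ler_pM2l ?exprn_gt0 //.
rewrite ler_nat /parent nth_rcons sz ltnn eqxx stays_rcons //.
by case: (a <= s)%N; case: (stays _ _ _ _ _).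
Qed.

(** A crude integer growth rate: 1 for hits, 3 m for children, m (m + 1) for self-loops. *)
Definition growthexp : nat := (3 * m + 1 + m * m.+1)%N.

(** The added constant bounds [genw]: a new vertex looping on itself has no older parent to be
    compared with and is charged to this constant. *)
Lemma genw_step h : valid m h -> (size h < T * m)%N ->
  \sum_(v < (size h %/ m).+1) stp h v * (famw genw (rcons h v) + 2 ^+ hh.+1) <=
  (famw genw h + 2 ^+ hh.+1) * (1 + growthexp%:R / totw (size h)).
Proof.
move=> vh nT; set n := size h; set s := (n %/ m)%N; set Y := famw genw h.
set G := 2 ^+ hh.+1; have G0 : 0 < G by exact: exprn_gt0.
set c := totw n; have c0 : 0 < c := totw_gt0 rho0 n.
have Y0 : 0 <= Y.
  by apply: sumr_ge0 => u _; rewrite !mulr_ge0 ?genw_ge0 // ltW // wt_gt0.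
have S1 := sum_famw_le genw_ge0 vh nT; rewrite -/n -/s -/Y -/c in S1.
have pt (v : 'I_s.+1) : stp h v * (famw genw (rcons h v) + G) <=
   (Y + G) * stp h v + (1 + 3 * m%:R) * (stp h v * ((m * v < n)%N%:R * genw h v)) +
   (v == s :> nat)%:R * (m%:R / c * (m.+1%:R * G)).
  rewrite famw_rcons //; [|exact: genw_rcons|by rewrite -ltnS].
  rewrite -/n -/s -/Y.
  have -> : Y + (m * v < n)%N%:R * genw h v + (m %| n)%N%:R * ((m%:R * rho + (val v == s)%:R) * genw (rcons h v) s) + G
     = (Y + G) + (m * v < n)%N%:R * genw h v + (m %| n)%N%:R * ((m%:R * rho + (val v == s)%:R) * genw (rcons h v) s) by ring.
  rewrite 2!mulrDr [stp h v * (Y + G)]mulrC -!addrA lerD2l.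
  have A0 : 0 <= stp h v * ((m * v < n)%N%:R * genw h v).
    by rewrite mulr_ge0 ?stp_ge0 // mulr_ge0 ?genw_ge0.
  rewrite [(1 + _) * _]mulrDl mul1r -!addrA lerD2l.
  have E0 : 0 <= (v == s :> nat)%:R * (m%:R / c * (m.+1%:R * G)).
    by rewrite !mulr_ge0 ?invr_ge0 // ltW.
  have [mn|_] := boolP (m %| n)%N; last first.
    by rewrite mul0r mulr0 addr_ge0 // mulr_ge0 // mulr_ge0.
  rewrite mul1r; have nE : n = (m * s)%N by rewrite mulnC /s divnK.
  have [vs|vs] := eqVneq (val v) s.
    rewrite [X in _ <= _ + X]mul1r -[leLHS]add0r; apply: lerD; first by rewrite mulr_ge0.
    apply: ler_pM; rewrite ?stp_ge0 ?mulr_ge0 ?genw_ge0 ?addr_ge0 ?mulr_ge0 ?(ltW rho0) //.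
      apply: le_trans (stp_le _ _ _ _) _ => //; rewrite /wt (count_mem_new m2 vh) ?addr0; last by rewrite vs -nE.
      by rewrite ler_pM2r ?invr_gt0 // ler_piMr // ltW.
    apply: ler_pM; rewrite ?genw_ge0 ?addr_ge0 ?mulr_ge0 ?(ltW rho0) //; last exact: genw_le.
    by rewrite -natr1 lerD2r ler_piMr // ltW.
  rewrite mul0r addr0 addr0.
  have vlt : (v < s)%N by rewrite ltn_neqAle vs -ltnS ltn_ord.
  have -> : (m * v < n)%N by rewrite nE ltn_mul2l vlt andbT; nlia.
  rewrite mul1r [leRHS]mulrCA; apply: ler_wpM2l; first exact: stp_ge0.
  apply: (@le_trans _ _ (m%:R * (3 * genw h v))); last by rewrite mulrCA mulrA.
  apply: ler_pM; rewrite ?genw_ge0 ?mulr_ge0 ?(ltW rho0) //; last exact: genw_child.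
  by rewrite ler_piMr // ltW.
apply: le_trans (ler_sum _ (fun v _ => pt v)) _.
rewrite !big_split /= -!mulr_sumr sum_stp // mulr1 -mulr_suml.
have -> : \sum_(v < s.+1) (v == s :> nat)%:R = 1 :> R.
  rewrite big_ord_recr /= eqxx big1 ?add0r // => v _.
  by rewrite ltn_eqF.
rewrite mul1r mulrDr mulr1 -addrA lerD2l.
apply: (@le_trans _ _ ((1 + 3 * m%:R) * (Y / c) + m%:R / c * (m.+1%:R * G))).
  by rewrite lerD2r ler_wpM2l.
have -> : (Y + G) * (growthexp%:R / c) = (1 + 3 * m%:R) * (Y / c) + m%:R / c * (m.+1%:R * G) +
   ((m * m.+1)%:R * Y + (3 * m + 1)%:R * G) / c.
  by rewrite /growthexp !natrD !natrM; ring.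
rewrite lerDl; apply: divr_ge0; last exact: ltW.
by apply: addr_ge0; apply: mulr_ge0 => //; exact: ltW.
Qed.

(** At time a only generation 0 is present, while at time T each counted vertex contributes at least
    m rho 2 ^ hh. For bounded T / a the count is a small fraction of T once hh, and then T, are
    large. *)
Lemma stays_count_le :
  \sum_(u < T) pexp (T * m) (fun h => (stays m a h hh u)%:R) [::] <=
  (2 * (a * m)%:R + 2 ^+ hh.+1) * (T%:R / a%:R) ^+ growthexp / (m%:R * rho * 2 ^+ hh).
Proof.
have m0 : 0 < m%:R :> R by rewrite ltr0n; nlia.
have p0 : 0 < m%:R * rho * 2 ^+ hh by rewrite !mulr_gt0 // exprn_gt0.
have am0 : (0 < a * m)%N by rewrite muln_gt0 a0; nlia.
have amT : (a * m <= T * m)%N by rewrite leq_mul2r aT orbT.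
rewrite ler_pdivlMr // mulrC -pexp_sum -pexpM.
have TE : (T * m = a * m + (T * m - a * m))%N by rewrite subnKC.
rewrite [in leLHS]TE pexpD -[leRHS](pexp_cst m2 rho0 (a * m) _ (@valid_nil m)).
apply: pexp_le => // h [vh _]; rewrite add0n => sz.
pose F h' := (famw genw h' + 2 ^+ hh.+1) * \prod_(size h' <= i < T * m) (1 + growthexp%:R / totw i).
have nn i : 0 <= 1 + growthexp%:R / totw i by rewrite addr_ge0 // divr_ge0 // ltW // totw_gt0.
apply: (@le_trans _ _ (pexp (T * m - a * m) F h)).
  apply: pexp_le => // h' ex sz'; have vh' : valid m h' by case: ex.
  have sT : size h' = (T * m)%N by rewrite sz' sz -TE.
  rewrite /F sT big_geq // mulr1 mulr_sumr -[leLHS]addr0; apply: lerD; last exact: exprn_ge0.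
  apply: ler_sum => u _; rewrite sT mulnC ltn_mul2r ltn_ord andbT.
  have -> : (0 < m)%N by [nlia]; rewrite mul1r.
  have [st|_] := boolP (stays m a h' hh u); last first.
    by rewrite mulr0 mulr_ge0 ?genw_ge0 // ltW // wt_gt0.
  rewrite mulr1; apply: ler_pM; rewrite ?mulr_ge0 ?exprn_ge0 ?(ltW rho0) //.
    by rewrite /wt lerDl.
  rewrite /genw big_ord_recr /= st mulr1 lerDr.
  by apply: sumr_ge0 => i _; rewrite mulr_ge0 // exprn_ge0.
apply: (@le_trans _ _ (F h)).
  apply: pexp_super => // h' ex sz'; have vh' : valid m h' by case: ex.
  have lt' : (size h' < T * m)%N by move: sz'; rewrite sz subnKC.
  rewrite /F; under [leLHS]eq_bigr => v _ do rewrite size_rcons mulrA.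
  rewrite -mulr_suml; apply: le_trans (ler_wpM2r _ (genw_step vh' lt')) _.
    by apply: prodr_ge0.
  by rewrite [in leRHS]big_ltn // mulrA.
rewrite /F sz; apply: ler_pM.
- by rewrite addr_ge0 ?exprn_ge0 //; apply: sumr_ge0 => u _; rewrite !mulr_ge0 ?genw_ge0 // ltW // wt_gt0.
- exact: prodr_ge0.
- rewrite lerD2r famw_initial //.
  apply: le_trans (oldw_initial vh sz); rewrite oldwE; apply: ler_sum => u _.
  rewrite ler_piMr ?(ltW (wt_gt0 _ _ _ _)) //.
  rewrite /genw big_ord_recl /= expr0 mul1r big1 ?addr0 // => i _.
  by rewrite leqNgt ltn_ord /= mulr0.
apply: le_trans (prod_growth_nat_le _ am0 amT) _.
rewrite !natrM -mulrA invfM [m%:R * _]mulrCA divff ?mulr1 // gt_eqF //.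
Qed.

Lemma sum_inv_nat_le x y : (0 < x)%N -> (x <= y)%N ->
  \sum_(x <= i < y) i%:R^-1 <= 1 + ln (y%:R / x%:R) :> R.
Proof.
move=> x0; have X0 : 0 < x%:R :> R by rewrite ltr0n.
have key z : (x <= z)%N -> \sum_(x <= i < z.+1) i%:R^-1 <= 1 + ln (z%:R / x%:R) :> R.
  elim: z => [|z IH]; first by rewrite leqn0 => /eqP e; rewrite e in x0.
  rewrite leq_eqVlt => /orP[/eqP <-|].
    by rewrite big_nat1 divff ?ln1 ?addr0 ?gt_eqF // invf_le1 // ler1n.
  rewrite ltnS => xz; rewrite big_nat_recr ?leqW //=.
  have z0 : (0 < z)%N by exact: leq_trans xz.
  apply: le_trans (lerD (IH xz) (inv_succ_le_ln R z0)) _.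
  rewrite !ln_div ?posrE ?ltr0n // le_eqVlt; apply/orP; left; apply/eqP; ring.
case: y => [|y]; first by rewrite leqn0 => /eqP e; rewrite e in x0.
rewrite leq_eqVlt => /orP[/eqP <-|]; first by rewrite big_geq // divff ?ln1 ?addr0 // gt_eqF.
rewrite ltnS => xy; apply: le_trans (key _ xy) _; rewrite lerD2l ler_ln ?posrE ?divr_gt0 ?ltr0n ?(leq_trans x0) //.
  by rewrite ler_pM2r ?invr_gt0 // ler_nat.
exact: leqW.
Qed.

Lemma sum_multiples (f : nat -> R) x y : (x <= y)%N ->
  \sum_(x * m <= i < y * m) (m %| i)%N%:R * f i = \sum_(x <= s < y) f (s * m)%N.
Proof.
elim: y => [|y IH]; first by rewrite leqn0 => /eqP ->; rewrite !big_geq.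
rewrite leq_eqVlt => /orP[/eqP <-|]; first by rewrite !big_geq.
rewrite ltnS => xy; rewrite (@big_cat_nat _ _ _ (y * m)) /=; [|by rewrite leq_mul2r xy orbT|by rewrite leq_mul2r leqnSn orbT].
rewrite IH // big_nat_recr //=; congr (_ + _).
rewrite big_ltn; last by rewrite ltn_mul2r ltnSn andbT; nlia.
rewrite dvdn_mull // mul1r big_nat big1 ?addr0 // => i /andP[li iu].
have [/dvdnP[k e]|_] := boolP (m %| i)%N; last by rewrite mul0r.
move: li iu; rewrite e !ltn_mul2r => /andP[_ yk] /andP[_ ky].
by move: (leq_trans ky yk); rewrite ltnn.
Qed.

(** The discount rate; being below m rho it keeps the factors of [discount] positive, and it is
    below 1. *)
Let q := rho / 2.

(* Every hit of v adds to the weight of its descendants at rate wt / totw; discounting by the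
   number of hits lowers that rate by the factor 1 - q. *)
Definition discount (d : nat) : R := \prod_(i < d) (1 - q / (m%:R * rho + i%:R)).

Lemma discount_factor i : 0 < 1 - q / (m%:R * rho + i%:R) <= 1.
Proof.
have r0 := rho0; have M2 : 2 <= m%:R :> R by rewrite ler_nat.
have mr : 2 * rho <= m%:R * rho by rewrite ler_wpM2r // ltW.
have i0 : 0 <= i%:R :> R by [].
have d0 : 0 < m%:R * rho + i%:R by lra.
rewrite subr_gt0 ltr_pdivrMr // mul1r lerBlDr lerDl divr_ge0 ?(ltW d0) // /q.
  by rewrite andbT; lra.
by lra.
Qed.

Lemma discountS d : discount d.+1 = discount d * (1 - q / (m%:R * rho + d%:R)).
Proof. by rewrite /discount big_ord_recr. Qed.

Lemma discount_gt0 d : 0 < discount d.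
Proof. by apply: prodr_gt0 => i _; case/andP: (discount_factor i). Qed.

Lemma discount_le1 d : discount d <= 1.
Proof. by apply: prodr_ile1 => i _; case/andP: (discount_factor i) => /ltW -> ->. Qed.

Lemma discount_mono d d' : (d <= d')%N -> discount d' <= discount d.
Proof.
move=> /subnKC <-; elim: (d' - d)%N => [|k IH]; first by rewrite addn0.
rewrite addnS discountS; apply: le_trans IH; rewrite ler_piMr ?(ltW (discount_gt0 _)) //.
by case/andP: (discount_factor (d + k)).
Qed.

Definition exitw (v : nat) (h : seq nat) (u : nat) : R := (exits m a h v hh u)%:R.

Lemma exitw_rcons v h w u : valid m h -> (m * u < size h)%N ->
  exitw v (rcons h w) u = exitw v h u.
Proof. by move=> vh lt; rewrite /exitw exits_rcons. Qed.

Lemma exitw_ge0 v h u : 0 <= exitw v h u. Proof. by []. Qed.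

Lemma exitw_child v h w s : valid m h -> size h = (m * s)%N -> (a <= s)%N -> (w <= s)%N ->
  exitw v (rcons h w) s <= (m * w < size h)%N%:R * exitw v h w.
Proof.
move=> vh sz as_ ws; have pw : parent m (rcons h w) s = w.
  by rewrite /parent nth_rcons sz ltnn eqxx.
move: ws; rewrite leq_eqVlt => /orP[/eqP e|ws].
  by rewrite /exitw exits_self ?mulr_ge0 // pw.
have wn : (m * w < size h)%N by rewrite sz ltn_mul2l ws andbT; nlia.
rewrite wn mul1r /exitw ler_nat; case: (hh) => [|i] /=; rewrite ltnNge as_ //= pw exits_rcons //.
by case: (boolP (exits m a h v i w)) => [/exitsS|//] /= ->.
Qed.

Definition exitpot (v : nat) (h : seq nat) : R :=
  discount (count_mem v h) * famw (exitw v) h.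

(** Members are hit at rate at most F / c, and when m divides n a child of a member joins with
    weight m rho. A hit of v has probability W / c and costs the factor 1 - q / W, so the discount
    subtracts q / c whatever the weight W. *)
Lemma exitpot_step v h : (v < a)%N -> valid m h -> (a * m <= size h)%N -> (size h < T * m)%N ->
  \sum_(w < (size h %/ m).+1) stp h w * exitpot v (rcons h w) <=
  exitpot v h * (1 + ((1 - q) / totw (size h) + (m %| size h)%N%:R * (m%:R * rho / totw (size h)))).
Proof.
move=> va vh an nT; set n := size h; set s := (n %/ m)%N; set F := famw (exitw v) h.
set c := totw n; have c0 : 0 < c := totw_gt0 rho0 n.
set d := count_mem v h; set G := discount d; have G0 : 0 < G := discount_gt0 d.
have as_ : (a <= s)%N by rewrite leq_divRL //; nlia.
have W0 := wt_gt0 m2 rho0 h v; set W := wt h v in W0.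
have F0 : 0 <= F by apply: sumr_ge0 => u _; rewrite !mulr_ge0 // ltW // wt_gt0.
have S1 := sum_famw_le (exitw_ge0 v) vh nT; rewrite -/n -/s -/F -/c in S1.
pose K : R := 1 + (m %| n)%N%:R * (m%:R * rho).
have K0 : 0 <= K by rewrite addr_ge0 // !mulr_ge0 // ltW.
have q0 : 0 < q by rewrite /q divr_gt0.
have GE w : discount (count_mem v (rcons h w)) = G * (1 - (w == v)%:R * (q / W)).
  rewrite -cats1 count_cat /= addn0; case: (w == v); last by rewrite addn0 mul0r subr0 mulr1.
  by rewrite addn1 discountS mul1r.
have qW : 0 <= 1 - q / W by have /andP[/ltW] := discount_factor d.
have pt (w : 'I_s.+1) : stp h w * exitpot v (rcons h w) <=
    G * (F * stp h w + K * (stp h w * ((m * w < n)%N%:R * exitw v h w)) -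
      (w == v :> nat)%:R * (stp h w * (q / W) * F)).
  have st0 := stp_ge0 m rho0 h w.
  have fr : famw (exitw v) (rcons h w) <= F + K * ((m * w < n)%N%:R * exitw v h w).
    rewrite famw_rcons //; [|exact: exitw_rcons|by rewrite -ltnS].
    rewrite -/n -/s -/F /K [(1 + _) * _]mulrDl mul1r -!addrA lerD2l lerD2l.
    have [mn|_] := boolP (m %| n)%N; last by rewrite !mul0r.
    rewrite !mul1r; have nE : n = (m * s)%N by rewrite mulnC /s divnK.
    have ws : (w <= s)%N by rewrite -ltnS.
    have ec := exitw_child v vh nE as_ ws; rewrite -/n in ec.
    have [e|ne] := eqVneq (val w) s; last by rewrite addr0 ler_wpM2l ?mulr_ge0 // ltW.
    rewrite [X in _ * X <= _](_ : _ = 0) ?mulr0 ?mulr_ge0 ?(ltW rho0) //.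
    rewrite /exitw exits_self // /parent nth_rcons -/n nE ltnn eqxx; exact: e.
  have E0 : 0 <= (m * w < n)%N%:R * exitw v h w by rewrite mulr_ge0.
  have -> : stp h w * exitpot v (rcons h w) = G * (stp h w *
      ((1 - (w == v :> nat)%:R * (q / W)) * famw (exitw v) (rcons h w))).
    by rewrite /exitpot GE; ring.
  apply: ler_wpM2l; first exact: ltW.
  case: eqP => [wv|_]; last first.
    rewrite !mul0r !subr0 mul1r; apply: le_trans (ler_wpM2l st0 fr) _.
    by rewrite le_eqVlt; apply/orP; left; apply/eqP; ring.
  rewrite !mul1r [leLHS]mulrA; apply: le_trans (ler_wpM2l (mulr_ge0 st0 qW) fr) _.
  rewrite -subr_ge0; set E := _ * exitw v h w in E0 *.
  have -> : F * stp h w + K * (stp h w * E) - stp h w * (q / W) * F -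
     stp h w * (1 - q / W) * (F + K * E) = stp h w * (q / W) * (K * E) by ring.
  by apply: mulr_ge0; apply: mulr_ge0 => //; rewrite divr_ge0 // ltW.
apply: le_trans (ler_sum _ (fun w _ => pt w)) _.
rewrite -mulr_sumr /exitpot -/d -/G -/F -mulrA; apply: ler_wpM2l; first exact: ltW.
rewrite big_split /= big_split /= -!mulr_sumr sum_stp // mulr1 sumrN.
have vs : (v < s.+1)%N by rewrite ltnS (leq_trans (ltnW va)).
rewrite [X in _ - X](bigD1 (Ordinal vs)) //= eqxx mul1r [X in _ - (_ + X)]big1 ?addr0; last first.
  by move=> w; rewrite -val_eqE /= => /negbTE ->; rewrite mul0r.
rewrite (stp_old m2 rho0 rho1 an va) -/n -/c -/W.
have -> : W / c * (q / W) * F = q / c * F by field; rewrite !gt_eqF.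
have := ler_wpM2l K0 S1.
have -> : F * (1 + ((1 - q) / c + (m %| n)%N%:R * (m%:R * rho / c))) = F + K * (F / c) - q / c * F.
  by rewrite /K; ring.
lra.
Qed.

(** The exponent is (1 - q) beta from all edges plus m rho beta / m = 1 - beta from the first edges,
    in total 1 - beta q: the discount brings it below 1. *)
Lemma prod_exitpot_le :
  \prod_(a * m <= i < T * m) (1 + ((1 - q) / totw i + (m %| i)%N%:R * (m%:R * rho / totw i))) <=
  expR 1 * (T%:R / a%:R) `^ (1 - beta * q).
Proof.
have b0 := beta_gt0 rho0; have b1 := beta_lt1 rho0.
have A0 : 0 < a%:R :> R by rewrite ltr0n.
have T0 : 0 < T%:R :> R by rewrite ltr0n (leq_trans a0).
have m0 : 0 < m%:R :> R by rewrite ltr0n; nlia.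
have am0 : (0 < a * m)%N by rewrite muln_gt0 a0; nlia.
have amT : (a * m <= T * m)%N by rewrite leq_mul2r aT orbT.
have q0 : 0 < q by rewrite /q divr_gt0.
have q1 : 0 < 1 - q by have := rho1; rewrite /q; lra.
apply: (@le_trans _ _ (\prod_(a * m <= i < T * m) expR ((1 - q) / totw i + (m %| i)%N%:R * (m%:R * rho / totw i)))).
  apply: ler_prod => i _; rewrite expR_ge1Dx andbT.
  by rewrite !addr_ge0 ?divr_ge0 ?mulr_ge0 ?invr_ge0 ?(ltW q1) ?(ltW rho0) // ltW // totw_gt0.
rewrite -expR_sum powRE ?divr_gt0 // -expRD ler_expR big_split /= (sum_multiples (fun i => m%:R * rho / totw i)) //.
set l := ln _; have l0 : 0 <= l by rewrite ln_ge0 // ler_pdivlMr // mul1r ler_nat.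
have s1 : \sum_(a * m <= i < T * m) (1 - q) / totw i <= (1 - q) * beta * (1 + l).
  apply: (@le_trans _ _ ((1 - q) * beta * \sum_(a * m <= i < T * m) i%:R^-1)).
    rewrite mulr_sumr big_nat [leRHS]big_nat; apply: ler_sum => i /andP[ai _].
    rewrite -mulrA ler_pM2l //; apply: totw_inv_le => //; exact: leq_trans ai.
  rewrite ler_pM2l ?mulr_gt0 //; apply: le_trans (sum_inv_nat_le am0 amT) _.
  by rewrite !natrM -mulrA invfM [m%:R * _]mulrCA divff ?mulr1 // gt_eqF.
have s2 : \sum_(a <= s < T) m%:R * rho / totw (s * m) <= (1 - beta) * (1 + l).
  apply: (@le_trans _ _ ((1 - beta) * \sum_(a <= i < T) i%:R^-1)).
    rewrite mulr_sumr big_nat [leRHS]big_nat; apply: ler_sum => i /andP[ai _].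
    have i0 : (0 < i)%N by exact: leq_trans ai.
    have im : (0 < i * m)%N by rewrite muln_gt0 i0; nlia.
    apply: le_trans (ler_wpM2l _ (totw_inv_le rho0 im)) _; first by rewrite mulr_ge0 // ltW.
    rewrite beta_compl // natrM invfM le_eqVlt; apply/orP; left; apply/eqP.
    rewrite mulrACA [m%:R * _]mulrC -mulrA [m%:R * _]mulrCA; field.
    by rewrite !gt_eqF // ltr0n.
  by rewrite ler_pM2l ?subr_gt0 //; exact: sum_inv_nat_le.
apply: le_trans (lerD s1 s2) _.
have := mulr_ge0 (ltW b0) (ltW q0); lra.
Qed.

(** A counted vertex has weight at least m rho and its ancestor a discount at least [discount d], so
    the potentials bound the count. For fixed d the result is of order T (T / a)^(- beta q), a small
    fraction of T for large T / a. *)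
Lemma low_exit_count_le d :
  \sum_(u < T) pexp (T * m) (fun h =>
     `[< exists2 v, (v < a)%N & exits m a h v hh u /\ (count_mem v h <= d)%N >]%:R) [::] <=
  2 * (a * m)%:R * (expR 1 * (T%:R / a%:R) `^ (1 - beta * q)) / (m%:R * rho * discount d).
Proof.
have m0 : 0 < m%:R :> R by rewrite ltr0n; nlia.
have p0 : 0 < m%:R * rho * discount d by rewrite !mulr_gt0 // discount_gt0.
have amT : (a * m <= T * m)%N by rewrite leq_mul2r aT orbT.
rewrite ler_pdivlMr // mulrC -pexp_sum -pexpM.
have TE : (T * m = a * m + (T * m - a * m))%N by rewrite subnKC.
rewrite [in leLHS]TE pexpD -[leRHS](pexp_cst m2 rho0 (a * m) _ (@valid_nil m)).
apply: pexp_le => // h [vh _]; rewrite add0n => sz.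
pose P n := \prod_(n <= i < T * m) (1 + ((1 - q) / totw i + (m %| i)%N%:R * (m%:R * rho / totw i))).
have q1 : 0 <= 1 - q by have := rho1; rewrite /q; lra.
have P0 n : 0 <= P n.
  apply: prodr_ge0 => i _.
  by rewrite !addr_ge0 ?divr_ge0 ?mulr_ge0 ?invr_ge0 ?(ltW rho0) // ltW // totw_gt0.
apply: (@le_trans _ _ (pexp (T * m - a * m) (fun h' => \sum_(v < a) exitpot v h') h)).
  apply: pexp_le => // h' ex sz'; have vh' : valid m h' by case: ex.
  have sT : size h' = (T * m)%N by rewrite sz' sz -TE.
  rewrite /exitpot /famw; under [leRHS]eq_bigr => v _ do rewrite mulr_sumr.
  rewrite exchange_big mulr_sumr /=; apply: ler_sum => u _.
  have uT : (m * u < size h')%N by rewrite sT mulnC ltn_mul2r ltn_ord andbT; nlia.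
  have nn (v : 'I_a) : true -> 0 <= discount (count_mem (val v) h') * ((m * u < size h')%N%:R * (wt h' u * exitw v h' u)).
    by rewrite !mulr_ge0 ?(ltW (discount_gt0 _)) // ltW // wt_gt0.
  case: asboolP => [[v va [ev cv]]|_]; last by rewrite mulr0; apply: sumr_ge0.
  rewrite mulr1 (bigD1 (Ordinal va)) //= -[leLHS]addr0; apply: lerD; last by apply: sumr_ge0 => w _; exact: nn.
  rewrite uT /exitw ev mul1r mulr1 mulrC; apply: ler_pM; rewrite ?(ltW (discount_gt0 _)) ?mulr_ge0 ?(ltW rho0) //.
    exact: discount_mono.
  by rewrite /wt lerDl.
rewrite pexp_sum.
apply: (@le_trans _ _ (\sum_(v < a) exitpot v h * P (a * m)%N)).
  apply: ler_sum => v _; pose F h' := exitpot v h' * P (size h').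
  have -> : exitpot v h * P (a * m)%N = F h by rewrite /F sz.
  apply: (@le_trans _ _ (pexp (T * m - a * m) F h)).
    apply: pexp_le => // h' ex sz'.
    have sT : size h' = (T * m)%N by rewrite sz' sz -TE.
    by rewrite /F /P sT big_geq // mulr1.
  apply: pexp_super => // h' ex sz'; have vh' : valid m h' by case: ex.
  have le' : (a * m <= size h')%N by rewrite -sz; exact: extends_size ex.
  have lt' : (size h' < T * m)%N by move: sz'; rewrite sz subnKC.
  rewrite /F; under [leLHS]eq_bigr => w _ do rewrite size_rcons mulrA.
  rewrite -mulr_suml; apply: le_trans (ler_wpM2r _ (exitpot_step (ltn_ord v) vh' le' lt')) _ => //.
  have -> : P (size h') = (1 + ((1 - q) / totw (size h') +
     (m %| size h')%:R * (m%:R * rho / totw (size h')))) * P (size h').+1 by rewrite /P big_ltn.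
  by rewrite [leRHS]mulrA.
rewrite -mulr_suml; apply: ler_pM => //.
- apply: sumr_ge0 => v _; rewrite mulr_ge0 ?(ltW (discount_gt0 _)) //.
  by apply: sumr_ge0 => u _; rewrite !mulr_ge0 // ltW // wt_gt0.
- apply: le_trans (oldw_initial vh sz); rewrite oldwE; apply: ler_sum => v _.
  rewrite /exitpot famw_initial // (bigD1 v) //= [X in _ * (_ + X)]big1 ?addr0; last first.
    move=> u uv; rewrite /exitw; case: (hh) => [|i] /=; rewrite ltn_ord.
      by rewrite -val_eqE /= in uv; rewrite (negbTE uv) mulr0.
    by rewrite -val_eqE /= in uv; rewrite (negbTE uv) mulr0.
  apply: (@le_trans _ _ (1 * (wt h v * 1))); last by rewrite mul1r mulr1.
  have w0 := ltW (wt_gt0 m2 rho0 h v).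
  apply: ler_pM; rewrite ?mulr_ge0 ?(ltW (discount_gt0 _)) ?discount_le1 //.
  by rewrite ler_wpM2l // lern1; case: (exits _ _ _ _ _ _).
exact: prod_exitpot_le.
Qed.

End FamilyWeights.

Lemma truncn_bounds (R : realType) (z : R) : 1 <= z ->
  [/\ (0 < Num.truncn z)%N, (Num.truncn z)%:R <= z & z <= 2 * (Num.truncn z)%:R].
Proof.
move=> z1; have z0 : 0 <= z by lra.
have /andP[l u] := truncn_itv z0; have p : (0 < Num.truncn z)%N by rewrite truncn_gt0.
split=> //; have : 1 <= (Num.truncn z)%:R :> R by rewrite ler1n.
by move: u; rewrite -natr1; lra.
Qed.

Lemma reach_extends m T t h h' u w k : size h = (T * m)%N -> (T <= t)%N ->
  extends m h h' -> reach T m h u w k -> reach t m h' u w k.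
Proof.
move=> sz Tt ex [p [pp ap lp sp]]; exists p; split=> //; last first.
  by apply/allP => x xp; apply: leq_trans Tt; exact: (allP ap).
move: ap => /=; elim: p u pp {lp sp} => //= x p IH u /andP[ux xp] /and3P[uT xT pT].
rewrite (IH x xp) ?xT // andbT; move/hadjP: ux => [j jm ux]; apply/hadjP; exists j => //.
have lt v : (v < T)%N -> (m * v + j < size h)%N.
  move=> vT; rewrite sz; apply: leq_trans (_ : m * v.+1 <= _)%N; first by rewrite mulnS addnC ltn_add2r.
  by rewrite mulnC leq_mul2r vT orbT.
by case: ux => e; [left|right]; rewrite (extends_nth ex) // lt.
Qed.

(** * The hierarchy of hubs *)

Section Levels.
Variables (R : realType) (m : nat) (rho : R).
Hypotheses (m2 : (1 < m)%N) (rho0 : 0 < rho) (rho1 : rho < 1).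

Local Notation totw := (totw rho).
Local Notation wt := (wt m rho).
Local Notation pexp := (pexp m rho).
Local Notation beta := (beta rho).
Local Notation oldw := (oldw m rho).

Variables (th eta B b : R) (T t L : nat).
(** A step up from level k has probability of order exp (sg lexp k) / t, capped at 1; up to [eta],
    positivity of [sg] is the condition th < beta / (1 - beta). *)
Let sg := beta - eta - th * (1 - beta + eta).
Hypotheses (th1 : 1 < th) (eta0 : 0 < eta) (sg0 : 0 < sg) (B1 : 1 <= B) (Bb : B <= b)
  (bL : b * th ^+ L = ln T%:R) (T0 : (0 < T)%N) (Tt : (T <= t)%N) (t2 : (t <= 2 * T)%N)
  (L0 : (0 < L)%N).

(* With y_k = expR (lexp k), level k consists of the vertices of weight at least
   y_k^(beta - eta) / 2; the T / y_k oldest vertices supply its total weight. *)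
Definition lexp (k : nat) : R := b * th ^+ k.

Lemma b_gt0 : 0 < b. Proof. by have := B1; have := Bb; lra. Qed.
Lemma th_gt0 : 0 < th. Proof. by have := th1; lra. Qed.

Lemma lexp_gt0 k : 0 < lexp k.
Proof. by rewrite mulr_gt0 ?b_gt0 // exprn_gt0 ?th_gt0. Qed.

Lemma lexpS k : lexp k.+1 = th * lexp k.
Proof. by rewrite /lexp exprS mulrCA. Qed.

Lemma lexp_le k : (k <= L)%N -> lexp k <= ln T%:R.
Proof.
move=> kL; rewrite -bL ler_pM2l ?b_gt0 // ler_weXn2l // ltW //.
Qed.

Definition lev (k : nat) : nat := Num.truncn (T%:R * expR (- lexp k)).

Let TR : 0 < T%:R :> R. Proof. by rewrite ltr0n. Qed.

Lemma expR_lnT : expR (ln T%:R) = T%:R :> R. Proof. by rewrite lnK // posrE. Qed.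

Lemma lev_bounds k : (k <= L)%N ->
  [/\ (0 < lev k)%N, (lev k <= T)%N, expR (lexp k) <= T%:R / (lev k)%:R
    & T%:R / (lev k)%:R <= 2 * expR (lexp k)].
Proof.
move=> kL; have E0 := expR_gt0 (lexp k).
have z1 : 1 <= T%:R * expR (- lexp k).
  rewrite expRN ler_pdivlMr // mul1r -expR_lnT ler_expR; exact: lexp_le.
have [p l u] := truncn_bounds z1; rewrite -/(lev k) in p l u.
have P0 : 0 < (lev k)%:R :> R by rewrite ltr0n.
move: l u; rewrite expRN ler_pdivlMr // ler_pdivrMr // => l u.
split=> //.
- rewrite -(ler_nat R); apply: le_trans l; rewrite ler_peMr ?(ltW P0) //.
  by rewrite -expR0 ler_expR ltW // lexp_gt0.
- by rewrite ler_pdivlMr // mulrC.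
by rewrite ler_pdivrMr // mulrAC.
Qed.

Lemma lev_last : lev L = 1%N.
Proof. by rewrite /lev /lexp bL expRN expR_lnT divff ?truncn1 // gt_eqF. Qed.

(** The typical order of the weight of the [lev k] oldest vertices, lowered by the factor y_k^(-eta)
    to make the failure probabilities summable over levels. *)
Definition thr (k : nat) : R :=
  (lev k)%:R * (T%:R / (lev k)%:R) `^ beta * expR (- (eta * lexp k)).

Lemma thr_ge0 k : 0 <= thr k.
Proof. by rewrite !mulr_ge0 ?powR_ge0 // expR_ge0. Qed.

Lemma thr_fail_le k : (k <= L)%N ->
  pexp (T * m) (fun h => `[< oldw (lev k) h <= thr k >]%:R) [::] <= 2 * expR (- (eta * lexp k)).
Proof.
move=> kL; have [p pT _ _] := lev_bounds kL.
have P0 : 0 < (lev k)%:R :> R by rewrite ltr0n.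
apply: le_trans (urn_low_prob m2 rho0 rho1 p pT (thr_ge0 k)) _.
have e : ((lev k)%:R / T%:R) `^ beta = ((T%:R / (lev k)%:R) `^ beta)^-1 :> R.
  by rewrite -[X in X `^ _]invf_div -[X in X `^ _]powR_inv1 ?divr_ge0 // -powRrM mulN1r powRN.
have q0 : 0 < (T%:R / (lev k)%:R) `^ beta by rewrite powR_gt0 // divr_gt0.
rewrite e /thr -mulrA ler_pM2l // le_eqVlt; apply/orP; left; apply/eqP.
by move: (_ `^ _) q0 (expR _) => z z0 E; field; rewrite !gt_eqF.
Qed.

(** The first bound serves as average weight per vertex, the second as total weight of a level;
    rounding in [lev] costs the factor 1 / 2. *)
Lemma thr_ge k : (k <= L)%N ->
  (lev k)%:R * expR ((beta - eta) * lexp k) <= thr k /\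
  T%:R / 2 * expR ((beta - 1 - eta) * lexp k) <= thr k.
Proof.
move=> kL; have [p pT l u] := lev_bounds kL.
have b0 := beta_gt0 rho0; have b1 := beta_lt1 rho0.
have P0 : 0 < (lev k)%:R :> R by rewrite ltr0n.
have E0 := expR_gt0 (lexp k).
have z0 : 0 < T%:R / (lev k)%:R :> R by rewrite divr_gt0.
have pe x : expR (lexp k) `^ x = expR (x * lexp k) by rewrite powRE // expRK.
rewrite /thr; split.
  rewrite -[leRHS]mulrA; apply: ler_wpM2l; first exact: ltW.
  have -> : expR ((beta - eta) * lexp k) = expR (beta * lexp k) * expR (- (eta * lexp k)).
    by rewrite -expRD; congr expR; ring.
  rewrite ler_pM2r ?expR_gt0 // -pe; apply: powR_mono => //; exact: ltW.
have -> : expR ((beta - 1 - eta) * lexp k) = expR ((beta - 1) * lexp k) * expR (- (eta * lexp k)).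
  by rewrite -expRD; congr expR; ring.
rewrite mulrA ler_pM2r ?expR_gt0 //.
set z := T%:R / _ in z0 l u *.
have -> : (lev k)%:R = T%:R / z by rewrite /z invf_div mulrCA divff ?mulr1 // gt_eqF.
rewrite -!mulrA ler_pM2l // -[z^-1 * _]mulrC -powRB1 //.
have -> : beta - 1 = - (1 - beta) by ring.
have b1' : 0 <= 1 - beta by lra.
apply: le_trans (powR_antimono b1' z0 u).
rewrite powRM ?expR_ge0 // pe ler_pM2r ?expR_gt0 // powRN lef_pV2 ?posrE ?powR_gt0 //.
have b2 : 1 - beta <= 1 by lra.
by apply: ler1_powR b2; rewrite ler1n.
Qed.

Let Cth := 1 + (th - 1)^-1.

Lemma sum_levels_le s K : 0 < s -> \sum_(0 <= k < K) expR (- (s * lexp k)) <= Cth / (s * B).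
Proof.
move=> s0; have B0 : 0 < B by have := B1; lra.
have sB : 0 < s * B by rewrite mulr_gt0.
apply: (@le_trans _ _ (\sum_(0 <= k < K) (s * B)^-1 * (th ^+ k)^-1)).
  apply: ler_sum => k _; rewrite expRN -invfM lef_pV2 ?posrE ?expR_gt0 ?mulr_gt0 ?exprn_gt0 ?th_gt0 //.
  apply: le_trans (_ : s * lexp k <= _); last by apply: le_trans (expR_ge1Dx _); rewrite lerDr.
  by rewrite /lexp -mulrA ler_pM2l // ler_pM2r ?exprn_gt0 ?th_gt0.
rewrite -mulr_sumr mulrC ler_pM2r ?invr_gt0 //.
case: K => [|K]; first by rewrite big_geq // addr_ge0 // invr_ge0; have := th1; lra.
by rewrite big_ltn // expr0 invr1 lerD2l; exact: geometric_sum_le.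
Qed.

(** The last level is vertex 0 alone, in accordance with [lev_last]. *)
Definition hub (h0 : seq nat) (k : nat) : pred nat := fun u =>
  if (k < L)%N then (u < T)%N && (expR ((beta - eta) * lexp k) / 2 <= wt h0 u) else u == 0%N.

Definition hubX (k : nat) : R := expR ((beta - eta) * lexp k) / 2.
Definition hubQ (k : nat) : R := T%:R / 4 * expR ((beta - 1 - eta) * lexp k.+1).
(** 144 is 9 times 16: [totw (t * m)] is at most 3 t m, and the factor T / 8 is at least t / 16. *)
Let C : R := 144 * m%:R ^+ 2.
Definition hubq (k : nat) : R := Num.min 1 (expR (sg * lexp k) / (C * t%:R)).

Let mR : 0 < m%:R :> R. Proof. by rewrite ltr0n; nlia. Qed.
Let tR : 0 < t%:R :> R. Proof. by rewrite ltr0n (leq_trans T0). Qed.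
Let C0 : 0 < C. Proof. by rewrite mulr_gt0 // exprn_gt0. Qed.

(** The light vertices among the [lev k.+1] oldest carry at most half of [thr k.+1], since each is
    below half the average granted by [thr_ge]; the heavy ones carry the rest. *)
Lemma hub_weight h0 k : (k < L)%N ->
  thr k.+1 < oldw (lev k.+1) h0 -> hubQ k <= \sum_(u < T | hub h0 k.+1 u) wt h0 u.
Proof.
move=> kL lt; have [p pT l u] := lev_bounds kL; have [g1 g2] := thr_ge kL.
rewrite /hub /hubQ; set E := expR ((beta - 1 - eta) * _) in g2 *.
have E0 : 0 <= E := expR_ge0 _.
have hq : T%:R / 4 * E <= thr k.+1 / 2 by move: g2; move: (thr k.+1) => z; lra.
have w0 := fun u => ltW (wt_gt0 m2 rho0 h0 u).
have [kL'|kL'] := ltnP k.+1 L; last first.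
  have kE : k.+1 = L by nlia.
  rewrite (bigD1 (Ordinal T0)) //= big1 ?addr0; last first.
    by move=> v /andP[/eqP e]; rewrite -val_eqE /= e.
  move: lt; rewrite oldwE kE lev_last big_ord1 -kE => lt.
  by apply: le_trans hq _; have := thr_ge0 k.+1; move: lt; move: (thr k.+1) (wt h0 _) => ? ?; lra.
set X := expR _ / 2; have X0 : 0 <= X by rewrite divr_ge0 ?expR_ge0.
apply: (@le_trans _ _ (oldw (lev k.+1) h0 - (lev k.+1)%:R * X)).
  apply: le_trans hq _; have : (lev k.+1)%:R * X <= thr k.+1 / 2.
    by rewrite /X mulrA ler_pM2r ?invr_gt0.
  by move: lt; move: (thr k.+1) (oldw _ _) (_ * X) => ? ? ?; lra.
rewrite lerBlDr oldwE.
have -> : (lev k.+1)%:R * X = \sum_(u < lev k.+1) X by rewrite sumr_const card_ord mulr_natl.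
have le1 : \sum_(u < lev k.+1) wt h0 u <= \sum_(u < lev k.+1) ((X <= wt h0 u)%R%:R * wt h0 u + X).
  apply: ler_sum => v _; have := w0 v; have [le|gt] := lerP X (wt h0 v).
    by rewrite mul1r lerDl.
  by move=> _; rewrite mul0r add0r; exact: ltW.
apply: le_trans le1 _.
rewrite big_split /= lerD2r (big_ord_widen _ (fun u => (X <= wt h0 u)%R%:R * wt h0 u) pT).
rewrite big_mkcond [leRHS]big_mkcond; apply: ler_sum => v _; rewrite ltn_ord /=.
by case: (v < _)%N; case: (X <= _); rewrite ?mul1r ?mul0r ?w0.
Qed.

Lemma hubq_bounds k : [/\ 0 < hubq k, hubq k <= 1 &
  (hubq k)^-1 <= 1 + C * t%:R * expR (- (sg * lexp k))].
Proof.
have z0 : 0 < expR (sg * lexp k) / (C * t%:R) by rewrite divr_gt0 ?expR_gt0 // mulr_gt0.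
have q0 : 0 < hubq k by rewrite lt_min ltr01.
split=> //; first by rewrite ge_min lexx.
have D0 : 0 < C * t%:R * expR (- (sg * lexp k)) by rewrite !mulr_gt0 ?expR_gt0.
rewrite /hubq minEle; case: ifP => _; first by rewrite invr1 lerDl ltW.
by rewrite invf_div expRN lerDr.
Qed.

Lemma hubq_le k : hubq k <= hubX k / totw (t * m) * (hubQ k / totw (t * m)).
Proof.
have c0 := totw_gt0 rho0 (t * m).
have cl : totw (t * m) <= 3 * (t%:R * m%:R).
  have : 1 <= t%:R * m%:R :> R by rewrite -natrM ler1n muln_gt0 (leq_trans T0) //; nlia.
  rewrite /totw natrM; move: (t%:R * m%:R) => z z1; have r0 := rho0; have r1 := rho1.
  have : z * rho <= z by rewrite ler_piMr ?ltW //; lra.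
  lra.
apply: le_trans (_ : expR (sg * lexp k) / (C * t%:R) <= _); first by rewrite ge_min lexx orbT.
have -> : hubX k / totw (t * m) * (hubQ k / totw (t * m)) =
    expR (sg * lexp k) * (T%:R / 8) / totw (t * m) ^+ 2.
  have -> : expR (sg * lexp k) = expR ((beta - eta) * lexp k) * expR ((beta - 1 - eta) * lexp k.+1).
    by rewrite -expRD lexpS /sg; congr expR; ring.
  by rewrite /hubX /hubQ; field; rewrite gt_eqF.
rewrite -[leRHS]mulrA ler_pM2l ?expR_gt0 // ler_pdivlMr ?exprn_gt0 // mulrC ler_pdivrMr ?mulr_gt0 //.
apply: (@le_trans _ _ ((3 * (t%:R * m%:R)) ^+ 2)).
  by rewrite ler_pXn2r ?nnegrE ?mulr_ge0 // ltW.
have tT : t%:R <= 2 * T%:R :> R by rewrite -natrM ler_nat.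
have -> : T%:R / 8 * (C * t%:R) = (2 * T%:R) * (9 * m%:R ^+ 2 * t%:R) by rewrite /C; field.
have -> : (3 * (t%:R * m%:R)) ^+ 2 = t%:R * (9 * m%:R ^+ 2 * t%:R) :> R by ring.
by rewrite ler_wpM2r // !mulr_ge0 ?exprn_ge0.
Qed.

(** The waiting times add up to at most L, from the cap of [hubq] at 1, plus a multiple of t / B,
    while t - T new vertices are available. *)
Lemma climb_levels h0 u : valid m h0 -> size h0 = (T * m)%N -> (T < t)%N -> (u < T)%N ->
  (forall k, (0 < k <= L)%N -> thr k < oldw (lev k) h0) -> hubX 0 <= wt h0 u ->
  pexp ((t - T) * m) (fun h => `[< ~ reach t m h u 0 (2 * L) >]%:R) h0 <=
  (L%:R + C * t%:R * (Cth / (sg * B))) / (t - T)%:R.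
Proof.
move=> vh sz Tt' uT urn wu; have r0 : 0 < (t - T)%:R :> R by rewrite ltr0n subn_gt0.
have ST k v : hub h0 k v -> (v < T)%N by rewrite /hub; case: ifP => [_ /andP[]|_ /eqP ->].
have SX k v : (k < L)%N -> hub h0 k v -> hubX k <= wt h0 v by rewrite /hub => -> /andP[].
have SQ k : (k < L)%N -> hubQ k <= \sum_(u < T | hub h0 k.+1 u) wt h0 u.
  by move=> kL; apply: hub_weight => //; apply: urn; rewrite ltnS.
have X0 k : (k < L)%N -> 0 <= hubX k by rewrite divr_ge0 ?expR_ge0.
have Q0 k : (k < L)%N -> 0 <= hubQ k by rewrite !mulr_ge0 ?expR_ge0.
have q0 k : (k < L)%N -> 0 < hubq k by case: (hubq_bounds k).
have q1 k : (k < L)%N -> hubq k <= 1 by case: (hubq_bounds k).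
have qE k : (k < L)%N -> hubq k <= hubX k / totw (t * m) * (hubQ k / totw (t * m)).
  by move=> _; exact: hubq_le.
have Su : hub h0 0 u by rewrite /hub L0 uT.
have := @climb _ _ _ _ _ _ _ m2 rho0 rho1 sz Tt _ _ _ _ ST SX SQ X0 Q0 q0 q1 qE
  (t - T) T 0%N u h0 (extends_refl vh) sz (subnKC Tt) (leqnn T) (leq0n L) Su.
move=> cl; rewrite ler_pdivlMr // mulrC; apply: le_trans (le_trans _ cl) _.
  apply: ler_wpM2l => //; apply: pexp_le => // h ex _.
  have [nr|//] := asboolP (~ reach t m h u 0 (2 * L)).
  case: asboolP => // ns; exfalso; apply: ns => -[w Sw rw]; apply: nr.
  by move: Sw; rewrite /hub ltnn => /eqP e; rewrite e subn0 in rw.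
rewrite /wait; apply: (@le_trans _ _ (\sum_(0 <= k < L) (1 + C * t%:R * expR (- (sg * lexp k))))).
  by apply: ler_sum => k _; case: (hubq_bounds k).
rewrite big_split /= sumr_const_nat subn0 -mulr_sumr lerD2l ler_pM2l ?mulr_gt0 //.
exact: sum_levels_le.
Qed.

Variables (a hh d K : nat).
Hypotheses (a0 : (0 < a)%N) (aT : (a <= T)%N) (Tt' : (T < t)%N) (Xd : hubX 0 <= d%:R)
  (KE : (hh + 2 * L <= K)%N).

Let W := (L%:R + C * t%:R * (Cth / (sg * B))) / (t - T)%:R.

(** Four ways to fail: the ancestral line stays young for hh generations, it ends at an old vertex
    with few hits, some urn is too light at time T, or the climb from there is too slow. *)
Lemma unreached_le v : (v < T)%N ->
  pexp (t * m) (fun h => `[< ~ reach t m h v 0 K >]%:R) [::] <=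
  pexp (T * m) (fun h => (stays m a h hh v)%:R) [::] +
  pexp (T * m) (fun h =>
     `[< exists2 w, (w < a)%N & exits m a h w hh v /\ (count_mem w h <= d)%N >]%:R) [::] +
  2 * (Cth / (eta * B)) + W.
Proof.
move=> vT.
have tE : (t * m = T * m + (t - T) * m)%N by rewrite -mulnDl subnKC.
have W0 : 0 <= W.
  have B0 : 0 < B by have := B1; lra.
  have Ct0 : 0 <= Cth by rewrite addr_ge0 // invr_ge0; have := th1; lra.
  rewrite divr_ge0 // addr_ge0 // mulr_ge0 //; first by rewrite mulr_ge0 // ltW.
  by rewrite divr_ge0 // mulr_ge0 // ltW.
pose urn h : R := \sum_(1 <= k < L.+1) `[< oldw (lev k) h <= thr k >]%:R.
have urnE : pexp (T * m) urn [::] <= 2 * (Cth / (eta * B)).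
  rewrite pexp_sum; apply: (@le_trans _ _ (\sum_(1 <= k < L.+1) 2 * expR (- (eta * lexp k)))).
    rewrite big_nat [leRHS]big_nat; apply: ler_sum => k /andP[_ kL]; exact: thr_fail_le.
  rewrite -mulr_sumr ler_pM2l //; apply: le_trans (sum_levels_le L.+1 eta0).
  by rewrite [leRHS]big_ltn // lerDr expR_ge0.
rewrite tE pexpD.
apply: (@le_trans _ _ (pexp (T * m) (fun h0 => (stays m a h0 hh v)%:R +
   `[< exists2 w, (w < a)%N & exits m a h0 w hh v /\ (count_mem w h0 <= d)%N >]%:R + urn h0 + W) [::])); last first.
  by rewrite 3!pexpDf pexp_cst // lerD2r lerD2l.
apply: pexp_le => // h0 [vh0 _]; rewrite add0n => sz0.
have le1 : pexp ((t - T) * m) (fun h => `[< ~ reach t m h v 0 K >]%:R) h0 <= 1.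
  exact: pexp_bool_le1.
have urn0 : 0 <= urn h0 by apply: sumr_ge0.
have [st|nst] := boolP (stays m a h0 hh v).
  by apply: le_trans le1 _; rewrite -!addrA lerDl !addr_ge0.
rewrite add0r; case: asboolP => [_|nlow].
  by apply: le_trans le1 _; rewrite -!addrA lerDl !addr_ge0.
rewrite add0r.
have [ok|] := pselect (forall k, (0 < k <= L)%N -> thr k < oldw (lev k) h0); last first.
  move=> /existsNP[k] /not_implyP[/andP[k0 kL] /negP]; rewrite -leNgt => bad.
  apply: le_trans le1 _; rewrite -[leLHS]addr0; apply: lerD => //.
  rewrite /urn (bigD1_seq k) ?mem_index_iota ?k0 ?ltnS ?iota_uniq //=.
  by move/asboolP: bad => ->; rewrite lerDl sumr_ge0.
have [w wa [ew rw]] := not_stays_exits m2 vh0 sz0 vT nst.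
have dw : (d < count_mem w h0)%N.
  by rewrite ltnNge; apply/negP => le; apply: nlow; exists w.
have wT : (w < T)%N by exact: leq_trans aT.
have ww : hubX 0 <= wt h0 w.
  apply: le_trans Xd _; apply: le_trans (_ : (count_mem w h0)%:R <= _).
    by rewrite ler_nat ltnW.
  by rewrite /wt lerDr mulr_ge0 // ltW.
rewrite -[leLHS]add0r; apply: lerD => //.
apply: le_trans (climb_levels vh0 sz0 Tt' wT ok ww).
apply: pexp_le => // h ex _; have [nr|//] := asboolP (~ reach t m h v 0 K).
case: asboolP => // nr'; exfalso; apply: nr' => r'; apply: nr.
apply: reachW KE _; apply: reach_trans r'; exact: reach_extends ex rw.
Qed.

Lemma unreached_sum_le :
  \sum_(v < t) pexp (t * m) (fun h => `[< ~ reach t m h v 0 K >]%:R) [::] <=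
  (t - T)%:R +
  (2 * (a * m)%:R + 2 ^+ hh.+1) * (T%:R / a%:R) ^+ growthexp m / (m%:R * rho * 2 ^+ hh) +
  2 * (a * m)%:R * (expR 1 * (T%:R / a%:R) `^ (1 - beta * (rho / 2))) / (m%:R * rho * discount m rho d) +
  T%:R * (2 * (Cth / (eta * B)) + W).
Proof.
rewrite -(big_mkord xpredT (fun v => pexp (t * m) (fun h => `[< ~ reach t m h v 0 K >]%:R) [::])).
rewrite (@big_cat_nat _ _ _ T) //= addrC -!addrA; apply: lerD.
  apply: (@le_trans _ _ (\sum_(T <= i < t) 1)).
    by apply: ler_sum => v _; exact: pexp_bool_le1.
  by rewrite sumr_const_nat.
rewrite big_mkord; apply: le_trans (ler_sum _ (fun (v : 'I_T) _ => unreached_le (ltn_ord v))) _.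
rewrite !big_split /= !sumr_const !card_ord -!addrA; apply: lerD.
  exact: stays_count_le.
apply: lerD; first exact: low_exit_count_le.
by rewrite [leRHS]mulr_natl mulrnDl.
Qed.

End Levels.

Section Choices.
Variable R : realType.

Lemma nat_ge (c : R) : exists N : nat, forall n, (N <= n)%N -> c <= n%:R.
Proof.
exists (Num.bound `|c|) => n Nn.
apply: le_trans (_ : (Num.bound `|c|)%:R <= _); last by rewrite ler_nat.
by apply: le_trans (ler_norm c) _; apply/ltW/archi_boundP.
Qed.

Lemma small_exp2 (c e : R) : 0 < e -> exists n : nat, c / 2 ^+ n <= e.
Proof.
move=> e0; have [n cn] := nat_ge (c / e); exists n.
have p0 : 0 < 2 ^+ n :> R by exact: exprn_gt0.
rewrite ler_pdivrMr // mulrC -ler_pdivrMr //; apply: le_trans (cn n (leqnn _)) _.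
by rewrite -natrX ler_nat ltnW // ltn_expl.
Qed.

Lemma small_powR (c s e : R) : 0 < s -> 0 < e ->
  exists2 M : nat, (0 < M)%N & forall z, M%:R <= z -> c * z `^ (- s) <= e.
Proof.
move=> s0 e0; have [M cM] := nat_ge ((`|c| / e) `^ s^-1); exists M.+1 => // z Mz.
have M0 : 0 < M.+1%:R :> R by rewrite ltr0n.
have z0 : 0 < z by exact: lt_le_trans Mz.
apply: le_trans (_ : `|c| * z `^ (- s) <= _); first by rewrite ler_wpM2r ?powR_ge0 ?ler_norm.
rewrite powRN ler_pdivrMr ?powR_gt0 // mulrC -ler_pdivrMr //.
have := powR_mono (ltW s0) (powR_ge0 _ _) (le_trans (cM M.+1 (leqnSn _)) Mz).
by rewrite -powRrM mulVf ?gt_eqF // powRr1 // divr_ge0 // ltW.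
Qed.

(** The levels have to end exactly at x = ln T, where only vertex 0 is left. The start b absorbs the
    rounding of L and stays below th B, so the weight required at level 0 is bounded. *)
Lemma geometric_position (th B x : R) : 1 < th -> 1 <= B -> th * B <= x ->
  exists L : nat, exists b : R,
    [/\ (0 < L)%N, B <= b, b <= th * B, b * th ^+ L = x & L%:R * ln th <= ln x].
Proof.
move=> th1 B1 Bx; have th0 : 0 < th by lra.
have B0 : 0 < B by lra.
have x0 : 0 < x by apply: lt_le_trans Bx; rewrite mulr_gt0.
have l0 : 0 < ln th by rewrite ln_gt0.
set z := ln (x / B) / ln th.
have z1 : 1 <= z by rewrite ler_pdivlMr // mul1r ler_ln ?posrE ?divr_gt0 // ler_pdivlMr.
have z0 : 0 <= z by lra.
have /andP[lo hi] := truncn_itv z0; set L := Num.truncn z in lo hi.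
have p0 n : 0 < th ^+ n by exact: exprn_gt0.
have lnX n : ln (th ^+ n) = n%:R * ln th by rewrite lnXn // mulr_natl.
have lo' : th ^+ L <= x / B.
  by rewrite -ler_ln ?posrE ?divr_gt0 // lnX -ler_pdivlMr.
have hi' : x / B <= th ^+ L.+1.
  by rewrite -ler_ln ?posrE ?divr_gt0 // lnX -ler_pdivrMr // ltW.
exists L, (x / th ^+ L); split.
- by rewrite truncn_gt0.
- by rewrite ler_pdivlMr // mulrC -ler_pdivlMr.
- by rewrite ler_pdivrMr // mulrAC -exprS -ler_pdivrMr.
- by rewrite mulfVK // gt_eqF.
rewrite -lnX ler_ln ?posrE //; apply: le_trans lo' _.
by rewrite ler_pdivrMr // ler_peMr // ltW.
Qed.

End Choices.

(** * Most vertices are close to vertex 0 *)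

Section Upper.
Variables (R : realType) (m : nat) (rho : R).
Hypotheses (m2 : (1 < m)%N) (rho0 : 0 < rho) (rho1 : rho < 1).

Local Notation pexp := (pexp m rho).
Local Notation beta := (beta rho).

Lemma climbing_exponents y : 0 < y -> 2 < y * (- ln rho) ->
  exists th eta, [/\ 1 < th, 2 < y * ln th, 0 < eta & 0 < beta - eta - th * (1 - beta + eta)].
Proof.
move=> y0 yl; have b0 := beta_gt0 rho0.
(* The midpoint of 2 / y and - ln rho: th = exp l' is below 1 / rho, while y ln th still exceeds
   2. *)
pose l' := (2 / y - ln rho) / 2.
have h1 : 2 / y < - ln rho by rewrite ltr_pdivrMr // mulrC.
have y2 : 0 < 2 / y by rewrite divr_gt0.
exists (expR l'); pose D := beta * (1 - expR l' * rho).
have tr : expR l' * rho < 1.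
  by rewrite -[X in _ * X]lnK ?posrE // -expRD -expR0 ltr_expR /l'; lra.
have D0 : 0 < D by rewrite mulr_gt0 // subr_gt0.
have t0 := expR_gt0 l'.
(* D is beta - th (1 - beta), and [eta] spends half of it. *)
exists (D / (2 * (1 + expR l'))); split.
- by rewrite -expR0 ltr_expR /l'; lra.
- rewrite expRK mulrC -ltr_pdivrMr // /l'; lra.
- by rewrite divr_gt0 // mulr_gt0 // addr_gt0.
rewrite beta_compl //.
have -> : beta - D / (2 * (1 + expR l')) - expR l' * (beta * rho + D / (2 * (1 + expR l'))) = D / 2.
  by rewrite /D; field; rewrite gt_eqF // addr_gt0.
by rewrite divr_gt0.
Qed.

Lemma upper_vertex y e : 0 < y -> 2 < y * (- ln rho) -> 0 < e ->
  exists N : nat, forall t K : nat, (N <= t)%N -> y * ln (ln t%:R) <= K%:R ->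
  (\sum_(v < t) pexp (t * m) (fun h => `[< ~ reach t m h v 0 K >]%:R) [::]) / t%:R <= e.
Proof.
move=> y0 yl e0; have b0 := beta_gt0 rho0; have b1 := beta_lt1 rho0.
have [th [eta [th1 yth eta0 sg0]]] := climbing_exponents y0 yl.
set sg := _ - _ - _ in sg0.
(* Seven shares: one for vertices born after T, two for lines that stay young, one for ancestors
   with few hits, and three for the urns, the term L and the waiting times. *)
pose e7 := e / 7; have e70 : 0 < e7 by rewrite divr_gt0.
have mR : 0 < m%:R :> R by rewrite ltr0n; nlia.
have th0 : 0 < th by lra.
have lth : 0 < ln th by rewrite ln_gt0.
pose Cth := 1 + (th - 1)^-1.
have Cth0 : 0 <= Cth by rewrite addr_ge0 // invr_ge0 subr_ge0 ltW.
pose C : R := 144 * m%:R ^+ 2.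
(* The constants are fixed in the order q, B, d, M, hh, each in terms of the earlier ones, and t is
   taken large at the end. *)
have [q0 q0E] := nat_ge e7^-1; pose q := (q0 + 2)%N.
have q2 : (2 <= q)%N by rewrite /q leq_addl.
have qR : 0 < q%:R :> R by rewrite ltr0n; nlia.
have qe : q%:R^-1 <= e7.
  by rewrite -[leRHS]invrK lef_pV2 ?posrE ?invr_gt0 //; apply: q0E; rewrite leq_addr.
pose B := Num.max 1 (Num.max (2 * Cth / eta / e7) (C * (2 * q%:R) * Cth / sg / e7)).
have B1 : 1 <= B by rewrite le_max lexx.
have B0 : 0 < B by lra.
have BU : 2 * (Cth / (eta * B)) <= e7.
  have : 2 * Cth / eta / e7 <= B by rewrite !le_max lexx /= orbT.
  rewrite ler_pdivrMr // => h; rewrite invfM !mulrA ler_pdivrMr // [e7 * B]mulrC; exact: h.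
have BW : C * (2 * q%:R) * (Cth / (sg * B)) <= e7.
  have : C * (2 * q%:R) * Cth / sg / e7 <= B by rewrite !le_max lexx !orbT.
  rewrite ler_pdivrMr // => h; rewrite invfM !mulrA ler_pdivrMr // [e7 * B]mulrC.
  by apply: le_trans h; rewrite !mulrA.
have [d dE] := nat_ge (expR ((beta - eta) * (th * B)) / 2).
pose s := beta * (rho / 2); have s0 : 0 < s by rewrite mulr_gt0 // divr_gt0.
pose Cd := 2 * m%:R * expR 1 / (m%:R * rho * discount m rho d).
have [M M0 ME] := small_powR Cd s0 e70.
pose g := growthexp m.
have [hh hhE] := small_exp2 (2 * (2 * M%:R) ^+ g / rho) e70.
have [N1 N1E] := nat_ge (2 * (2 * M%:R) ^+ g / (m%:R * rho) / e7).
(* This surplus, multiplied by log log t, makes room for the hh ancestor steps besides the 2 L steps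
   of the climb. *)
have yth' : 0 < y - 2 / ln th by rewrite subr_gt0 ltr_pdivrMr.
have ev : evR (fun x => [/\ th * B + ln 2 <= x, 2 * q%:R / ln th / e7 * (1 + x) <= expR (1 * x)
   & expR (hh%:R / (y - 2 / ln th)) <= x]).
  apply: evR_imp (evR_and (evR_ge (th * B + ln 2)) (evR_and (evR_expR (2 * q%:R / ln th / e7) ltr01)
    (evR_ge (expR (hh%:R / (y - 2 / ln th)))))) => x [? []]; by split.
have [N2 N2E] := evR_ln_nat ev.
exists (N1 + N2 + q + 2 * M)%N => t K Nt tK.
have tq : (q <= t)%N by nlia.
have tM : (2 * M <= t)%N by nlia.
have {ev N2E} [x1 x2 x3] := N2E t ltac:(nlia).
have {N1E} t1 := N1E t ltac:(nlia).
clear Nt; have tN : (0 < t)%N by nlia.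
have tR : 0 < t%:R :> R by rewrite ltr0n.
pose r := (t %/ q)%N; pose T := (t - r)%N.
have q0' : (0 < q)%N by nlia.
have r0 : (0 < r)%N by rewrite divn_gt0.
have rq : (r * q <= t)%N by exact: leq_divM.
have tr : (t <= 2 * q * r)%N.
  have := ltn_ceil t q0'; rewrite -/r mulSn.
  have : (q <= r * q)%N by rewrite leq_pmull.
  have -> : (2 * q * r = r * q + r * q)%N by ring.
  by nlia.
have r2 : (2 * r <= t)%N by apply: leq_trans rq; rewrite mulnC leq_mul2l q2 orbT.
have Tt : (T < t)%N by rewrite /T; nlia.
have rE : (t - T)%N = r by rewrite /T; nlia.
have t2T : (t <= 2 * T)%N by rewrite /T; nlia.
have T0 : (0 < T)%N by rewrite /T; nlia.
have TM : (M <= T)%N by rewrite /T; nlia.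
clearbody T.
have TR : 0 < T%:R :> R by rewrite ltr0n.
have rR : 0 < r%:R :> R by rewrite ltr0n.
have tT : t%:R <= 2 * T%:R :> R by rewrite -natrM ler_nat.
have Tt' : T%:R <= t%:R :> R by rewrite ler_nat ltnW.
have lnT : th * B <= ln T%:R.
  have : ln t%:R <= ln 2 + ln T%:R :> R by rewrite -lnM ?posrE // ler_ln ?posrE ?mulr_gt0.
  lra.
have lnTt : ln T%:R <= ln t%:R :> R by rewrite ler_ln ?posrE.
have lnT0 : 0 < ln T%:R :> R by apply: lt_le_trans lnT; rewrite mulr_gt0.
have [L [b [L0 Bb bB bL Ll]]] := geometric_position th1 B1 lnT.
have Llt : L%:R <= ln (ln t%:R) / ln th.
  rewrite ler_pdivlMr //; apply: le_trans Ll _; rewrite ler_ln ?posrE //; exact: lt_le_trans lnTt.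
have lnt0 : 0 < ln t%:R :> R by exact: lt_le_trans lnTt.
have KE : (hh + 2 * L <= K)%N.
  rewrite -(ler_nat R) natrD natrM; apply: le_trans tK.
  have : hh%:R <= (y - 2 / ln th) * ln (ln t%:R).
    by rewrite mulrC -ler_pdivrMr // -[leLHS]expRK ler_ln ?posrE ?expR_gt0.
  have : 2 * L%:R <= 2 / ln th * ln (ln t%:R) by rewrite -mulrA ler_pM2l // mulrC.
  lra.
pose a := (T %/ M)%N.
have a0 : (0 < a)%N by rewrite divn_gt0.
have aT : (a <= T)%N by exact: leq_div.
have AR : 0 < a%:R :> R by rewrite ltr0n.
have Ma : M%:R <= T%:R / a%:R :> R.
  by rewrite ler_pdivlMr // -natrM ler_nat mulnC; exact: leq_divM.
have aM : T%:R / a%:R <= 2 * M%:R :> R.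
  rewrite ler_pdivrMr // -!natrM ler_nat; have := ltn_ceil T M0; rewrite -/a mulSn.
  have : (M <= a * M)%N by rewrite leq_pmull.
  have -> : (2 * M * a = a * M + a * M)%N by ring.
  by nlia.
have Xd : hubX rho th eta b 0 <= d%:R.
  apply: le_trans (dE d (leqnn _)); rewrite /hubX ler_pM2r ?invr_gt0 // ler_expR /lexp expr0 mulr1.
  have be : 0 <= beta - eta.
    have : 0 < th * (1 - beta + eta) by rewrite mulr_gt0 //; lra.
    by move: sg0; rewrite /sg; lra.
  exact: ler_wpM2l.
have main := unreached_sum_le m2 rho0 rho1 th1 eta0 sg0 B1 Bb bL T0 (ltnW Tt) t2T L0 a0 aT Tt Xd KE.
rewrite rE -/sg -/Cth -/C in main.
rewrite ler_pdivrMr //; apply: le_trans main _.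
have G0 := discount_gt0 m2 rho0 d.
have p1 : r%:R <= e7 * t%:R.
  apply: le_trans (_ : q%:R^-1 * t%:R <= _); last by rewrite ler_pM2r.
  by rewrite mulrC ler_pdivlMr // -natrM ler_nat.
have p2 : (2 * (a * m)%:R + 2 ^+ hh.+1) * (T%:R / a%:R) ^+ growthexp m / (m%:R * rho * 2 ^+ hh) <= 2 * e7 * t%:R.
  have E0 : 0 < 2 ^+ hh :> R by exact: exprn_gt0.
  apply: (@le_trans _ _ ((2 * (a * m)%:R + 2 ^+ hh.+1) * (2 * M%:R) ^+ g / (m%:R * rho * 2 ^+ hh))).
    rewrite ler_pM2r ?invr_gt0 ?mulr_gt0 // ler_wpM2l ?addr_ge0 ?mulr_ge0 ?exprn_ge0 //.
    by rewrite lerXn2r ?nnegrE ?divr_ge0 ?mulr_ge0.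
  set P := (2 * M%:R) ^+ g in hhE t1 *; have P0 : 0 <= P by rewrite exprn_ge0 // mulr_ge0.
  have -> : (2 * (a * m)%:R + 2 ^+ hh.+1) * P / (m%:R * rho * 2 ^+ hh) =
     (2 * P / rho / 2 ^+ hh) * a%:R + 2 * P / (m%:R * rho).
    by rewrite natrM exprS; field; rewrite !gt_eqF.
  have aR : a%:R <= t%:R :> R by rewrite ler_nat (leq_trans aT) // ltnW.
  have -> : 2 * e7 * t%:R = e7 * t%:R + e7 * t%:R by ring.
  apply: lerD.
    apply: ler_pM => //; rewrite divr_ge0 ?exprn_ge0 // divr_ge0 ?mulr_ge0 // ltW //.
  by move: t1; rewrite ler_pdivrMr // mulrC [_ * e7]mulrC.
have p3 : 2 * (a * m)%:R * (expR 1 * (T%:R / a%:R) `^ (1 - beta * (rho / 2))) / (m%:R * rho * discount m rho d) <= e7 * t%:R.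
  have z0 : 0 < T%:R / a%:R :> R by rewrite divr_gt0.
  have zz : (T%:R / a%:R) `^ (1 - beta * (rho / 2)) = T%:R / a%:R * (T%:R / a%:R) `^ (- s).
    rewrite !powRE // -[X in _ = X * _](@lnK R) ?posrE // -expRD.
    by congr expR; rewrite /s; ring.
  rewrite zz; set Z := _ `^ (- s).
  have -> : 2 * (a * m)%:R * (expR 1 * (T%:R / a%:R * Z)) / (m%:R * rho * discount m rho d) = Cd * Z * T%:R.
    by rewrite natrM /Cd; move: (expR 1) => E; field; rewrite !gt_eqF.
  apply: ler_pM => //; last exact: ME.
  by rewrite mulr_ge0 ?powR_ge0 // divr_ge0 ?mulr_ge0 ?expR_ge0 // ?ltW // ?mulr_gt0.
have p4 : T%:R * (2 * (Cth / (eta * B)) + (L%:R + C * t%:R * (Cth / (sg * B))) / r%:R) <= 3 * e7 * t%:R.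
  have Lr : L%:R / r%:R <= e7.
    rewrite ler_pdivrMr //; apply: le_trans Llt _.
    have lnln : ln (ln t%:R) <= 1 + ln t%:R :> R by have := ln_le_sub1 lnt0; lra.
    apply: le_trans (_ : (1 + ln t%:R) / ln th <= _); first by rewrite ler_pM2r ?invr_gt0.
    move: x2; rewrite mul1r lnK ?posrE // => x2.
    have tqr : t%:R <= 2 * q%:R * r%:R :> R by rewrite -!natrM ler_nat.
    have h := le_trans x2 tqr.
    have q20 : 0 < 2 * q%:R :> R by rewrite mulr_gt0.
    have : (1 + ln t%:R) / ln th / e7 <= r%:R.
      rewrite -(ler_pM2l q20); apply: le_trans _ h.
      by rewrite le_eqVlt; apply/orP; left; apply/eqP; ring.
    by rewrite ler_pdivrMr // [r%:R * _]mulrC.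
  have Cr : C * t%:R * (Cth / (sg * B)) / r%:R <= e7.
    apply: le_trans BW; rewrite mulrAC ler_wpM2r //.
      by rewrite divr_ge0 // ltW // mulr_gt0.
    rewrite -mulrA ler_pM2l ?mulr_gt0 ?exprn_gt0 // ler_pdivrMr // -!natrM ler_nat.
    exact: tr.
  apply: (@le_trans _ _ (T%:R * (3 * e7))); last by rewrite mulrC ler_pM2l // mulr_gt0.
  by rewrite ler_pM2l // mulrDl; lra.
have -> : e * t%:R = e7 * t%:R + 2 * e7 * t%:R + e7 * t%:R + 3 * e7 * t%:R.
  by rewrite /e7; field.
by rewrite !lerD.
Qed.

End Upper.

(** * Convergence in probability from the two bounds *)

Local Open Scope classical_set_scope.
Local Open Scope ring_scope.

(** If both vertices reach 0 within K steps, the distance is finite and at most 2 K, so an atypical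
    value must be too small; a shortest path then has at most n0 edges. *)
Lemma atypical_dist (R : realType) (t m : nat) (l eps LL : R) (n0 K : nat) h (v w : 'I_t) :
  (1 < m)%N -> valid m h -> size h = (t * m)%N -> 0 < LL ->
  (4 / l - eps) * LL < n0.+1%:R -> (2 * K)%:R <= (4 / l + eps) * LL ->
  is_true (match pa_dist (config t m h) v w with
   | None => true
   | Some n => eps < `| n%:R / LL - 4 / l |
   end) ->
  [\/ joined m t v w n0 h, ~ reach t m h v 0 K | ~ reach t m h w 0 K].
Proof.
move=> m2 vh sz LL0 n0E KE.
have [rv|] := pselect (reach t m h v 0 K); last by move=> nr _; apply: Or32.
have [rw|] := pselect (reach t m h w 0 K); last by move=> nr _; apply: Or33.
have [n dn nK] := reach_pa_dist m2 vh sz (reach_trans rv (reach_sym rw)).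
rewrite dn => far; apply: Or31.
have {}nK : n%:R <= (4 / l + eps) * LL.
  by apply: le_trans KE; rewrite ler_nat mul2n -addnn.
have nE : n%:R < (4 / l - eps) * LL.
  move: nK; rewrite -ler_pdivrMr // -ltr_pdivrMr //; move: far.
  by case: (lerP 0 (n%:R / LL - 4 / l)) => s; [rewrite ger0_norm|rewrite ltr0_norm]; lra.
have nn0 : (n <= n0)%N by rewrite -ltnS -(ltr_nat R); exact: lt_trans n0E.
have [p [pp ap lp up sp]] := pa_dist_hpath m2 vh sz dn.
exists p; split=> //; first by case/andP: ap.
exact: leq_trans sp nn0.
Qed.

Theorem theorem1p6 (R : realType) (m : nat) (delta : R)
  (hm : (2 <= m)%N) (hd1 : - (m%:R) < delta) (hd2 : delta < 0) :
  let tau := 3 + delta / m%:R in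
  forall eps : R, 0 < eps ->
  (fun t : nat =>
     pa_prob delta (fun (xi : pa_config t m) (v1 v2 : 'I_t) =>
       match pa_dist xi v1 v2 with
       | None => true
       | Some h => eps < `| h%:R / ln (ln t%:R) - 4 / `| ln (tau - 2) | |
       end)) @ \oo --> (0 : R).
Proof.
move=> tau eps eps0; pose rho : R := 1 + delta / m%:R.
have mR : 0 < m%:R :> R by rewrite ltr0n (leq_trans _ hm).
have rho0 : 0 < rho by rewrite /rho -ltrBlDl sub0r ltr_pdivlMr // mulN1r.
have rho1 : rho < 1 by rewrite /rho gtrDl pmulr_llt0 ?invr_gt0.
have -> : tau - 2 = rho by rewrite /tau /rho; ring.
have l0 := l_gt0 rho0 rho1; set l := - ln rho in l0.
have -> : `|ln rho| = l by rewrite ltr0_norm // -oppr_gt0.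
(* The second term keeps x positive for large [eps]; both terms are below 4 / l. *)
pose x := Num.max (4 / l - eps) (2 / l).
have x0 : 0 < x by rewrite lt_max divr_gt0 ?orbT.
have xl : x * l < 4.
  rewrite -ltr_pdivlMr // gt_max ltrBlDr ltrDl eps0 /= ltr_pM2r ?invr_gt0 //; lra.
(* In 2 K this adds (eps / 2) log log t and rounding adds at most 2, so the total stays within the
   margin once log log t is at least 4 / eps. *)
pose y := 2 / l + eps / 4.
have y0 : 0 < y by rewrite addr_gt0 // divr_gt0.
have yl : 2 < y * l.
  by rewrite /y mulrDl mulfVK ?gt_eqF // ltrDl mulr_gt0 // divr_gt0.
apply/cvgrPdist_le => e e0.
pose e4 := e / 4; have e40 : 0 < e4 by rewrite divr_gt0.
have [N1 N1E] := lower_bound hm rho0 rho1 x0 xl e40.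
have [N2 N2E] := upper_vertex hm rho0 rho1 y0 yl e40.
have [N3 N3E] := evR_ln_nat (evR_ge (expR (4 / eps))).
have [N4 N4E] := nat_ge e4^-1.
exists (N1 + N2 + N3 + N4 + 1)%N => //= t; rewrite /mkset => Nt.
have t0 : (0 < t)%N by nlia.
have tR : 0 < t%:R :> R by rewrite ltr0n.
have {}N3E := N3E t ltac:(nlia); have {}N4E := N4E t ltac:(nlia).
set LL := ln (ln t%:R) in N1E N2E *.
have LLe : 4 / eps <= LL.
  by rewrite -[leLHS]expRK ler_ln ?posrE ?expR_gt0 //; apply: lt_le_trans N3E; exact: expR_gt0.
have LL0 : 0 < LL by apply: lt_le_trans LLe; rewrite divr_gt0.
pose n0 := Num.truncn (x * LL); pose K := (Num.truncn (y * LL)).+1.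
have xLL : 0 <= x * LL by rewrite mulr_ge0 // ltW.
have yLL : 0 <= y * LL by rewrite mulr_ge0 // ltW.
have /andP[n0l n0u] := truncn_itv xLL; rewrite -/n0 in n0l n0u.
have /andP[Kl Ku] := truncn_itv yLL; rewrite -/K in Ku.
have low := N1E t n0 ltac:(nlia) n0l.
have up := N2E t K ltac:(nlia) (ltW Ku).
have far1 : (4 / l - eps) * LL < n0.+1%:R.
  by apply: le_lt_trans n0u; rewrite ler_pM2r // le_max lexx.
have far2 : (2 * K)%:R <= (4 / l + eps) * LL.
  rewrite natrM /K -[(Num.truncn _).+1%:R]natr1; apply: (@le_trans _ _ (2 * (y * LL) + 2)).
    by rewrite mulrDr mulr1 lerD2r ler_pM2l.
  have : 4 <= LL * eps by rewrite -ler_pdivrMr.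
  rewrite /y; set i := l^-1; nra.
rewrite sub0r normrN (pa_prob_pexp hm rho0 rho1 _ (erefl rho)).
set A := fun v => pexp m rho (t * m) (fun h => `[< ~ reach t m h v 0 K >]%:R) [::] in up.
set J := fun v w : 'I_t => pexp m rho (t * m) (fun h => `[< joined m t v w n0 h >]%:R) [::].
have A0 v : 0 <= A v by apply: pexp_ge0.
pose far (v w : 'I_t) h : bool := match pa_dist (config t m h) v w with
     | None => true | Some n => eps < `| n%:R / LL - 4 / l | end.
have pt (v w : 'I_t) : pexp m rho (t * m) (fun h => (far v w h)%:R) [::] <=
     J v w + (A v + A w).
  rewrite -!pexpDf; apply: pexp_le => // h [vh _]; rewrite add0n => sz.
  move: (@atypical_dist R t m l eps LL n0 K h v w hm vh sz LL0 far1 far2).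
  rewrite -/(far v w h); case: (far v w h) => [/(_ isT)|_]; last by rewrite !addr_ge0.
  by case=> /asboolP ->; [rewrite lerDl|rewrite addrCA lerDl|rewrite addrA lerDr]; rewrite ?addr_ge0.
rewrite ger0_norm; last first.
  by apply: sumr_ge0 => v _; apply: sumr_ge0 => w _; rewrite divr_ge0 ?exprn_ge0 //; apply: pexp_ge0.
apply: (@le_trans _ _ (\sum_(v < t) \sum_(w < t) (J v w / t%:R ^+ 2 + (A v + A w) / t%:R ^+ 2))).
  apply: ler_sum => v _; apply: ler_sum => w _.
  rewrite -mulrDl ler_pM2r ?invr_gt0 ?exprn_gt0 //; exact: pt.
have -> : e = e4 + (2 * e4 + e4 + 0) by rewrite /e4; field.
under eq_bigr => v _ do rewrite big_split.
rewrite big_split /=; apply: lerD => //.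
have dbl := @double_sum_le R t (fun v w => A v + A w) A 0 t0.
apply: le_trans (dbl _) _; first by move=> v w; rewrite addr0 lerDl.
rewrite !lerD //; first by rewrite -mulrA ler_pM2l.
by rewrite -[leRHS]invrK lef_pV2 ?posrE ?invr_gt0.
Qed.
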